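(* Let $d\ge 1$ and let $N$ be a non-negative integer. (i) (Bargmann case) Let $\mu$ be a finite complex regular Borel measure on $\mathbb{C}^d$ with compact support. If the Toeplitz–Bargmann operator $T_\mu^{\mathcal F}$ has finite rank $N$, then $\mu$ is a linear combination of $N$ point masses, i.e. $\mu=\sum_{k=1}^N\lambda_k\delta_{z_k}$ with $\lambda_k\in\mathbb{C}$ and $z_k\in\mathbb{C}^d$. In particular, if $\mu$ is absolutely continuous with respect to Lebesgue measure, then $\mu=0$. (ii) (Bergman case) Let $\Omega\subset\mathbb{C}^d$ be a bounded connected domain and let $\mu$ be a finite complex regular Borel measure on $\Omega$ with compact support in $\Omega$. If the Toeplitz–Bergman operator $T_\mu^{\Omega}$ has finite rank $N$, then $\mu$ is a linear combination of $N$ point masses, i.e. $\mu=\sum_{k=1}^N\lambda_k\delta_{z_k}$ with $\lambda_k\in\mathbb{C}$ and $z_k\in\Omega$. In particular, if $\mu$ is absolutely continuous with respect to Lebesgue measure, then $\mu=0$.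
   Context: Let $dm$ be Lebesgue measure on $\mathbb{C}^d\cong\mathbb{R}^{2d}$ and $d\gamma(z)=(2\pi)^{-d}e^{-|z|^2/2}\,dm(z)$. The Bargmann space $\mathcal F^2$ is the closed subspace of $L^2(\mathbb{C}^d,\gamma)$ consisting of entire functions; its reproducing kernel is $P(z,w)=\exp(z\cdot\overline{w}/2)$, where $z\cdot\overline{w}=\sum_{j=1}^d z_j\overline{w_j}$. For a complex regular Borel measure $\mu$ on $\mathbb{C}^d$ with compact support, the Toeplitz–Bargmann operator $T_\mu^{\mathcal F}:\mathcal F^2\to\mathcal F^2$ is $$(T_\mu^{\mathcal F}u)(z)=\int_{\mathbb{C}^d}P(z,w)u(w)\,d\mu(w).$$ For a bounded connected domain $\Omega\subset\mathbb{C}^d$, the Bergman space $H^2(\Omega)$ is the closed subspace of holomorphic functions in $L^2(\Omega,dm)$, with Bergman (reproducing) kernel $B(z,w)$. For a complex regular Borel measure $\mu$ on $\Omega$ with compact support in $\Omega$, the Toeplitz–Bergman operator $T_\mu^\Omega:H^2(\Omega)\to H^2(\Omega)$ is $$(T_\mu^\Omega u)(z)=\int_\Omega B(z,w)u(w)\,d\mu(w),$$ equivalently $(T_\mu^\Omega u,v)_{H^2(\Omega)}=\int_\Omega u\overline{v}\,d\mu$ for $u,v\in H^2(\Omega)$. The rank of an operator is the dimension of its range. $\delta_a$ denotes the unit point mass at $a$. *)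

(* Defs.v *)
From HB Require Import structures.
From mathcomp Require Import all_boot all_order all_algebra.
From mathcomp Require Import complex.
From mathcomp Require Import all_classical all_reals all_analysis.
From mathcomp Require Import measurable_realfun.

Set Implicit Arguments.
Unset Strict Implicit.
Unset Printing Implicit Defensive.

Import Order.TTheory GRing.Theory Num.Theory.
Import numFieldNormedType.Exports.

Local Open Scope classical_set_scope.
Local Open Scope ring_scope.
Local Open Scope complex_scope.

HB.instance Definition _ (R : rcfType) := NormedModule.copy R[i] R[i]^o.

(* C^d is ['rV[R[i]]_d] with the Borel sigma-algebra. Its library norm is the
   sup norm; the Euclidean norm is only used through [sqnorm] below. *)
HB.instance Definition _ (R : realType) (d : nat) :=
  Measurable.copy 'rV[R[i]]_d (g_sigma_algebraType (@open 'rV[R[i]]_d)).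

Notation absC := ComplexField.Normc.normc.

Section borel_measurability.
Variable R : realType.

Lemma absC_Re (z : R[i]) : `|complex.Re z| <= absC z.
Proof.
case: z => a b /=; rewrite -sqrtr_sqr ler_sqrt ?addr_ge0 ?sqr_ge0//.
by rewrite lerDl sqr_ge0.
Qed.

Lemma absC_Im (z : R[i]) : `|complex.Im z| <= absC z.
Proof.
case: z => a b /=; rewrite -sqrtr_sqr ler_sqrt ?addr_ge0 ?sqr_ge0//.
by rewrite lerDr sqr_ge0.
Qed.

Lemma absC_le (z : R[i]) : absC z <= `|complex.Re z| + `|complex.Im z|.
Proof.
case: z => a b /=; rewrite -[leRHS]ger0_norm ?addr_ge0// -sqrtr_sqr.
rewrite ler_sqrt ?sqr_ge0// sqrrD !real_normK ?num_real//.
by rewrite addrAC lerDl mulrn_wge0// mulr_ge0.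
Qed.

Lemma normCE (z : R[i]) : `|z| = (absC z)%:C.
Proof. by []. Qed.

Lemma continuous_Re : continuous (@complex.Re R).
Proof.
move=> z; apply: (@cvgrPdist_lt _ _ _ (nbhs z) (nbhs_filter z) _ _).2 => e e0.
apply/nbhs_ballP; exists e%:C; first by rewrite /= ltcR.
move=> w; rewrite -ball_normE/= normCE ltcR; apply: le_lt_trans.
by apply: le_trans (absC_Re _); case: (z) (w) => [? ?] [? ?].
Qed.

Lemma continuous_Im : continuous (@complex.Im R).
Proof.
move=> z; apply: (@cvgrPdist_lt _ _ _ (nbhs z) (nbhs_filter z) _ _).2 => e e0.
apply/nbhs_ballP; exists e%:C; first by rewrite /= ltcR.
move=> w; rewrite -ball_normE/= normCE ltcR; apply: le_lt_trans.
by apply: le_trans (absC_Im _); case: (z) (w) => [? ?] [? ?].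
Qed.

Lemma continuous_borel_measurable n (f : 'rV[R[i]]_n -> R) :
  continuous f -> measurable_fun setT f.
Proof.
move=> /continuousP cf.
apply: (measurability _ (RGenOpens.measurableE R)) => _ [_ [a [b ->]] <-].
rewrite setTI; apply: sub_sigma_algebra; apply: cf.
exact: interval_open.
Qed.

Lemma measurable_Re_coord n (j : 'I_n) :
  measurable_fun setT (fun z : 'rV[R[i]]_n => complex.Re (z ord0 j)).
Proof.
apply: continuous_borel_measurable => z.
apply: (@continuous_comp _ _ _ (fun z : 'rV[R[i]]_n => z ord0 j) (@complex.Re R)).
  exact: coord_continuous.
exact: continuous_Re.
Qed.

Lemma measurable_Im_coord n (j : 'I_n) :
  measurable_fun setT (fun z : 'rV[R[i]]_n => complex.Im (z ord0 j)).
Proof.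
apply: continuous_borel_measurable => z.
apply: (@continuous_comp _ _ _ (fun z : 'rV[R[i]]_n => z ord0 j) (@complex.Im R)).
  exact: coord_continuous.
exact: continuous_Im.
Qed.

Definition rat_box n (p : {ffun 'I_n -> rat * rat} * nat) : set 'rV[R[i]]_n :=
  [set z | forall j, `|complex.Re (z ord0 j) - ratr (p.1 j).1| < p.2.+1%:R^-1
              /\ `|complex.Im (z ord0 j) - ratr (p.1 j).2| < p.2.+1%:R^-1].

Lemma open_bigcup_rat_box n (U : set 'rV[R[i]]_n) : open U ->
  U = \bigcup_(p in [set p | rat_box p `<=` U]) rat_box p.
Proof.
move=> oU; apply/seteqP; split => [z Uz|z [p /= pU pz]]; last exact: pU.
have /nbhs_ballP[e /= e0 zeU] : nbhs z U by exact: open_nbhs_nbhs.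
have Re0 : 0 < complex.Re e by move: e0; case: (e) => a b; rewrite ltcE/= => /andP[].
have eE : e = (complex.Re e)%:C.
  by move: e0; case: (e) => a b; rewrite ltcE/= => /andP[/eqP -> _].
pose k := Num.truncn (4 / complex.Re e).
have ke : k.+1%:R^-1 *+ 4 < complex.Re e.
  have := truncnS_gt (4 / complex.Re e); rewrite -/k => h.
  by rewrite -[ltLHS]mulr_natl ltr_pdivrMr// mulrC -ltr_pdivrMr.
have /choice[q Hq] : forall j : 'I_n, exists q : rat * rat,
    `|complex.Re (z ord0 j) - ratr q.1| < k.+1%:R^-1 /\
    `|complex.Im (z ord0 j) - ratr q.2| < k.+1%:R^-1.
  have approx (x : R) : exists q : rat, `|x - ratr q| < k.+1%:R^-1.
    have /rat_in_itvoo[q] : x - k.+1%:R^-1 < x + k.+1%:R^-1.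
      by rewrite ltrBlDr -addrA ltrDl addr_gt0// invr_gt0.
    rewrite in_itv/= => /andP[h1 h2]; exists q.
    by rewrite distrC ltr_distl h1 h2.
  move=> j; have [q1 h1] := approx (complex.Re (z ord0 j)).
  by have [q2 h2] := approx (complex.Im (z ord0 j)); exists (q1, q2).
exists ([ffun j => q j], k); last by move=> j; rewrite ffunE; exact: Hq.
move=> w /= wq; apply: zeU; split => // i j; rewrite (ord1 i) -ball_normE/=.
rewrite normCE eE ltcR; apply: le_lt_trans (absC_le _) _.
have tri (x y a r : R) : `|x - a| < r -> `|y - a| < r -> `|x - y| <= r *+ 2.
  move=> h1 h2; rewrite -(subrK a x) -addrA; apply: le_trans (ler_normD _ _) _.
  by rewrite mulr2n lerD// ?(ltW h1)// distrC ltW.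
have [h1 h2] := Hq j; have [h3 h4] := wq j.
rewrite ffunE in h3 h4.
have h5 := tri _ _ _ _ h1 h3; have h6 := tri _ _ _ _ h2 h4.
have -> : complex.Re (z ord0 j - w ord0 j)
    = complex.Re (z ord0 j) - complex.Re (w ord0 j).
  by case: (z _ _) (w _ _) => [? ?] [? ?].
have -> : complex.Im (z ord0 j - w ord0 j)
    = complex.Im (z ord0 j) - complex.Im (w ord0 j).
  by case: (z _ _) (w _ _) => [? ?] [? ?].
apply: le_lt_trans (lerD h5 h6) _.
by rewrite -mulrnDr.
Qed.

Lemma measurable_fun_rV d (T : measurableType d) n (f : T -> 'rV[R[i]]_n) :
  (forall j, measurable_fun setT (fun t => complex.Re (f t ord0 j))) ->
  (forall j, measurable_fun setT (fun t => complex.Im (f t ord0 j))) ->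
  measurable_fun setT f.
Proof.
move=> mRe mIm.
apply: (measurability (@open 'rV[R[i]]_n)) => // _ [U oU <-].
rewrite setTI (open_bigcup_rat_box oU) preimage_bigcup bigcup_mkcond.
apply: countable_bigcupT_measurable; first exact: countableP.
move=> p; case: ifPn => // _.
have -> : f @^-1` rat_box p = \bigcap_(j in [set: 'I_n])
    ((fun t => complex.Re (f t ord0 j)) @^-1`
       [set x | `|x - ratr (p.1 j).1| < p.2.+1%:R^-1] `&`
     (fun t => complex.Im (f t ord0 j)) @^-1`
       [set x | `|x - ratr (p.1 j).2| < p.2.+1%:R^-1]).
  by apply/seteqP; split => [t h j _|t h j]; [exact: h|exact: h].
have mball (a r : R) : measurable [set x : R | `|x - a| < r].
  have -> : [set x : R | `|x - a| < r] = `]a - r, a + r[%classic.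
    by apply/seteqP; split => x /=; rewrite in_itv/= -ltr_distl.
  exact: measurable_itv.
apply: fin_bigcap_measurable; first exact: finite_finset.
move=> j _; apply: measurableI.
  by rewrite -[X in measurable X]setTI; exact: mRe.
by rewrite -[X in measurable X]setTI; exact: mIm.
Qed.

End borel_measurability.

(* The library's canonical sigma-finite structure on [m1 \x m2] is only found
   for finite [m1] and [m2]. *)
Lemma sigma_finite_product d1 d2 (T1 : measurableType d1)
    (T2 : measurableType d2) (R : realType) (m1 : {measure set T1 -> \bar R})
    (m2 : {sigma_finite_measure set T2 -> \bar R}) :
  sigma_finite setT m1 -> sigma_finite setT (m1 \x m2)%E.
Proof.
move=> /sigma_finiteP[F [TF ndF Foo]].
have /sigma_finiteP[G [TG ndG Goo]] := sigma_finiteT m2.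
exists (fun n => F n `*` G n).
  rewrite -setXTT TF TG predeqE => -[x y]; split.
    move=> [/= [n _ Fnx] [k _ Gky]]; exists (maxn n k) => //; split.
    - by move: x Fnx; exact/subsetPset/ndF/leq_maxl.
    - by move: y Gky; exact/subsetPset/ndG/leq_maxr.
  by move=> [n _ []/= ? ?]; split; exists n.
move=> k; have [? ?] := Foo k; have [? ?] := Goo k.
split; first exact: measurableX.
by rewrite product_measure1E// lte_mul_pinfty// ge0_fin_numE.
Qed.

Section lebesgue_complex.
Variable R : realType.
Local Notation leb := (@lebesgue_measure R).

Definition consC n (p : measurableTypeR R * measurableTypeR R * 'rV[R[i]]_n) :
    'rV[R[i]]_n.+1 :=
  row_mx (p.1.1 +i* p.1.2)%:M p.2 : 'rV_(1 + n).

Definition unconsC n (z : 'rV[R[i]]_n.+1) :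
    measurableTypeR R * measurableTypeR R * 'rV[R[i]]_n :=
  (complex.Re (z ord0 ord0), complex.Im (z ord0 ord0),
   rsubmx (z : 'rV_(1 + n))).

Lemma consC_head n (p : measurableTypeR R * measurableTypeR R * 'rV[R[i]]_n) :
  consC p ord0 ord0 = p.1.1 +i* p.1.2.
Proof.
have -> : ord0 = lshift n (ord0 : 'I_1) :> 'I_(1 + n) by exact: val_inj.
by etransitivity; [exact: row_mxEl | rewrite mxE].
Qed.

Lemma consC_tail n (p : measurableTypeR R * measurableTypeR R * 'rV[R[i]]_n) j :
  consC p ord0 (lift ord0 j) = p.2 ord0 j.
Proof. by rewrite -rshift1; exact: row_mxEr. Qed.

Lemma consCK n : cancel (@consC n) (@unconsC n).
Proof.
by move=> [[x y] v]; rewrite /unconsC consC_head /consC row_mxKr.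
Qed.

Lemma measurable_consC n : measurable_fun setT (@consC n).
Proof.
apply: measurable_fun_rV => j.
- have [->|[j0 ->]] : j = ord0 \/ exists k, j = lift ord0 k.
    by case: (unliftP ord0 j) => [k ->|->]; [right; exists k|left].
    rewrite [X in measurable_fun _ X](_ : _ = fst \o fst).
      exact: measurableT_comp.
    by apply/funext => p /=; rewrite consC_head.
  rewrite [X in measurable_fun _ X](_ : _ =
    (fun z : 'rV[R[i]]_n => complex.Re (z ord0 j0)) \o snd).
    by apply: measurableT_comp => //; exact: measurable_Re_coord.
  by apply/funext => p /=; rewrite consC_tail.
- have [->|[j0 ->]] : j = ord0 \/ exists k, j = lift ord0 k.
    by case: (unliftP ord0 j) => [k ->|->]; [right; exists k|left].
    rewrite [X in measurable_fun _ X](_ : _ = snd \o fst).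
      exact: measurableT_comp.
    by apply/funext => p /=; rewrite consC_head.
  rewrite [X in measurable_fun _ X](_ : _ =
    (fun z : 'rV[R[i]]_n => complex.Im (z ord0 j0)) \o snd).
    by apply: measurableT_comp => //; exact: measurable_Im_coord.
  by apply/funext => p /=; rewrite consC_tail.
Qed.

Lemma measurable_unconsC n : measurable_fun setT (@unconsC n).
Proof.
apply/measurable_fun_pairP; split.
  apply/measurable_fun_pairP; split.
    exact: measurable_Re_coord.
  exact: measurable_Im_coord.
apply: measurable_fun_rV => j.
  have := @measurable_Re_coord R n.+1 (rshift 1 j).
  by congr measurable_fun; apply/funext => z /=; rewrite mxE.
have := @measurable_Im_coord R n.+1 (rshift 1 j).
by congr measurable_fun; apply/funext => z /=; rewrite mxE.
Qed.

Section step.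
Variables (n : nat) (m : {sigma_finite_measure set 'rV[R[i]]_n -> \bar R}).

(* Lebesgue measure on C x C^n transported to C^n.+1. *)
Definition lebesgueCS : set 'rV[R[i]]_n.+1 -> \bar R :=
  pushforward ((leb \x leb) \x m)%E (@consC n).

Let lebesgueCS0 : lebesgueCS set0 = 0%E.
Proof. by rewrite /lebesgueCS /pushforward preimage_set0 measure0. Qed.

Let lebesgueCS_ge0 A : (0 <= lebesgueCS A)%E.
Proof. by rewrite /lebesgueCS /pushforward; exact: measure_ge0. Qed.

Let lebesgueCS_sigma_additive : semi_sigma_additive lebesgueCS.
Proof. apply: measure_semi_sigma_additive; exact: measurable_consC. Qed.

HB.instance Definition _ := isMeasure.Build _ _ _
  lebesgueCS lebesgueCS0 lebesgueCS_ge0 lebesgueCS_sigma_additive.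

Let lebesgueCS_sigma_finite : sigma_finite setT lebesgueCS.
Proof.
have [F FT mF] : sigma_finite setT ((leb \x leb) \x m)%E.
  by do 2 apply: sigma_finite_product; exact: sigma_finiteT.
exists (fun k => @unconsC n @^-1` F k).
  by rewrite -preimage_bigcup -FT preimage_setT.
move=> k; have [mFk Foo] := mF k; split.
  by rewrite -[X in measurable X]setTI; exact: measurable_unconsC.
rewrite /lebesgueCS /pushforward -comp_preimage.
rewrite (_ : unconsC (n:=n) \o consC (n:=n) = id) ?preimage_id//.
by apply/funext => p /=; rewrite consCK.
Qed.

HB.instance Definition _ := Measure_isSigmaFinite.Build _ _ _
  lebesgueCS lebesgueCS_sigma_finite.

End step.

(* Lebesgue measure on C^n = R^2n, as an iterated product. *)
Fixpoint lebesgueC (n : nat) : {sigma_finite_measure set 'rV[R[i]]_n -> \bar R} :=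
  match n with
  | 0 => \d_(0 : 'rV[R[i]]_0) : {sigma_finite_measure set 'rV[R[i]]_0 -> \bar R}
  | n'.+1 => lebesgueCS (lebesgueC n')
  end.

End lebesgue_complex.

Section complex_measures.
Context d (T : measurableType d) (R : realType).
Implicit Types (mu : {charge set T -> \bar R[i]}) (nu : {charge set T -> \bar R}).

(* A complex measure is a charge with values in [\bar R[i]] (finite on
   measurable sets); its values on non-measurable sets are unconstrained. *)

Lemma fine_charge_cvg mu (F : (set T)^nat) :
  (forall k, measurable (F k)) -> trivIset setT F ->
  (fun n => \sum_(0 <= k < n) fine (mu (F k))) @ \oo -->
    fine (mu (\bigcup_k F k)).
Proof.
move=> mF tF.
have mU : measurable (\bigcup_k F k) by exact: bigcupT_measurable.
have H := charge_semi_sigma_additive F mF tF mU.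
move=> A nA.
have fin B : measurable B -> mu B = (fine (mu B))%:E.
  by move=> mB; rewrite fineK// fin_num_measure.
have : nbhs (mu (\bigcup_k F k)) (fine @^-1` A) by rewrite (fin _ mU).
move=> /H HA; apply: (@filterS _ \oo _ _ _ _ HA) => n /=.
rewrite (eq_bigr (fun k => (fine (mu (F k)))%:E)) ?sumEFin//.
by move=> k _; exact: fin.
Qed.

Definition charge_Re mu (A : set T) : \bar R := (complex.Re (fine (mu A)))%:E.

Definition charge_Im mu (A : set T) : \bar R := (complex.Im (fine (mu A)))%:E.

Section charge_Re_Im.
Variable mu : {charge set T -> \bar R[i]}.

Let charge_Re0 : charge_Re mu set0 = 0%E.
Proof. by rewrite /charge_Re charge0. Qed.

Let charge_Re_fin (A : set T) : measurable A -> charge_Re mu A \is a fin_num.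
Proof. by []. Qed.

Let charge_Re_sigma_additive : semi_sigma_additive (charge_Re mu).
Proof.
move=> F mF tF mU; rewrite /charge_Re.
under eq_fun do rewrite sumEFin.
apply: cvg_EFin; first by apply: nearW.
have := cvg_comp _ _ (fine_charge_cvg (mu := mu) mF tF) (@continuous_Re R _).
apply: cvg_trans; apply: near_eq_cvg; apply: nearW => n /=.
by apply: (big_morph (@complex.Re R)) => // -[? ?] [? ?].
Qed.

HB.instance Definition _ := isCharge.Build _ _ _ (charge_Re mu)
  charge_Re0 charge_Re_fin charge_Re_sigma_additive.

Let charge_Im0 : charge_Im mu set0 = 0%E.
Proof. by rewrite /charge_Im charge0. Qed.

Let charge_Im_fin (A : set T) : measurable A -> charge_Im mu A \is a fin_num.
Proof. by []. Qed.

Let charge_Im_sigma_additive : semi_sigma_additive (charge_Im mu).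
Proof.
move=> F mF tF mU; rewrite /charge_Im.
under eq_fun do rewrite sumEFin.
apply: cvg_EFin; first by apply: nearW.
have := cvg_comp _ _ (fine_charge_cvg (mu := mu) mF tF) (@continuous_Im R _).
apply: cvg_trans; apply: near_eq_cvg; apply: nearW => n /=.
by apply: (big_morph (@complex.Im R)) => // -[? ?] [? ?].
Qed.

HB.instance Definition _ := isCharge.Build _ _ _ (charge_Im mu)
  charge_Im0 charge_Im_fin charge_Im_sigma_additive.

End charge_Re_Im.

Definition hahn_pos nu : set T := sval (cid (Hahn_decomposition nu)).

Definition hahn_neg nu : set T := sval (cid (svalP (cid (Hahn_decomposition nu)))).

Definition hahn_posneg nu : hahn_decomposition nu (hahn_pos nu) (hahn_neg nu) :=
  svalP (cid (svalP (cid (Hahn_decomposition nu)))).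

(* By uniqueness of the Jordan decomposition, this does not depend on the
   chosen Hahn decomposition. *)
Definition charge_integral nu (D : set T) (f : T -> R) : R :=
  \int[jordan_pos (hahn_posneg nu)]_(x in D) f x -
  \int[jordan_neg (hahn_posneg nu)]_(x in D) f x.

Definition cmeasure_integral mu (D : set T) (f : T -> R[i]) : R[i] :=
  let fr x := complex.Re (f x) in
  let fi x := complex.Im (f x) in
  (charge_integral (charge_Re mu) D fr - charge_integral (charge_Im mu) D fi) +i*
  (charge_integral (charge_Re mu) D fi + charge_integral (charge_Im mu) D fr).

Definition Cintegral (m : {measure set T -> \bar R}) (D : set T)
    (f : T -> R[i]) : R[i] :=
  (\int[m]_(x in D) complex.Re (f x)) +i* (\int[m]_(x in D) complex.Im (f x)).

(* Supremum over the countable measurable partitions of [A]. *)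
Definition total_variation mu (A : set T) : \bar R :=
  ereal_sup [set (\sum_(0 <= k <oo) (absC (fine (mu (F k))))%:E)%E | F in
    [set F : (set T)^nat | [/\ forall k, measurable (F k), trivIset setT F
                             & \bigcup_k F k = A]]].

(* The library's [\d_a] takes values in [\bar R] for a real field [R] only. *)
Definition point_mass (a : T) (A : set T) : \bar R[i] := (\1_A a)%:E.

End complex_measures.

Section complex_borel_measures.
Variables (R : realType) (d : nat).
Local Notation Cd := 'rV[R[i]]_d.
Implicit Type mu : {charge set Cd -> \bar R[i]}.

Definition regular_cmeasure mu := forall A : set Cd, measurable A ->
  total_variation mu A =
    ereal_inf [set total_variation mu U | U in [set U | open U /\ A `<=` U]] /\
  total_variation mu A =
    ereal_sup [set total_variation mu K | K in [set K | compact K /\ K `<=` A]].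

Definition cmeasure_support mu : set Cd :=
  [set z | forall U, open_nbhs z U -> total_variation mu U != 0%E].

(* A complex measure on [O] is represented by its extension by 0 to C^d. *)
Definition carried_by mu (O : set Cd) := total_variation mu (~` O) = 0%E.

Definition abs_continuous_lebesgue mu := forall A : set Cd, measurable A ->
  lebesgueC R d A = 0%E -> mu A = 0%E.

End complex_borel_measures.

Section gaussian.
Variables (R : realType) (d : nat).
Local Notation Cd := 'rV[R[i]]_d.

Definition sqnorm (z : Cd) : R := \sum_(j < d) absC (z ord0 j) ^+ 2.

Definition gaussian_density (z : Cd) : R :=
  (2 * pi) ^- d * expR (- sqnorm z / 2).

Definition gaussianC (A : set Cd) : \bar R :=
  (\int[lebesgueC R d]_(z in A) (gaussian_density z)%:E)%E.

Lemma measurable_gaussian_density : measurable_fun setT gaussian_density.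
Proof.
rewrite /gaussian_density; apply: measurable_funM => //.
apply: measurableT_comp => //; apply: measurable_funM => //.
apply: measurableT_comp => //.
have -> : sqnorm = fun z => \sum_(j < d)
    (complex.Re (z ord0 j) ^+ 2 + complex.Im (z ord0 j) ^+ 2).
  apply/funext => z; apply: eq_bigr => j _.
  by case: (z _ _) => a b /=; rewrite sqr_sqrtr// addr_ge0// sqr_ge0.
apply: measurable_sum => j; apply: measurable_funD.
  by apply: measurable_funX; exact: measurable_Re_coord.
by apply: measurable_funX; exact: measurable_Im_coord.
Qed.

Lemma gaussian_density_ge0 z : 0 <= gaussian_density z.
Proof. by rewrite mulr_ge0 ?expR_ge0// invr_ge0 exprn_ge0// mulr_ge0// pi_ge0. Qed.

Let gaussianC0 : gaussianC set0 = 0%E.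
Proof. by rewrite /gaussianC integral_set0. Qed.

Let gaussianC_ge0 A : (0 <= gaussianC A)%E.
Proof. by apply: integral_ge0 => z _; rewrite lee_fin gaussian_density_ge0. Qed.

Let gaussianC_sigma_additive : semi_sigma_additive gaussianC.
Proof.
move=> F mF tF mU; rewrite /gaussianC ge0_integral_bigcup//; last 2 first.
- apply/measurable_EFinP; apply: measurable_funTS.
  exact: measurable_gaussian_density.
- by move=> z _; rewrite lee_fin gaussian_density_ge0.
apply: is_cvg_ereal_nneg_natsum_cond => n _ _.
exact: gaussianC_ge0.
Qed.

HB.instance Definition _ := isMeasure.Build _ _ _
  gaussianC gaussianC0 gaussianC_ge0 gaussianC_sigma_additive.

End gaussian.

Section toeplitz.
Variables (R : realType) (d : nat).
Local Notation C := R[i].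
Local Notation Cd := 'rV[R[i]]_d.
Implicit Types (u v : Cd -> C) (O : set Cd).

Definition expC (z : C) : C :=
  (expR (complex.Re z))%:C * (cos (complex.Im z) +i* sin (complex.Im z)).

Definition hdot (z w : Cd) : C := \sum_(j < d) z ord0 j * (w ord0 j)^*.

Definition bargmann_kernel (z w : Cd) : C := expC (hdot z w / 2).

Definition bargmann_space : set (Cd -> C) :=
  [set u | (forall z, differentiable u z) /\
           (\int[@gaussianC R d]_z (absC (u z) ^+ 2)%:E < +oo)%E].

(* Functions on [O] are represented by their extension by 0 to C^d, so that
   [bergman_space O] is a subspace of [Cd -> C] isomorphic to H^2(O). *)
Definition bergman_space O : set (Cd -> C) :=
  [set u | [/\ forall z, O z -> differentiable u z,
               forall z, ~ O z -> u z = 0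
             & (\int[lebesgueC R d]_(z in O) (absC (u z) ^+ 2)%:E < +oo)%E]].

Definition bergman_inner O u v : C :=
  Cintegral (lebesgueC R d) O (fun z => u z * (v z)^*).

(* The reproducing property determines [B] on C^d x [O]. *)
Definition is_bergman_kernel O (B : Cd -> Cd -> C) := forall w, O w ->
  bergman_space O (B ^~ w) /\
  forall u, bergman_space O u -> u w = bergman_inner O u (B ^~ w).

Definition toeplitz (K : Cd -> Cd -> C) (O : set Cd)
    (mu : {charge set Cd -> \bar C}) u : Cd -> C :=
  fun z => cmeasure_integral mu O (fun w => K z w * u w).

End toeplitz.

Definition has_dimension (K : fieldType) (V : lmodType K) (E : set V) (N : nat) :=
  exists e : 'I_N -> V,
    (forall c : 'I_N -> K, \sum_(k < N) c k *: e k = 0 -> forall k, c k = 0) /\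
    E = [set \sum_(k < N) c k *: e k | c in [set: 'I_N -> K]].

Definition has_rank (K : fieldType) (V : lmodType K) (H : set V) (T : V -> V)
    (N : nat) := has_dimension (T @` H) N.

(* Main.v *)
(* Let L h be the integral of h against mu over K = supp mu, let n = N + 1, and let
   E be the algebra spanned by the exponentials w |-> exp(a.w). If u is in E and
   T u = 0, then L (u conj(g)) = 0 for all g in E: in the Bargmann case conj(g) is
   a combination of kernel functions P(z, .), and in the Bergman case g is
   approximated by functions orthogonal to u, boundedly on K and pointwise. So if T
   has rank N, all determinants det (L (f_i conj(g_j))) of size n vanish.
   Expanding them, the n-th tensor power of L vanishes on
   det(f_i(z_j)) conj(det(g_i(z_j))) Phi(z) when Phi is a product of functions
   a(z_j) conj(b(z_j)) with a, b in E, hence, by Stone-Weierstrass on K^n modulo the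
   symmetric group, for all symmetric continuous Phi, and then, by symmetrizing,
   for all Phi = h_1(z_1)...h_n(z_n). If n distinct points p_k were in the support
   of L, one could take f = g a Lagrange basis at these points and h_k supported
   near p_k and nearly norming for L, which is a contradiction. *)

Require Import Defs.
From HB Require Import structures.
From mathcomp Require Import all_boot all_order all_algebra all_fingroup.
From mathcomp Require Import complex ring lra.
From mathcomp Require Import all_classical all_reals all_analysis.
From mathcomp Require Import measurable_realfun.

Set Implicit Arguments.
Unset Strict Implicit.
Unset Printing Implicit Defensive.

Import Order.TTheory GRing.Theory Num.Theory.
Import numFieldNormedType.Exports.

Local Open Scope classical_set_scope.
Local Open Scope ring_scope.
Local Open Scope complex_scope.

(** * The Stone-Weierstrass theorem *)

(** Exponentials form a convenient algebra: their products are exponentials, their squared moduli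
    lead to Gaussian integrals, and every conjugate of one is a Bargmann kernel function. The
    vanishing determinants only control factors that are the same in every variable, since only
    these can be absorbed into the f_i and g_j. Hence the detour through symmetric functions; it
    loses nothing, because the weight det(f_i(z_j)) conj(det(g_i(z_j))) is symmetric too. The final
    contradiction is quantitative: near the points p_k the weight is within 2^-(n+1) of 1, while the
    nearly norming h_k lose at most a factor 2 each, 2^-n in total. In the Bergman case the kernel
    is known only through its reproducing property, and T u = 0 says that u is orthogonal, for L, to
    all kernel functions. A minimizing sequence plays the part of an orthogonal projection. Its
    boundedness on K requires point values to be controlled by L2 norms, which is derived from
    Goursat's theorem through a rough Cauchy formula on rectangles whose winding integral is merely
    bounded below. *)

Lemma compact_directed (T : topologicalType) (K : set T) (I : Type) (D : set I)
    (Q : I -> T -> Prop) :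
  compact K -> D !=set0 ->
  (forall i j, D i -> D j -> exists2 k, D k & forall z, Q i z \/ Q j z -> Q k z) ->
  (forall z, K z -> exists2 i, D i & \forall z' \near z, Q i z') ->
  exists2 i, D i & forall z, K z -> Q i z.
Proof.
move=> cK [i0 Di0] dir loc.
(* [F] is the filter of tails of the directed family; through it the near-covering form of
   compactness replaces the choice of a finite subcover. *)
pose F : set_system I := [set S | exists2 i, D i &
  forall k, D k -> (forall z, Q i z -> Q k z) -> S k].
have FF : Filter F.
  split.
  - by exists i0.
  - move=> A B [i Di iA] [j Dj jB]; have [k Dk ijk] := dir _ _ Di Dj.
    exists k => // l Dl kl; split.
      by apply: iA => // z iz; apply: kl; apply: ijk; left.
    by apply: jB => // z iz; apply: kl; apply: ijk; right.
  - by move=> A B AB [i Di iA]; exists i => // k Dk ik; exact/AB/iA.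
have := (compact_near_coveringP K).1 cK I F (fun i z => Q i z) FF.
case.
  move=> z Kz; have [i Di iz] := loc z Kz.
  exists ([set z' | Q i z'], [set k | forall z, Q i z -> Q k z]).
    by split => //; exists i.
  by move=> [z' k] /= [q]; apply.
by move=> i Di H; exists i => //; apply: H.
Qed.

Section stone_weierstrass.
Variables (R : realType) (T : topologicalType) (X : set T).

Definition uniformly_close (A : set (T -> R)) (f : T -> R) :=
  forall e, 0 < e -> exists2 a, A a & forall x, X x -> `|f x - a x| <= e.

(** The classical iteration towards |t|. Its iterates are polynomials in [t], so they stay in any
    algebra that contains the constants. *)
Fixpoint abs_iter (t : R) (k : nat) : R :=
  if k is k'.+1 then abs_iter t k' + (t ^+ 2 - abs_iter t k' ^+ 2) / 2 else 0.

(* The error [e_k = |t| - abs_iter t k] satisfies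
   [e_(k+1) = e_k (1 - (|t| + abs_iter t k) / 2) <= e_k (1 - e_k / 2)]. *)
Lemma abs_iterP (t : R) (k : nat) : `|t| <= 1 ->
  0 <= abs_iter t k <= `|t| /\ `|t| - abs_iter t k <= 2 / k.+2%:R.
Proof.
move=> t1; have t0 := normr_ge0 t; elim: k => [|k [/andP[IH0 IH1] IH2]] /=.
  by rewrite lexx t0 subr0 divff.
have -> : t ^+ 2 = `|t| ^+ 2 by rewrite real_normK// num_real.
move: (abs_iter t k) IH0 IH1 IH2 => q IH0 IH1 IH2.
move: `|t| t0 t1 IH1 IH2 => s t0 t1 IH1 IH2.
split; first by apply/andP; split; nra.
have k0 : 0 <= k%:R :> R by [].
have E2 : k.+2%:R = k%:R + 2 :> R by rewrite -addn2 natrD.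
have E3 : k.+3%:R = k%:R + 3 :> R by rewrite -addn3 natrD.
rewrite E2 in IH2; rewrite E3; set x := k%:R in k0 IH2 *.
set b := 2 / (x + 2) in IH2.
have b0 : 0 <= b by rewrite divr_ge0//; lra.
have b1 : b <= 1 by rewrite ler_pdivrMr; lra.
(* The function x (1 - x / 2) increases on [0, 1], an interval that contains both the error and its
   bound [b]. *)
apply: (@le_trans _ _ (b * (1 - b / 2))); first by nra.
rewrite ler_pdivlMr; last by lra.
have xb : (x + 2) * b = 2 by rewrite /b; field; lra.
nra.
Qed.

Variable A : set (T -> R).
Hypothesis cX : compact X.
Hypothesis A_cst : forall c, A (fun=> c).
Hypothesis A_add : forall f g, A f -> A g -> A (fun x => f x + g x).
Hypothesis A_mul : forall f g, A f -> A g -> A (fun x => f x * g x).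
Hypothesis A_cont : forall f, A f -> continuous f.

Lemma continuous_compact_bound (f : T -> R) : (forall x, X x -> f @ x --> f x) ->
  exists2 M, 0 < M & forall x, X x -> `|f x| <= M.
Proof.
move=> cf.
have [|M N /= M0 N0|z Xz|M M0 H] := @compact_directed _ X R [set M | 0 < M]
  (fun M x => `|f x| <= M) cX; last by exists M.
- by exists 1 => /=.
- exists (Num.max M N); first by rewrite lt_max M0.
  by move=> z [h|h]; rewrite le_max h ?orbT.
- exists (`|f z| + 1) => /=; first by rewrite ltr_wpDl.
  have /cvgrPdist_le/(_ 1 ltr01) := cf z Xz.
  apply: filterS => y h.
  rewrite -lerBlDl (le_trans _ h)// distrC.
  by apply: lerB_dist.
Qed.

Local Notation Abar := (uniformly_close A).

Lemma closure_self f : A f -> Abar f.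
Proof. by move=> Af e e0; exists f => // x _; rewrite subrr normr0 ltW. Qed.

Lemma closure_add f g : Abar f -> Abar g -> Abar (fun x => f x + g x).
Proof.
move=> Hf Hg e e0; have e2 : 0 < e / 2 by rewrite divr_gt0.
have [a Aa ha] := Hf _ e2; have [b Ab hb] := Hg _ e2.
exists (fun x => a x + b x); first exact: A_add.
move=> x Xx; rewrite opprD addrACA (splitr e).
by apply: le_trans (ler_normD _ _) _; rewrite lerD ?ha ?hb.
Qed.

Lemma closure_scale c f : Abar f -> Abar (fun x => c * f x).
Proof.
move=> Hf e e0; have c1 : 0 < `|c| + 1 by rewrite ltr_wpDl.
have [a Aa ha] := Hf (e / (`|c| + 1)) (divr_gt0 e0 c1).
exists (fun x => c * a x); first exact: A_mul.
move=> x Xx; rewrite -mulrBr normrM.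
apply: (@le_trans _ _ ((`|c| + 1) * (e / (`|c| + 1)))).
  by apply: ler_pM => //; [rewrite lerDl|exact: ha].
by rewrite mulrC divfK// gt_eqF.
Qed.

(** The iterates [abs_iter] converge to the absolute value uniformly on [-1, 1] only, so the
    approximant [a] is first divided by a bound [M] for it on [X]. *)
Lemma closure_abs f : Abar f -> Abar (fun x => `|f x|).
Proof.
move=> Hf e e0; have e2 : 0 < e / 2 by rewrite divr_gt0.
have [a Aa ha] := Hf _ e2.
have [M M0 hM] := continuous_compact_bound (fun x _ => A_cont Aa (x := x)).
(* So many iterations bring the rate 2 / (k + 2), scaled back by [M], below e / 2. *)
pose k := Num.truncn (M * 4 / e).
have ke : M * (2 / k.+2%:R) <= e / 2.
  have := truncnS_gt (M * 4 / e); rewrite -/k ltr_pdivrMr// => h.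
  rewrite mulrA ler_pdivrMr//; have : k.+1%:R <= k.+2%:R :> R by rewrite ler_nat.
  by move=> h'; nra.
have Ak j : A (fun x => abs_iter (M^-1 * a x) j).
  elim: j => [|j IH] /=; first exact: A_cst.
  apply: A_add => //; have -> : (fun x => ((M^-1 * a x) ^+ 2 -
      abs_iter (M^-1 * a x) j ^+ 2) / 2) = (fun x => ((M^-1 * a x) * (M^-1 * a x) +
      (- 1) * (abs_iter (M^-1 * a x) j * abs_iter (M^-1 * a x) j)) * 2^-1).
    by apply/funext => x; rewrite !expr2 mulN1r.
  apply: A_mul => //; apply: A_add; last by apply: A_mul => //; exact: A_mul.
  by apply: A_mul; exact: A_mul.
exists (fun x => M * abs_iter (M^-1 * a x) k); first by apply: A_mul => //.
move=> x Xx.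
have aM1 : `|M^-1 * a x| <= 1.
  by rewrite normrM gtr0_norm ?invr_gt0// ler_pdivrMl// mulr1 hM.
have [/andP[h0 h1] h2] := abs_iterP k aM1.
have aME : `|a x| = M * `|M^-1 * a x|.
  by rewrite normrM gtr0_norm ?invr_gt0// mulrA divff ?mul1r// gt_eqF.
rewrite -(subrK `|a x| `|f x|) -addrA (splitr e).
apply: le_trans (ler_normD _ _) _; apply: lerD.
  exact: le_trans (ler_dist_dist _ _) (ha _ Xx).
rewrite aME -mulrBr normrM (gtr0_norm M0) ger0_norm ?subr_ge0//.
by apply: le_trans ke; rewrite ler_pM2l.
Qed.

Lemma closure_max f g : Abar f -> Abar g -> Abar (fun x => Num.max (f x) (g x)).
Proof.
move=> Hf Hg; have -> : (fun x => Num.max (f x) (g x)) =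
    (fun x => 2^-1 * ((f x + g x) + `|f x + (- 1) * g x|)).
  by apply/funext => x; rewrite maxr_absE mulN1r mulrC.
apply: closure_scale; apply: closure_add; first exact: closure_add.
by apply: closure_abs; apply: closure_add => //; exact: closure_scale.
Qed.

Lemma closure_min f g : Abar f -> Abar g -> Abar (fun x => Num.min (f x) (g x)).
Proof.
move=> Hf Hg; have -> : (fun x => Num.min (f x) (g x)) =
    (fun x => (- 1) * Num.max (- 1 * f x) (- 1 * g x)).
  by apply/funext => x; rewrite !mulN1r -oppr_min opprK.
by apply: closure_scale; apply: closure_max; exact: closure_scale.
Qed.

(* Stone's form of the theorem: [A] need not separate points, it is enough that
   it separates the points separated by [f]. *)
Theorem stone_weierstrass (f : T -> R) : continuous f ->
  (forall x y, X x -> X y -> f x <> f y -> exists2 a, A a & a x <> a y) ->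
  uniformly_close A f.
Proof.
move=> cf sep.
have interp x y : X x -> X y -> exists2 a, A a & a x = f x /\ a y = f y.
  move=> Xx Xy; have [fxy|/eqP fxy] := eqVneq (f x) (f y).
    by exists (fun=> f x).
  have [a Aa /eqP axy] := sep _ _ Xx Xy fxy.
  exists (fun z => f x + ((f y - f x) / (a y - a x)) * (a z + - a x)).
    by apply: A_add => //; apply: A_mul => //; exact: A_add.
  by rewrite subrr mulr0 addr0 divfK ?subr_eq0 1?eq_sym// subrKC.
have near_gt (a : T -> R) z e : continuous a -> a z = f z -> 0 < e ->
    \forall z' \near z, `|a z' - f z'| < e.
  move=> ca az e0.
  have : (fun x => a x - f x) @ z --> a z - f z by apply: cvgB; [exact: ca|exact: cf].
  rewrite az subrr => /cvgrPdist_lt/(_ e e0); apply: filterS => y.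
  by rewrite sub0r normrN.
move=> e e0.
have e2 : 0 < e / 2 by rewrite divr_gt0.
(* First compactness pass: maxima of functions that interpolate [f] at [x] and at a second point
   exceed f - e / 2 on all of [X] and stay below f + e / 2 near [x]. The second pass takes minima of
   such functions over [x]. *)
have step x : X x -> exists2 g, Abar g & (forall z, X z -> f z - e / 2 < g z) /\
    \forall z \near x, g z < f z + e / 2.
  move=> Xx.
  have [|h h' [Ah hx] [Ah' h'x]|y Xy|g [Ag gx] H] := @compact_directed _ X (T -> R)
      [set g | Abar g /\ \forall z \near x, g z < f z + e / 2]
      (fun g z => f z - e / 2 < g z) cX.
  - exists (fun=> f x); split; first exact: closure_self (A_cst _).
    have := near_gt (fun=> f x) x _ (A_cont (A_cst _)) erefl e2.
    by apply: filterS => z; rewrite ltr_distl => /andP[_].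
  - exists (fun z => Num.max (h z) (h' z)).
      split; first exact: closure_max.
      by apply: filterS2 hx h'x => z hz h'z; rewrite gt_max hz.
    by move=> z [] hz; rewrite lt_max hz ?orbT.
  - have [a Aa [ax ay]] := interp x y Xx Xy.
    exists a.
      split; first exact: closure_self Aa.
      have := near_gt a x _ (A_cont Aa) ax e2.
      by apply: filterS => z; rewrite ltr_distl => /andP[_].
    have := near_gt a y _ (A_cont Aa) ay e2.
    by apply: filterS => z; rewrite ltr_distl => /andP[].
  - by exists g => //; split.
have [X0|/set0P[x0 Xx0]] := eqVneq X set0.
  by exists (fun=> 0) => // x; rewrite X0.
have [|h h' Dh Dh'|y Xy|g [Ag gf] H] := @compact_directed _ X (T -> R)
    [set g | Abar g /\ forall z, X z -> f z - e / 2 < g z]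
    (fun g z => g z < f z + e / 2) cX.
- by have [g Ag [gf _]] := step _ Xx0; exists g.
- case: Dh Dh' => [Ah hx] [Ah' h'x]; exists (fun z => Num.min (h z) (h' z)).
    split; first exact: closure_min.
    by move=> z Xz; rewrite lt_min hx ?h'x.
  by move=> z [] hz; rewrite gt_min hz ?orbT.
- by have [g Ag [gf gy]] := step _ Xy; exists g.
- have [a Aa ha] := Ag _ e2; exists a => // x Xx.
  rewrite (splitr e) -(subrK (g x) (f x)) -addrA.
  apply: le_trans (ler_normD _ _) _; apply: lerD; last exact: ha.
  by rewrite distrC ler_distl ltW ?gf// ltW// H.
Qed.

End stone_weierstrass.

(** * Tensor powers of a functional *)

Section complex_modulus.
Variable R : realType.
Implicit Types z w : R[i].

Lemma absC_ge0 z : 0 <= absC z.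
Proof. by case: z => a b; exact: sqrtr_ge0. Qed.

Lemma absC0 : absC (0 : R[i]) = 0.
Proof. exact: ComplexField.Normc.normc0. Qed.

Lemma absC1 : absC (1 : R[i]) = 1.
Proof. exact: ComplexField.Normc.normc1. Qed.

Lemma absCM z w : absC (z * w) = absC z * absC w.
Proof. exact: ComplexField.Normc.normcM. Qed.

Lemma absCV z : absC z^-1 = (absC z)^-1.
Proof. exact: ComplexField.Normc.normcV. Qed.

Lemma absCD z w : absC (z + w) <= absC z + absC w.
Proof. exact: le_normcD. Qed.

Lemma absCN z : absC (- z) = absC z.
Proof. exact: normcN. Qed.

Lemma absCB z w : absC (z - w) = absC (w - z).
Proof. by rewrite -absCN opprB. Qed.

Lemma absC_eq0 z : (absC z == 0) = (z == 0).
Proof.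
apply/eqP/eqP => [|->]; last exact: absC0.
exact: ComplexField.Normc.eq0_normc.
Qed.

Lemma absC_gt0 z : (0 < absC z) = (z != 0).
Proof. by rewrite lt_def absC_ge0 andbT absC_eq0. Qed.

Lemma absC_real (x : R) : absC x%:C = `|x|.
Proof. by rewrite /= expr0n/= addr0 sqrtr_sqr. Qed.

Lemma absCJ z : absC (conjc z) = absC z.
Proof. by case: z => a b /=; rewrite sqrrN. Qed.

Lemma absC_prod I (s : seq I) (P : pred I) (F : I -> R[i]) :
  absC (\prod_(i <- s | P i) F i) = \prod_(i <- s | P i) absC (F i).
Proof. exact: (big_morph _ absCM absC1). Qed.

Lemma conjcM z w : conjc (z * w) = conjc z * conjc w.
Proof. exact: rmorphM. Qed.

Lemma conjcD z w : conjc (z + w) = conjc z + conjc w.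
Proof. exact: rmorphD. Qed.

Lemma mulcJ z : z * conjc z = (absC z ^+ 2)%:C.
Proof.
case: z => a b; rewrite /= sqr_sqrtr ?addr_ge0 ?sqr_ge0//.
by apply/eqP; rewrite eq_complex/=; apply/andP; split; apply/eqP; ring.
Qed.

Lemma cReM z w : complex.Re (z * w) =
  complex.Re z * complex.Re w - complex.Im z * complex.Im w.
Proof. by case: z w => [? ?] [? ?]. Qed.

Lemma cImM z w : complex.Im (z * w) =
  complex.Re z * complex.Im w + complex.Im z * complex.Re w.
Proof. by case: z w => [? ?] [? ?]. Qed.

Lemma cReD z w : complex.Re (z + w) = complex.Re z + complex.Re w.
Proof. by case: z w => [? ?] [? ?]. Qed.

Lemma cImD z w : complex.Im (z + w) = complex.Im z + complex.Im w.
Proof. by case: z w => [? ?] [? ?]. Qed.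

Lemma cReB z w : complex.Re (z - w) = complex.Re z - complex.Re w.
Proof. by case: z w => [? ?] [? ?]. Qed.

Lemma cImB z w : complex.Im (z - w) = complex.Im z - complex.Im w.
Proof. by case: z w => [? ?] [? ?]. Qed.

Lemma Re_Im_inj z w : complex.Re z = complex.Re w ->
  complex.Im z = complex.Im w -> z = w.
Proof. by case: z w => [? ?] [? ?] /= -> ->. Qed.

Lemma pos_real_complex (e : R[i]) : 0 < e -> exists2 r : R, 0 < r & e = r%:C.
Proof.
by case: e => r s; rewrite ltcE /= => /andP[/eqP -> r0]; exists r.
Qed.

Lemma cvgC_absP T (F : set_system T) {FF : Filter F} (f : T -> R[i]) (l : R[i]) :
  f @ F --> l <-> forall e : R, 0 < e -> \forall x \near F, absC (l - f x) < e.
Proof.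
split.
  move=> /cvgrPdist_lt H e e0.
  have := H e%:C; rewrite ltcR => /(_ e0).
  by apply: filterS => x; rewrite normCE ltcR.
move=> H; apply/cvgrPdist_lt => e e0.
have [r r0 ->] := pos_real_complex e0.
by have := H _ r0; apply: filterS => x; rewrite normCE ltcR.
Qed.

Lemma near_absC z (e : R) : 0 < e -> \forall w \near z, absC (z - w) < e.
Proof.
move=> e0; apply/nbhs_ballP; exists e%:C; first by rewrite /= ltcR.
by move=> w; rewrite -ball_normE/= normCE ltcR.
Qed.

Lemma continuous_conjC : continuous (@conjc R).
Proof.
move=> z; apply/(cvgC_absP (FF := nbhs_filter z)) => e e0.
have := near_absC z e0.
by apply: filterS => w; rewrite -raddfB absCJ.
Qed.

Lemma continuous_absC : continuous (@ComplexField.Normc.normc R).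
Proof.
move=> z; apply/(cvgrPdist_lt (FF := nbhs_filter z)) => e e0.
have := near_absC z e0.
apply: filterS => w; apply: le_lt_trans; rewrite ler_norml.
have h1 := absCD (z - w) w; have h2 := absCD (w - z) z.
by rewrite subrK in h1; rewrite subrK absCB in h2; lra.
Qed.

Lemma continuous_real_complex : continuous (fun x : R => x%:C).
Proof.
move=> x; apply/(cvgC_absP (FF := nbhs_filter x)) => e e0.
have /cvgrPdist_lt/(_ e e0) : (id : R -> R) @ x --> x by exact: cvg_id.
by apply: filterS => y; rewrite -raddfB absC_real.
Qed.

Lemma cvgC_sum T (F : set_system T) {FF : Filter F} I (s : seq I) (P : pred I)
    (f : I -> T -> R[i]) (l : I -> R[i]) :
  (forall i, P i -> f i @ F --> l i) ->
  (fun x => \sum_(i <- s | P i) f i x) @ F --> \sum_(i <- s | P i) l i.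
Proof. by move=> H; apply: cvg_big => //; exact: add_continuous. Qed.

Lemma cvgC_prod T (F : set_system T) {FF : Filter F} I (s : seq I) (P : pred I)
    (f : I -> T -> R[i]) (l : I -> R[i]) :
  (forall i, P i -> f i @ F --> l i) ->
  (fun x => \prod_(i <- s | P i) f i x) @ F --> \prod_(i <- s | P i) l i.
Proof. by move=> H; apply: cvg_big => //; exact: mul_continuous. Qed.

End complex_modulus.

Section tensors.
Variables (R : realType) (T : ptopologicalType) (n : nat).
Local Notation C := R[i].
Variables (K : set T) (L : (T -> C) -> C).

(* [lam] is a value at [Phi] of the n-th tensor power of [L]; by [tensor_bound] it
   is determined by [Phi]. *)
Definition tensor (Cl : 'I_n -> set (T -> C)) (Phi : ('I_n -> T) -> C) (lam : C) :=
  exists (I : finType) (c : I -> C) (t : I -> 'I_n -> T -> C),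
    [/\ forall i j, Cl j (t i j),
        Phi = (fun Z => \sum_i c i * \prod_j t i j (Z j)) &
        lam = \sum_i c i * \prod_j L (t i j)].

Section closure_properties.
Variable Cl : 'I_n -> set (T -> C).

Lemma tensor_pure (t : 'I_n -> T -> C) : (forall j, Cl j (t j)) ->
  tensor Cl (fun Z => \prod_j t j (Z j)) (\prod_j L (t j)).
Proof.
move=> Ct; exists unit, (fun=> 1), (fun=> t); split => //.
  by apply/funext => Z; rewrite big_const card_unit /= mul1r addr0.
by rewrite big_const card_unit /= mul1r addr0.
Qed.

Lemma tensor0 : tensor Cl (fun=> 0) 0.
Proof.
exists void, (fun=> 0), (fun _ _ _ => 0); split; first by case.
  by apply/funext => Z; rewrite big1// => i _; rewrite mul0r.
by rewrite big1// => i _; rewrite mul0r.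
Qed.

Lemma tensorD Phi lam Phi' lam' : tensor Cl Phi lam -> tensor Cl Phi' lam' ->
  tensor Cl (fun Z => Phi Z + Phi' Z) (lam + lam').
Proof.
move=> [I [c [t [Ct -> ->]]]] [J [c' [t' [Ct' -> ->]]]].
exists (I + J)%type, (fun x => match x with inl i => c i | inr j => c' j end),
  (fun x => match x with inl i => t i | inr j => t' j end); split.
- by move=> [i|i] j.
- by apply/funext => Z; rewrite big_sumType.
- by rewrite big_sumType.
Qed.

Lemma tensorZ a Phi lam : tensor Cl Phi lam ->
  tensor Cl (fun Z => a * Phi Z) (a * lam).
Proof.
move=> [I [c [t [Ct -> ->]]]]; exists I, (fun i => a * c i), t; split => //.
  by apply/funext => Z; rewrite mulr_sumr; apply: eq_bigr => i _; rewrite mulrA.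
by rewrite mulr_sumr; apply: eq_bigr => i _; rewrite mulrA.
Qed.

Lemma tensor_sum I (s : seq I) (P : pred I) (Phi : I -> ('I_n -> T) -> C)
    (lam : I -> C) : (forall i, P i -> tensor Cl (Phi i) (lam i)) ->
  tensor Cl (fun Z => \sum_(i <- s | P i) Phi i Z) (\sum_(i <- s | P i) lam i).
Proof.
move=> H; elim: s => [|i s IH].
  have -> : (fun Z => \sum_(i <- [::] | P i) Phi i Z) = (fun=> 0).
    by apply/funext => Z; rewrite big_nil.
  by rewrite big_nil; exact: tensor0.
rewrite big_cons; case: ifPn => Pi.
  under [X in tensor _ X]funext => Z do rewrite big_cons Pi.
  by apply: tensorD => //; exact: H.
by under [X in tensor _ X]funext => Z do rewrite big_cons (negbTE Pi).
Qed.

Hypothesis Cl0 : forall j, Cl j (fun=> 0).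
Hypothesis Cl_lin : forall j (a : C) f g, Cl j f -> Cl j g ->
  Cl j (fun x => a * f x + g x).
Hypothesis L_lin : forall j (a : C) f g, Cl j f -> Cl j g ->
  L (fun x => a * f x + g x) = a * L f + L g.

Lemma class_sum j I (s : seq I) (c : I -> C) (t : I -> T -> C) :
  (forall i, Cl j (t i)) ->
  Cl j (fun x => \sum_(i <- s) c i * t i x) /\
  L (fun x => \sum_(i <- s) c i * t i x) = \sum_(i <- s) c i * L (t i).
Proof.
move=> Ct; elim: s => [|i s [IH1 IH2]].
  have -> : (fun x => \sum_(i <- [::]) c i * t i x) = (fun=> 0).
    by apply/funext => x; rewrite big_nil.
  split; first exact: Cl0.
  rewrite big_nil; have := L_lin (-1) (Cl0 j) (Cl0 j).
  have -> : (fun _ : T => -1 * 0 + 0) = (fun=> 0 : C).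
    by apply/funext => x; rewrite mulr0 addr0.
  by move=> ->; rewrite mulN1r addNr.
have -> : (fun x => \sum_(i <- i :: s) c i * t i x) =
          (fun x => c i * t i x + \sum_(i <- s) c i * t i x).
  by apply/funext => x; rewrite big_cons.
by split; [exact: Cl_lin|rewrite (L_lin _ (Ct i) IH1) IH2 big_cons].
Qed.

Variable b : 'I_n -> R.
Hypothesis L_bound : forall j f (M : R), Cl j f -> 0 <= M ->
  (forall x, K x -> absC (f x) <= M) -> absC (L f) <= b j * M.
Hypothesis b_ge0 : forall j, 0 <= b j.

(* The variables are integrated out one after the other. *)
Lemma tensor_bound Phi lam (e : R) : tensor Cl Phi lam -> 0 <= e ->
  (forall Z, (forall j, K (Z j)) -> absC (Phi Z) <= e) ->
  absC lam <= (\prod_j b j) * e.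
Proof.
move=> [I [c [t [Ct -> ->]]]] e0 He.
have H k : (k <= n)%N -> forall Z, (forall j : 'I_n, (k <= j)%N -> K (Z j)) ->
    absC (\sum_i c i * \prod_(j < n) (if (j < k)%N then L (t i j) else t i j (Z j)))
    <= (\prod_(j < n | (j < k)%N) b j) * e.
  elim: k => [|k IH] kn Z KZ.
    by rewrite [X in _ <= X * e]big_pred0// mul1r; apply: He => j; exact: KZ.
  pose j0 := Ordinal kn.
  (* [d i] gathers the factors of the other variables, so that passing from stage [k] to stage
     [k.+1] is one application of [L], to a function [f] of the variable [j0] alone. *)
  pose d i := c i * \prod_(j < n | j != j0)
    (if (j < k.+1)%N then L (t i j) else t i j (Z j)).
  pose f x := \sum_i d i * t i j0 x.
  have [Cf Lf] := class_sum (index_enum I) d (fun i => Ct i j0).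
  have -> : \sum_i c i * \prod_(j < n)
      (if (j < k.+1)%N then L (t i j) else t i j (Z j)) = L f.
    rewrite Lf; apply: eq_bigr => i _.
    by rewrite (bigD1 j0)//= ltnS leqnn mulrCA mulrC.
  have -> : \prod_(j < n | (j < k.+1)%N) b j =
      b j0 * \prod_(j < n | (j < k)%N) b j.
    rewrite (bigD1 j0) ?ltnS//=; congr (_ * _); apply: eq_bigl => j.
    by rewrite ltnS (ltn_neqAle j k) -val_eqE/= andbC.
  rewrite -mulrA; apply: (L_bound Cf).
    by rewrite mulr_ge0// prodr_ge0.
  move=> x Kx.
  have := IH (ltnW kn) (fun j => if j == j0 then x else Z j).
  have -> : \sum_i c i * \prod_(j < n) (if (j < k)%N then L (t i j) else
      t i j (if j == j0 then x else Z j)) = f x.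
    apply: eq_bigr => i _; rewrite (bigD1 j0)//= ltnn eqxx /d -mulrA.
    congr (_ * _); rewrite mulrC; congr (_ * _); apply: eq_bigr => j jj0.
    rewrite (negbTE jj0) ltnS [(j <= k)%N]leq_eqVlt; rewrite -val_eqE /= in jj0.
    by rewrite (negbTE jj0).
  apply=> j kj; case: eqP => // /eqP jj0; apply: KZ.
  by rewrite ltn_neqAle kj eq_sym andbT; rewrite -val_eqE /= in jj0.
have := H n (leqnn n) (fun=> point).
have -> : \prod_(j < n | (j < n)%N) b j = \prod_j b j.
  by apply: eq_bigl => j; rewrite ltn_ord.
have -> : \sum_i c i * \prod_(j < n) (if (j < n)%N then L (t i j) else t i j point)
    = \sum_i c i * \prod_j L (t i j).
  apply: eq_bigr => i _; congr (_ * _); apply: eq_bigr => j _.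
  by rewrite ltn_ord.
by apply => j; rewrite leqNgt ltn_ord.
Qed.

End closure_properties.

Lemma tensor_sub (Cl Cl' : 'I_n -> set (T -> C)) Phi lam :
  (forall j, Cl j `<=` Cl' j) -> tensor Cl Phi lam -> tensor Cl' Phi lam.
Proof.
move=> sub [I [c [t [Ct -> ->]]]]; exists I, c, t; split => //.
by move=> i j; exact: sub.
Qed.

(** The scalars [L (t i j)] commute, so the value survives a permutation of the variables, provided
    all variables share one class. *)
Lemma tensor_perm (Cl : set (T -> C)) Phi lam (s : {perm 'I_n}) :
  tensor (fun=> Cl) Phi lam -> tensor (fun=> Cl) (fun Z => Phi (Z \o s)) lam.
Proof.
move=> [I [c [t [Ct -> ->]]]]; exists I, c, (fun i j => t i ((s^-1)%g j)); split => //.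
  apply/funext => Z; apply: eq_bigr => i _; congr (_ * _).
  rewrite [RHS](reindex_inj (@perm_inj _ s)).
  by apply: eq_bigr => j _; rewrite /= permK.
apply: eq_bigr => i _; congr (_ * _).
rewrite [RHS](reindex_inj (@perm_inj _ s)).
by apply: eq_bigr => j _; rewrite /= permK.
Qed.

(** An arbitrary filter with convergent coordinates is allowed because two are used: the product
    topology, and the filter generated by boxes around a given tuple. *)
Lemma tensor_cvg Phi lam (F : set_system ('I_n -> T)) {FF : Filter F}
    (p : 'I_n -> T) : (forall j, (fun Z : 'I_n -> T => Z j) @ F --> p j) ->
  tensor (fun=> [set h | continuous h]) Phi lam -> Phi @ F --> Phi p.
Proof.
move=> Fp [I [c [t [Ct -> _]]]].
apply: cvgC_sum => i _; apply: cvgMr.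
by apply: cvgC_prod => j _; apply: cvg_comp (Fp j) (Ct i j _).
Qed.

End tensors.

(** * Determinants of a functional of finite rank *)

Section continuous_complex_functions.
Variables (R : realType) (T : topologicalType).
Implicit Types f g : T -> R[i].

Lemma continuousC_cst (c : R[i]) : continuous (fun _ : T => c).
Proof. by move=> x; exact: cvg_cst. Qed.

Lemma continuousC_add f g : continuous f -> continuous g ->
  continuous (fun x => f x + g x).
Proof. by move=> cf cg x; apply: cvgD; [exact: cf|exact: cg]. Qed.

Lemma continuousC_mul f g : continuous f -> continuous g ->
  continuous (fun x => f x * g x).
Proof. by move=> cf cg x; apply: cvgM; [exact: cf|exact: cg]. Qed.

Lemma continuousC_conj f : continuous f -> continuous (fun x => conjc (f x)).
Proof. by move=> cf x; apply: (cvg_comp _ _ (cf x)); exact: continuous_conjC. Qed.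

Lemma continuousC_lin (a : R[i]) f g : continuous f -> continuous g ->
  continuous (fun x => a * f x + g x).
Proof.
move=> cf cg.
exact: (continuousC_add (continuousC_mul (@continuousC_cst a) cf) cg).
Qed.

Lemma continuous_ReC f : continuous f -> continuous (fun x => complex.Re (f x)).
Proof. by move=> cf x; apply: (cvg_comp _ _ (cf x)); exact: continuous_Re. Qed.

Lemma continuous_ImC f : continuous f -> continuous (fun x => complex.Im (f x)).
Proof. by move=> cf x; apply: (cvg_comp _ _ (cf x)); exact: continuous_Im. Qed.

Lemma continuous_absCf f : continuous f -> continuous (fun x => absC (f x)).
Proof. by move=> cf x; apply: (cvg_comp _ _ (cf x)); exact: continuous_absC. Qed.

End continuous_complex_functions.

(** * Symmetric functions generated by a point-separating algebra *)

Section separating_algebra.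
Variables (R : realType) (T : ptopologicalType) (E : set (T -> R[i])).
Local Notation C := R[i].
Hypothesis E_cst : forall c, E (fun=> c).
Hypothesis E_add : forall f g, E f -> E g -> E (fun x => f x + g x).
Hypothesis E_mul : forall f g, E f -> E g -> E (fun x => f x * g x).
Hypothesis E_cont : forall f, E f -> continuous f.
Hypothesis E_sep : forall x y, x <> y -> exists2 f, E f & f x <> f y.

(** A product of separating factors, each vanishing at one point of [s] other than [p] and
    normalised at [p]: a Lagrange basis function inside the algebra. *)
Lemma interpolation (s : seq T) (p : T) : exists2 e, E e &
  e p = 1 /\ forall q, q \in s -> q != p -> e q = 0.
Proof.
elim: s => [|q s [e Ee [ep es]]]; first by exists (fun=> 1).
have [->|qp] := eqVneq q p.
  exists e => //; split => // r; rewrite inE => /orP[/eqP ->|]; last exact: es.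
  by rewrite eqxx.
have [f Ef /eqP fqp] := E_sep (elimN eqP qp).
exists (fun x => e x * ((f x + (- f q)) * (f p - f q)^-1)).
  by apply: E_mul => //; apply: E_mul => //; exact: E_add.
split; first by rewrite ep mul1r divff// subr_eq0 eq_sym.
move=> r; rewrite inE => /orP[/eqP ->|rs rp]; first by rewrite subrr mul0r mulr0.
by rewrite es// mul0r.
Qed.

Variable n : nat.

(** The same pair [a], [b] serves every coordinate, so that it can be absorbed into the entries of
    the two determinants; the price is that only symmetric functions arise. *)
Inductive split_fun : (('I_n -> T) -> C) -> Prop :=
| split_pure a b : E a -> E b -> split_fun (fun Z => \prod_j (a (Z j) * conjc (b (Z j))))
| split_add f g : split_fun f -> split_fun g -> split_fun (fun Z => f Z + g Z)
| split_scale c f : split_fun f -> split_fun (fun Z => c * f Z).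

Lemma split_cst c : split_fun (fun=> c).
Proof.
have := split_scale c (split_pure (E_cst 1) (E_cst 1)).
congr split_fun; apply/funext => Z.
by rewrite big1 ?mulr1// => j _; rewrite mul1r; exact: conjc1.
Qed.

Lemma split_mul f g : split_fun f -> split_fun g -> split_fun (fun Z => f Z * g Z).
Proof.
move=> Sf Sg; elim: Sf => [a b Ea Eb|f1 f2 _ IH1 _ IH2|c f1 _ IH].
- elim: Sg => [a' b' Ea' Eb'|g1 g2 _ IH1 _ IH2|c g1 _ IH].
  + have := split_pure (E_mul Ea Ea') (E_mul Eb Eb').
    congr split_fun; apply/funext => Z; rewrite -big_split; apply: eq_bigr => j _ /=.
    by rewrite conjcM; ring.
  + by have := split_add IH1 IH2; congr split_fun; apply/funext => Z; rewrite mulrDr.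
  + by have := split_scale c IH; congr split_fun; apply/funext => Z; rewrite mulrCA.
- by have := split_add IH1 IH2; congr split_fun; apply/funext => Z; rewrite mulrDl.
- by have := split_scale c IH; congr split_fun; apply/funext => Z; rewrite mulrA.
Qed.

Lemma split_conj f : split_fun f -> split_fun (fun Z => conjc (f Z)).
Proof.
elim=> [a b Ea Eb|f1 f2 _ IH1 _ IH2|c f1 _ IH].
- have := split_pure Eb Ea; congr split_fun; apply/funext => Z.
  rewrite rmorph_prod; apply: eq_bigr => j _ /=.
  by rewrite conjcM conjcK mulrC.
- by have := split_add IH1 IH2; congr split_fun; apply/funext => Z; rewrite conjcD.
- by have := split_scale (conjc c) IH; congr split_fun; apply/funext => Z; rewrite conjcM.
Qed.

Lemma split_continuous f : split_fun f ->
  continuous (f : {ptws 'I_n -> T} -> C).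
Proof.
elim=> [a b Ea Eb|f1 f2 _ IH1 _ IH2|c f1 _ IH].
- move=> Z; apply: cvgC_prod => j _.
  have pj : (fun Z : {ptws 'I_n -> T} => Z j) @ Z --> Z j by exact: proj_continuous.
  have cE (h : T -> C) : continuous h -> h (Y j) @[Y --> (Z : {ptws 'I_n -> T})] --> h (Z j).
    by move=> ch; apply: (cvg_comp (fun Y : {ptws 'I_n -> T} => Y j) h pj); exact: ch.
  exact: (cvgM (cE _ (E_cont Ea)) (cE _ (continuousC_conj (E_cont Eb)))).
- exact: (continuousC_add IH1 IH2).
- exact: (continuousC_mul (@continuousC_cst _ {ptws 'I_n -> T} c) IH).
Qed.

Variable K : set T.
Hypothesis cK : compact K.

(* The algebra [split_fun] separates the orbits of [K^n] under the symmetric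
   group. *)
Lemma split_dense (f : {ptws 'I_n -> T} -> R) (e : R) : continuous f ->
  (forall Z (s : {perm 'I_n}), f (Z \o s) = f Z) -> 0 < e ->
  exists2 a : ('I_n -> T) -> R, split_fun (fun Z => (a Z)%:C) &
    forall Z, (forall j, K (Z j)) -> `|f Z - a Z| <= e.
Proof.
move=> cf symf e0.
have cKn : compact [set Z : {ptws 'I_n -> T} | forall j, K (Z j)].
  exact: (@tychonoff _ (fun=> T) (fun=> K)).
pose A := [set a : {ptws 'I_n -> T} -> R | split_fun (fun Z => (a Z)%:C)].
have A_Re g : split_fun g -> A (fun Z => complex.Re (g Z)).
  move=> Sg; have := split_scale 2^-1 (split_add Sg (split_conj Sg)).
  congr split_fun; apply/funext => Z; by rewrite addcJ mulKf.
have A_cst (c : R) : A (fun=> c) by exact: split_cst.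
have A_add g h : A g -> A h -> A (fun x => g x + h x).
  move=> Ag Ah; have := split_add Ag Ah; congr split_fun.
  by apply/funext => Z; rewrite raddfD.
have A_mul g h : A g -> A h -> A (fun x => g x * h x).
  move=> Ag Ah; have := split_mul Ag Ah; congr split_fun.
  by apply/funext => Z; rewrite rmorphM.
have A_cont g : A g -> continuous g.
  by move=> /split_continuous/continuous_ReC.
have [|a Aa H] := @stone_weierstrass R _ _ A cKn A_cst A_add A_mul A_cont f cf _ e e0;
  last by exists a.
move=> Y Z _ _ fYZ.
(* If all multiplicities agreed, [Z] would be a permutation of [Y], and the symmetric [f] could not
   separate them. *)
have [p Hp] : exists p, count_mem p [tuple Y j | j < n] != count_mem p [tuple Z j | j < n].
  apply: contrapT => /forallNP H; apply: fYZ.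
  have /tuple_permP[s Hs] : perm_eq [tuple Y j | j < n] [tuple Z j | j < n].
    by apply/allP => p _ /=; have /negP := H p; rewrite negbK.
  rewrite -(symf Z s); congr f; apply/funext => j.
  have /(congr1 (fun t => nth point t j)) := Hs.
  by rewrite -!tnth_nth !tnth_mktuple.
pose S := [tuple Y j | j < n] ++ [tuple Z j | j < n].
(* Since [g] is 1 at [p] and 0 at the other entries, the product of the factors 1 + g(X_j) is 2 to
   the power of the multiplicity of [p]: a split function that tells the two orbits apart. *)
have [g Eg [gp gq]] := interpolation S p.
exists (fun X => complex.Re (\prod_j (1 + g (X j)))).
  apply: A_Re; have := split_pure (E_add (E_cst 1) Eg) (E_cst 1).
  congr split_fun; apply/funext => X; apply: eq_bigr => j _.
  rewrite [conjc _](_ : _ = 1) ?mulr1//; exact: conjc1.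
have val (s : seq T) : {subset s <= S} ->
    \prod_(x <- s) (1 + g x) = (2 ^+ count_mem p s)%:C.
  elim: s => [|x s IH] sS; first by rewrite big_nil.
  rewrite big_cons IH => [|y ys]; last by rewrite sS// inE ys orbT.
  have xS : x \in S by rewrite sS// mem_head.
  have [->|xp] := eqVneq x p; first by rewrite /= eqxx gp exprS rmorphM rmorph_nat.
  by rewrite /= (negbTE xp) gq// addr0 mul1r.
have val' (X : 'I_n -> T) : {subset [tuple X j | j < n] <= S} ->
    complex.Re (\prod_j (1 + g (X j))) = 2 ^+ count_mem p [tuple X j | j < n].
  by move=> /val; rewrite /= big_map big_enum /= => ->.
rewrite !val'; first 1 last.
- by move=> x xZ; rewrite mem_cat xZ orbT.
- by move=> x xZ; rewrite mem_cat xZ.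
- by move=> /(@ieexprIn R 2 (ltr0Sn R 1)); rewrite pnatr_eq1 => /(_ isT)/eqP; rewrite (negbTE Hp).
Qed.
End separating_algebra.

(** * Alternating forms and their tensor expansions *)

Section alternating_forms.
Variables (R : realType) (T : ptopologicalType) (n : nat).
Local Notation C := R[i].
Implicit Types (f g h : 'I_n -> T -> C) (Z : 'I_n -> T).

Definition alternant f Z : C := \det (\matrix_(j, i) f i (Z j)).

Lemma alternantE f Z :
  alternant f Z = \sum_(s : 'S_n) (-1) ^+ s * \prod_j f (s j) (Z j).
Proof.
apply: eq_bigr => s _; congr (_ * _); apply: eq_bigr => j _.
by rewrite mxE.
Qed.

Lemma alternant_perm f Z (s : 'S_n) :
  alternant f (Z \o s) = (-1) ^+ s * alternant f Z.
Proof.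
rewrite /alternant -det_perm -det_mulmx; congr (\det _).
by rewrite -row_permE; apply/matrixP => i j; rewrite !mxE.
Qed.

(** The signs of the two determinants cancel, which makes the weight symmetric. *)
Lemma alternant_sqr_perm f g Z (s : 'S_n) :
  alternant f (Z \o s) * conjc (alternant g (Z \o s)) =
  alternant f Z * conjc (alternant g Z).
Proof.
by rewrite !alternant_perm conjcM rmorph_sign mulrACA -expr2 sqrr_sign mul1r.
Qed.

(** Expanding both determinants leaves a signed sum of pure tensors. The class [Cl] is kept free: it
    will be either all continuous functions or those supported near given points. *)
Lemma tensor_alternant (L : (T -> C) -> C) Cl f g h :
  (forall (s t : 'S_n) j, Cl j (fun x => f (s j) x * conjc (g (t j) x) * h j x)) ->
  tensor L Cl (fun Z => alternant f Z * conjc (alternant g Z) * \prod_j h j (Z j))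
    (\sum_(s : 'S_n) \sum_(t : 'S_n) (-1) ^+ s * (-1) ^+ t *
      \prod_j L (fun x => f (s j) x * conjc (g (t j) x) * h j x)).
Proof.
move=> HC.
have -> : (fun Z => alternant f Z * conjc (alternant g Z) * \prod_j h j (Z j)) =
    (fun Z => \sum_(s : 'S_n) \sum_(t : 'S_n) (-1) ^+ s * (-1) ^+ t *
      \prod_j (f (s j) (Z j) * conjc (g (t j) (Z j)) * h j (Z j))).
  apply/funext => Z; rewrite !alternantE rmorph_sum big_distrlr mulr_suml.
  apply: eq_bigr => s _; rewrite mulr_suml; apply: eq_bigr => t _.
  rewrite /= conjcM rmorph_sign rmorph_prod [in RHS]big_split [in RHS]big_split /=.
  by rewrite mulrACA -!mulrA.
apply: tensor_sum => s _; apply: tensor_sum => t _.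
apply: tensorZ.
exact: (tensor_pure L (HC s t)).
Qed.

End alternating_forms.

(** * Finite support of a functional whose determinants vanish *)

Section finite_rank_functional.
Variables (R : realType) (T : ptopologicalType) (K : set T).
Local Notation C := R[i].
Variables (L : (T -> C) -> C) (E : set (T -> C)) (n : nat) (M0 : R).
Hypothesis cK : compact K.
Hypothesis L_lin : forall (a : C) f g, continuous f -> continuous g ->
  L (fun x => a * f x + g x) = a * L f + L g.
Hypothesis M0_ge0 : 0 <= M0.
Hypothesis L_bound : forall f (M : R), continuous f -> 0 <= M ->
  (forall x, K x -> absC (f x) <= M) -> absC (L f) <= M0 * M.
Hypothesis E_cst : forall c, E (fun=> c).
Hypothesis E_add : forall f g, E f -> E g -> E (fun x => f x + g x).
Hypothesis E_mul : forall f g, E f -> E g -> E (fun x => f x * g x).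
Hypothesis E_cont : forall f, E f -> continuous f.
Hypothesis E_sep : forall x y, x <> y -> exists2 f, E f & f x <> f y.
Hypothesis det0 : forall f g : 'I_n -> T -> C,
  (forall i, E (f i)) -> (forall i, E (g i)) ->
  \det (\matrix_(i, j) L (fun x => f i x * conjc (g j x))) = 0.

Let contC := fun _ : 'I_n => [set h : T -> C | continuous h].

(** For a pure factor and a fixed permutation [t], the sum over [s] in the double expansion is, up
    to sign, the determinant for the functions a f_i and b g_(t j). These still lie in the algebra,
    so [det0] applies. *)
Lemma tensor_alternant_split (f g : 'I_n -> T -> C) Phi :
  (forall i, E (f i)) -> (forall i, E (g i)) -> split_fun E Phi ->
  tensor L contC (fun Z => alternant f Z * conjc (alternant g Z) * Phi Z) 0.
Proof.
move=> Ef Eg; elim=> [a b Ea Eb|P1 P2 _ IH1 _ IH2|c P _ IH]; last 2 first.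
- have := tensorD IH1 IH2; rewrite addr0; congr tensor.
  by apply/funext => Z; rewrite mulrDr.
- have := tensorZ c IH; rewrite mulr0; congr tensor.
  by apply/funext => Z; rewrite mulrCA.
have cont s t : continuous (fun x => f s x * conjc (g t x) * (a x * conjc (b x))).
  have cEf := E_cont (Ef s); have cEg := continuousC_conj (E_cont (Eg t)).
  have cEa := E_cont Ea; have cEb := continuousC_conj (E_cont Eb).
  exact: (continuousC_mul (continuousC_mul cEf cEg) (continuousC_mul cEa cEb)).
have := @tensor_alternant R T n L contC f g
  (fun j x => a x * conjc (b x)) (fun s t j => cont (s j) (t j)).
congr tensor; rewrite exchange_big big1// => t _.
have := @det0 (fun i x => a x * f i x) (fun i x => b x * g (t i) x)
  (fun i => E_mul Ea (Ef i)) (fun i => E_mul Eb (Eg (t i))).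
rewrite -det_tr /determinant => H.
transitivity ((-1) ^+ t * 0 : C); last by rewrite mulr0.
rewrite -[in RHS]H mulr_sumr; apply: eq_bigr => s _.
rewrite mulrCA mulrA; congr (_ * _); apply: eq_bigr => j _.
rewrite !mxE; congr L; apply/funext => x.
by rewrite conjcM; ring.
Qed.

Lemma alternant_cvg (F : set_system ('I_n -> T)) {FF : Filter F} (p : 'I_n -> T)
    (f g : 'I_n -> T -> C) : (forall i, E (f i)) -> (forall i, E (g i)) ->
  (forall j, (fun Z : 'I_n -> T => Z j) @ F --> p j) ->
  (fun Z => alternant f Z * conjc (alternant g Z)) @ F -->
    alternant f p * conjc (alternant g p).
Proof.
move=> Ef Eg Fp.
have cont s t : continuous (fun x => f s x * conjc (g t x) * 1).
  apply: (continuousC_mul _ (@continuousC_cst R T 1)).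
  exact: (continuousC_mul (E_cont (Ef s)) (continuousC_conj (E_cont (Eg t)))).
have := @tensor_alternant R T n L contC f g (fun _ _ => 1) (fun s t j => cont (s j) (t j)).
pose FG Z := alternant f Z * conjc (alternant g Z).
have -> : (fun Z => alternant f Z * conjc (alternant g Z) *
    \prod_(j < n) 1) = FG by apply/funext => Z; rewrite big1 ?mulr1.
by move=> tFG; exact: (tensor_cvg Fp tFG).
Qed.

(** Symmetrizing the product of the [h j] multiplies the value by n!, because the weight is
    symmetric. The symmetrized factor is, on K^n, a uniform limit of split functions, for which the
    value is 0, and values are controlled by sup norms. *)
Lemma tensor_alternant_eq0 (f g h : 'I_n -> T -> C) lam :
  (forall i, E (f i)) -> (forall i, E (g i)) -> (forall i, continuous (h i)) ->
  tensor L contC (fun Z => alternant f Z * conjc (alternant g Z) *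
    \prod_j h j (Z j)) lam -> lam = 0.
Proof.
move=> Ef Eg ch tl.
pose FG Z := alternant f Z * conjc (alternant g Z).
pose Psi Z := \sum_(s : 'S_n) \prod_j h j ((Z \o s) j).
have tPsi : tensor L contC (fun Z => FG Z * Psi Z) (n`!%:R * lam).
  have -> : n`!%:R * lam = \sum_(s : 'S_n) lam.
    by rewrite sumr_const card_Sn mulr_natl.
  have -> : (fun Z => FG Z * Psi Z) = (fun Z => \sum_(s : 'S_n)
      (FG (Z \o s) * \prod_j h j ((Z \o s) j))).
    apply/funext => Z; rewrite mulr_sumr; apply: eq_bigr => s _.
    by rewrite /FG alternant_sqr_perm.
  by apply: tensor_sum => s _; exact: (tensor_perm s tl).
have projc (Z : {ptws 'I_n -> T}) j :
    (fun Y : {ptws 'I_n -> T} => Y j) @ Z --> Z j.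
  exact: (@proj_continuous _ (fun=> T) j Z).
have cPsi : continuous (Psi : {ptws 'I_n -> T} -> C).
  move=> Z; apply: cvgC_sum => s _; apply: cvgC_prod => j _.
  by apply: (cvg_comp (fun Y : {ptws 'I_n -> T} => Y (s j)) (h j) (projc Z (s j))); exact: ch.
have symPsi Z (s : 'S_n) : Psi (Z \o s) = Psi Z.
  rewrite /Psi [RHS](reindex_inj (mulIg s)).
  apply: eq_bigr => t _; apply: eq_bigr => j _.
  by rewrite /= permM.
have cKn : compact [set Z : {ptws 'I_n -> T} | forall j, K (Z j)].
  exact: (@tychonoff _ (fun=> T) (fun=> K)).
have cFG : continuous (FG : {ptws 'I_n -> T} -> C).
  by move=> Z; exact: (alternant_cvg Ef Eg (projc Z)).
have [M M1 HM] := continuous_compact_bound cKn (fun x _ => @continuous_absCf R _ _ cFG x).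
have bound (e : R) : 0 < e -> absC (n`!%:R * lam) <= M0 ^+ n * (M * (e *+ 2)).
  move=> e0.
  have [a Sa Ha] := split_dense E_cst E_add E_mul E_cont E_sep cK
    (continuous_ReC cPsi) (fun Z s => congr1 (@complex.Re R) (symPsi Z s)) e0.
  have [b Sb Hb] := split_dense E_cst E_add E_mul E_cont E_sep cK
    (continuous_ImC cPsi) (fun Z s => congr1 (@complex.Im R) (symPsi Z s)) e0.
  have Sab := split_add Sa (split_scale 'i Sb).
  have := tensorD tPsi (tensorZ (-1) (tensor_alternant_split Ef Eg Sab)).
  rewrite mulr0 addr0 => tD.
  have -> : M0 ^+ n = \prod_(j < n) M0 by rewrite prodr_const card_ord.
  apply: (tensor_bound (Cl := contC) _ _ _ _ _ tD).
  - by move=> j; exact: continuousC_cst.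
  - by move=> j c F G; exact: continuousC_lin.
  - by move=> j c F G cF cG; exact: (L_lin c cF cG).
  - by move=> j F N; exact: L_bound.
  - by [].
  - by rewrite mulr_ge0 ?(ltW M1)// mulrn_wge0// ltW.
  move=> Z KZ.
  have -> : FG Z * Psi Z + -1 * (alternant f Z * conjc (alternant g Z) *
      ((a Z)%:C + 'i * (b Z)%:C)) = FG Z * (Psi Z - ((a Z)%:C + 'i * (b Z)%:C)).
    by rewrite mulN1r -mulrN -mulrDr.
  rewrite absCM; apply: ler_pM; rewrite ?absC_ge0//.
    by have := HM Z KZ; rewrite ger0_norm ?absC_ge0.
  apply: le_trans (absC_le _) _; rewrite mulr2n.
  have -> : (a Z)%:C + 'i * (b Z)%:C = (a Z) +i* (b Z).
    by apply: Re_Im_inj => /=; ring.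
  by rewrite cReB cImB; apply: lerD; [exact: Ha|exact: Hb].
apply: contrapT => /eqP lam0.
have nl0 : 0 < absC (n`!%:R * lam).
  by rewrite absC_gt0 mulf_neq0// pnatr_eq0 -lt0n fact_gt0.
have A0 : 0 <= M0 ^+ n * M by rewrite mulr_ge0 ?exprn_ge0 ?(ltW M1).
(* For this error the upper bound is less than half of the positive quantity that it should
   dominate; the added 1 keeps the denominator positive. *)
have := bound (absC (n`!%:R * lam) / (4 * (M0 ^+ n * M + 1))).
move: (M0 ^+ n) A0 => P A0.
set x := absC _ in nl0 *; rewrite mulr2n.
have d0 : 0 < 4 * (P * M + 1) by lra.
move=> /(_ (divr_gt0 nl0 d0)); apply/negP; rewrite -ltNge.
rewrite mulrA -mulrDl mulrA ltr_pdivrMr//; nra.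
Qed.

(** Membership in the support in the sense of distributions, phrased with test functions because [L]
    is an abstract functional here. *)
Definition locally_nonzero (p : T) := forall U, nbhs p U ->
  exists h, [/\ continuous h, forall x, ~ U x -> h x = 0 & L h <> 0].

Theorem locally_nonzero_finite (p : 'I_n -> T) : injective p ->
  ~ (forall k, locally_nonzero (p k)).
Proof.
move=> p_inj nz.
have /choice[f Hf] : forall k, exists f, E f /\ forall j, f (p j) = (k == j)%:R.
  move=> k; have [f Ef [fk fj]] := interpolation E_cst E_add E_mul E_sep
    [seq p j | j : 'I_n] (p k).
  exists f; split => // j; have [<-//|kj] := eqVneq k j.
  by rewrite fj ?map_f ?mem_enum//; apply: contra kj => /eqP/p_inj ->.
have Ef k : E (f k) by have [] := Hf k.
have fE k j : f k (p j) = (k == j)%:R by have [_] := Hf k.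
pose FG Z := alternant f Z * conjc (alternant f Z).
have FGp : FG p = 1.
  have -> : FG p = alternant f p * conjc (alternant f p) by [].
  have -> : alternant f p = 1.
    rewrite /alternant -(det1 C n); congr (\det _).
    by apply/matrixP => i j; rewrite !mxE fE eq_sym.
  by rewrite mul1r; exact: conjc1.
(* Boxes around [p] form a base of [F], so closeness of the weight to its value at [p] is delivered
   directly on a product of neighbourhoods [U j]. *)
pose F : set_system ('I_n -> T) := [set S | exists U : 'I_n -> set T,
  (forall j, nbhs (p j) (U j)) /\ (forall Z, (forall j, U j (Z j)) -> S Z)].
have FF : Filter F.
  split.
  - by exists (fun=> setT); split => // j; exact: filterT.
  - move=> A B [U [nU UA]] [V [nV VB]]; exists (fun j => U j `&` V j); split.
      by move=> j; exact: filterI.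
    move=> Z UVZ; split; first by apply: UA => j; have [] := UVZ j.
    by apply: VB => j; have [] := UVZ j.
  - by move=> A B AB [U [nU UA]]; exists U; split => // Z /UA; exact: AB.
have Fp j : (fun Z : 'I_n -> T => Z j) @ F --> p j.
  move=> A nA; exists (fun k => if k == j then A else setT); split.
    by move=> k; case: eqP => [->//|_]; exact: filterT.
  by move=> Z /(_ j); rewrite eqxx.
have cFG : FG @ F --> FG p by exact: (alternant_cvg Ef Ef Fp).
(* Half of 2^-n, the loss incurred below by functions [h j] that are norming only up to a factor
   2. *)
pose eps : R := (2 ^+ n *+ 2)^-1.
have eps0 : 0 < eps by rewrite invr_gt0 pmulrn_lgt0// exprn_gt0.
have /cvgC_absP/(_ _ eps0)[U [nU HU]] := cFG.
pose Cl j := [set h : T -> C | continuous h /\ forall x, ~ U j x -> h x = 0].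
pose S j := [set absC (L h) | h in [set h | Cl j h /\ forall x, K x -> absC (h x) <= 1]].
have S_sup j : has_sup (S j).
  split.
    exists (absC (L (fun=> 0))), (fun=> 0); last by [].
    split; last by move=> x _; rewrite absC0 ler01.
    by split; [exact: continuousC_cst|].
  exists (M0 * 1) => _ [h [[ch _] h1] <-]; exact: L_bound.
(* The norm of [L] on functions supported in [U j]. Using it instead of [M0] keeps both sides of the
   final comparison proportional to the product of the [b j]. *)
pose b j := sup (S j).
have S_ub j h : Cl j h -> (forall x, K x -> absC (h x) <= 1) -> absC (L h) <= b j.
  by move=> Clh h1; apply: (ub_le_sup (S_sup j).2); exists h.
have L_scale (c : C) h : continuous h -> L (fun x => c * h x) = c * L h.
  move=> ch.
  have L0 : L (fun=> 0) = 0.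
    have := L_lin (-1) (@continuousC_cst R T 0) (@continuousC_cst R T 0).
    have -> : (fun _ : T => -1 * 0 + 0) = (fun=> 0 : C).
      by apply/funext => x; rewrite mulr0 addr0.
    by move=> ->; rewrite mulN1r addNr.
  have := L_lin c ch (@continuousC_cst R T 0); rewrite L0 addr0 => <-.
  by congr L; apply/funext => x; rewrite addr0.
have b_bound j h (M : R) : Cl j h -> 0 <= M -> (forall x, K x -> absC (h x) <= M) ->
    absC (L h) <= b j * M.
  move=> [ch Uh] M0' hM; have [M_eq0|M_neq0] := eqVneq M 0.
    rewrite M_eq0 mulr0 -(mulr0 M0); apply: L_bound => // x Kx.
    by rewrite -M_eq0 hM.
  have Mgt0 : 0 < M by rewrite lt_def M_neq0.
  have := S_ub j (fun x => (M^-1)%:C * h x); rewrite L_scale//.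
  rewrite absCM absC_real gtr0_norm ?invr_gt0// ler_pdivrMl// mulrC; apply.
    split; first exact: (continuousC_mul (@continuousC_cst R T _) ch).
    by move=> x /Uh ->; rewrite mulr0.
  move=> x Kx; rewrite absCM absC_real gtr0_norm ?invr_gt0//.
  by rewrite ler_pdivrMl// mulr1 hM.
have b_gt0 j : 0 < b j.
  have [h [ch Uh Lh]] := nz j _ (nU j).
  have [M Mgt0 hM] := continuous_compact_bound cK (fun x _ => @continuous_absCf R _ _ ch x).
  have := b_bound j h M (conj ch Uh) (ltW Mgt0) _.
  have H : forall x, K x -> absC (h x) <= M.
    by move=> x /hM; rewrite ger0_norm ?absC_ge0.
  move=> /(_ H); have : 0 < absC (L h) by rewrite absC_gt0; apply/eqP.
  by move=> L0 /(lt_le_trans L0); rewrite pmulr_lgt0.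
have /choice[h Hh] : forall j, exists h, [/\ Cl j h,
    forall x, K x -> absC (h x) <= 1 & b j / 2 < absC (L h)].
  move=> j; have b2 : 0 < b j / 2 by rewrite divr_gt0.
  have [_ [h [Clh h1] <-]] := sup_adherent b2 (S_sup j).
  by rewrite -/(b j) {1}(splitr (b j)) addrK => H; exists h.
have Clh j : Cl j (h j) by have [] := Hh j.
have h1 j x : K x -> absC (h j x) <= 1 by have [_ + _] := Hh j; apply.
have Lh j : b j / 2 < absC (L (h j)) by have [] := Hh j.
have Clmul s t j : Cl j (fun x => f s x * conjc (f t x) * h j x).
  have [ch Uh] := Clh j; split; last by move=> x /Uh ->; rewrite mulr0.
  by apply: (continuousC_mul _ ch);
    exact: (continuousC_mul (E_cont (Ef s)) (continuousC_conj (E_cont (Ef t)))).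
have tl := @tensor_alternant R T n L Cl f f h (fun s t j => Clmul (s j) (t j) j).
have subC j : Cl j `<=` contC j by move=> g [].
have := tensor_alternant_eq0 Ef Ef (fun j => (Clh j).1) (tensor_sub subC tl).
move=> lam0; rewrite lam0 in tl.
(* The second tensor has value 0, so the product of the [L (h j)] is the value of (1 - weight) times
   the product of the [h j]. That function is small when all coordinates lie in the [U j], by their
   choice, and 0 otherwise. *)
have := tensorD (tensor_pure L Clh) (tensorZ (-1) tl); rewrite mulr0 addr0 => tD.
have := tensor_bound (Cl := Cl) _ _ _ b_bound (fun j => ltW (b_gt0 j)) tD (ltW eps0) _.
have -> : absC (\prod_j L (h j)) = \prod_j absC (L (h j)) by exact: absC_prod.
have b2E : \prod_j (b j / 2) = (\prod_j b j) * (2 ^+ n)^-1.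
  by rewrite big_split /= prodr_const card_ord exprVn.
have : \prod_j (b j / 2) <= \prod_j absC (L (h j)).
  by apply: ler_prod => j _; rewrite divr_ge0 ?ltW.
rewrite b2E => H1 H2.
have : \prod_j absC (L (h j)) <= (\prod_j b j) * eps.
  apply: H2.
  - by move=> j; split; [exact: continuousC_cst|].
  - move=> j c g g' [cg Ug] [cg' Ug']; split; first exact: (continuousC_lin cg cg').
    by move=> x Ux; rewrite Ug ?Ug'// mulr0 addr0.
  - by move=> j c g g' [cg _] [cg' _]; exact: (L_lin c cg cg').
  move=> Z KZ.
  have -> : \prod_j h j (Z j) + -1 * (alternant f Z * conjc (alternant f Z) *
      \prod_j h j (Z j)) = (FG p - FG Z) * \prod_j h j (Z j).
    by rewrite FGp mulrBl mul1r mulN1r.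
  have [UZ|/existsNP[j UZ]] := pselect (forall j, U j (Z j)).
    rewrite absCM -[leRHS]mulr1; apply: ler_pM; rewrite ?absC_ge0//.
      exact: ltW (HU _ UZ).
    rewrite absC_prod; apply: prodr_ile1 => j _.
    by rewrite absC_ge0 h1.
  rewrite (bigD1 j)//= (Clh j).2// mul0r mulr0 absC0; exact: ltW.
move=> H3; have := le_trans H1 H3.
have X0 : 0 < 2 ^+ n :> R by rewrite exprn_gt0.
rewrite ler_pM2l ?prodr_gt0// /eps lef_pV2 ?posrE ?pmulrn_lgt0//.
by rewrite mulr2n gerDl leNgt X0.
Qed.

End finite_rank_functional.

(** * Integration against a complex measure *)

Section bounded_measurable_functions.
Context d (T : measurableType d) (R : realType).
Implicit Types (D K : set T) (f g : T -> R) (nu : {charge set T -> \bar R}).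

(** On a measurable [K] such functions are integrable for every finite measure, in particular for
    both Jordan parts of a charge. *)
Definition bmf K f := measurable_fun K f /\ exists M, forall x, K x -> `|f x| <= M.

Lemma bmf_cst K c : bmf K (fun=> c).
Proof. by split; [exact: measurable_cst|exists `|c|]. Qed.

Lemma bmf_lin K a f g : bmf K f -> bmf K g -> bmf K (fun x => a * f x + g x).
Proof.
move=> [mf [M hM]] [mg [N hN]]; split.
  by apply: measurable_funD => //; apply: measurable_funM.
exists (`|a| * M + N) => x Kx; apply: le_trans (ler_normD _ _) _.
by rewrite normrM lerD ?hN// ler_wpM2l// hM.
Qed.

Lemma bmf_add K f g : bmf K f -> bmf K g -> bmf K (fun x => f x + g x).
Proof.
move=> bf bg; have := bmf_lin 1 bf bg; congr bmf.
by apply/funext => x; rewrite mul1r.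
Qed.

Lemma bmf_sub K f g : bmf K f -> bmf K g -> bmf K (fun x => f x - g x).
Proof.
move=> bf bg; have := bmf_lin (-1) bg bf; congr bmf.
by apply/funext => x; rewrite mulN1r addrC.
Qed.

Lemma bmf_mul K f g : bmf K f -> bmf K g -> bmf K (fun x => f x * g x).
Proof.
move=> [mf [M hM]] [mg [N hN]]; split; first exact: measurable_funM.
exists (M * N) => x Kx; rewrite normrM; apply: ler_pM => //; [exact: hM|exact: hN].
Qed.

Section finite_measure.
Variable m : {finite_measure set T -> \bar R}.

Lemma bmf_integrable K f : measurable K -> bmf K f -> m.-integrable K (EFin \o f).
Proof.
move=> mK [mf [M hM]]; apply: measurable_bounded_integrable => //.
  by rewrite ltey_eq fin_num_measure.
exists M; split; first by rewrite num_real.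
by move=> N MN x Kx; exact: le_trans (hM x Kx) (ltW MN).
Qed.

Lemma Rintegral_bmf_lin K a f g : measurable K -> bmf K f -> bmf K g ->
  \int[m]_(x in K) (a * f x + g x) =
  a * \int[m]_(x in K) f x + \int[m]_(x in K) g x.
Proof.
move=> mK bf bg; rewrite RintegralD ?RintegralZl//.
- exact: bmf_integrable.
- apply: bmf_integrable => //; have := bmf_lin a bf (bmf_cst K 0).
  by congr bmf; apply/funext => x; rewrite addr0.
- exact: bmf_integrable.
Qed.

Lemma Rintegral_bmf_bound K f M : measurable K -> bmf K f ->
  (forall x, K x -> `|f x| <= M) -> `|\int[m]_(x in K) f x| <= M * fine (m K).
Proof.
move=> mK bf hM; apply: le_trans (le_normr_Rintegral mK (bmf_integrable mK bf)) _.
rewrite -Rintegral_cst//; apply: le_Rintegral => //.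
- have [mf [N hN]] := bf; apply: bmf_integrable => //; split.
    exact: measurableT_comp.
  by exists N => x Kx; rewrite normr_id hN.
- by apply: bmf_integrable => //; exact: bmf_cst.
Qed.

Lemma Rintegral_bmf_cvg K (f_ : nat -> T -> R) f M : measurable K ->
  (forall k, measurable_fun K (f_ k)) -> measurable_fun K f ->
  (forall k x, K x -> `|f_ k x| <= M) ->
  (forall x, K x -> f_ ^~ x @ \oo --> f x) ->
  (fun k => \int[m]_(x in K) f_ k x) @ \oo --> \int[m]_(x in K) f x.
Proof.
move=> mK mf_ mf hM cf.
have [||/=|||fint _ cvg] := @dominated_convergence _ _ _ m K mK
    (fun k x => (f_ k x)%:E) (EFin \o f) (cst M%:E).
- by move=> k; apply/measurable_EFinP.
- exact/measurable_EFinP.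
- by apply: aeW => x Kx; apply: cvg_EFin; [exact: nearW|exact: cf].
- by apply: bmf_integrable => //; exact: bmf_cst.
- by apply: aeW => x k Kx; rewrite lee_fin hM.
have fin := integrable_fin_num mK fint.
apply: fine_cvg; rewrite fineK//.
Qed.

(** A Toeplitz integrand may be unbounded away from the support, so [f] is only measurable on [D];
    the extended integrals already agree, the integrands being equal almost everywhere. *)
Lemma Rintegral_negligible D K f : measurable D -> measurable K -> K `<=` D ->
  measurable_fun D f -> m (D `\` K) = 0%E ->
  \int[m]_(x in D) f x = \int[m]_(x in K) f x.
Proof.
move=> mD mK KD mf mDK; congr fine.
rewrite -[in RHS](setIidr KD) integral_mkcondr.
have mK' : measurable_fun D (EFin \o f) by exact/measurable_EFinP.
apply: ae_eq_integral => //.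
  apply/(measurable_restrict (EFin \o f) mK mD).
  by apply: measurable_funS mK' => // x [].
exists (D `\` K); split => //; first exact: measurableD.
move=> x /= /not_implyP[Dx fx]; split => // Kx; apply: fx.
by rewrite patchE mem_set.
Qed.

End finite_measure.

Section charges.
Variable nu : {charge set T -> \bar R}.
Local Notation jp := (jordan_pos (hahn_posneg nu)).
Local Notation jn := (jordan_neg (hahn_posneg nu)).

(** Each Jordan part is, up to sign, the restriction of [nu] to one set of the Hahn decomposition,
    hence on [A] it only sees values of [nu] at measurable subsets of [A]. *)
Lemma jordan_null A : measurable A ->
  (forall B, measurable B -> B `<=` A -> nu B = 0%E) -> jp A = 0%E /\ jn A = 0%E.
Proof.
move=> mA A0; have [[mP _] [mN _] _ _] := hahn_posneg nu.
split.
  rewrite jordan_posE cjordan_posE /crestr0 mem_set// /crestr A0//.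
  exact: measurableI.
rewrite jordan_negE cjordan_negE /crestr0 mem_set// /crestr A0 ?oppe0//.
exact: measurableI.
Qed.

Lemma charge_jordan A : measurable A -> nu A = (jp A - jn A)%E.
Proof.
move=> mA; rewrite (jordan_decomp (hahn_posneg nu) mA) /cadd /= /cscale.
by rewrite EFinN mulN1e.
Qed.

Lemma charge_integral_lin K a f g : measurable K -> bmf K f -> bmf K g ->
  charge_integral nu K (fun x => a * f x + g x) =
  a * charge_integral nu K f + charge_integral nu K g.
Proof.
by move=> mK bf bg; rewrite /charge_integral !Rintegral_bmf_lin//; ring.
Qed.

Lemma charge_integral_bound K f M : measurable K -> bmf K f ->
  (forall x, K x -> `|f x| <= M) ->
  `|charge_integral nu K f| <= M * (fine (jp K) + fine (jn K)).
Proof.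
move=> mK bf hM; apply: le_trans (ler_normB _ _) _.
by rewrite mulrDr lerD// Rintegral_bmf_bound.
Qed.

Lemma charge_integral_cvg K (f_ : nat -> T -> R) f M : measurable K ->
  (forall k, measurable_fun K (f_ k)) -> measurable_fun K f ->
  (forall k x, K x -> `|f_ k x| <= M) ->
  (forall x, K x -> f_ ^~ x @ \oo --> f x) ->
  (fun k => charge_integral nu K (f_ k)) @ \oo --> charge_integral nu K f.
Proof.
by move=> mK mf_ mf hM cf; apply: cvgB; apply: (Rintegral_bmf_cvg (M := M)).
Qed.

Lemma charge_integral_negligible D K f : measurable D -> measurable K ->
  K `<=` D -> measurable_fun D f ->
  (forall B, measurable B -> B `<=` D `\` K -> nu B = 0%E) ->
  charge_integral nu D f = charge_integral nu K f.
Proof.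
move=> mD mK KD mf H; have [p0 n0] := jordan_null (measurableD mD mK) H.
by rewrite /charge_integral; congr (_ - _); exact: Rintegral_negligible.
Qed.

End charges.

Section complex_measure.
Variable mu : {charge set T -> \bar R[i]}.
Implicit Types h : T -> R[i].

(** Null sets of the total variation, phrased through measurable subsets; [A] itself may fail to be
    measurable. *)
Definition charge_null A := forall B, measurable B -> B `<=` A -> mu B = 0%E.

Lemma null_ReIm B : mu B = 0%E -> charge_Re mu B = 0%E /\ charge_Im mu B = 0%E.
Proof. by rewrite /charge_Re /charge_Im => ->. Qed.

Lemma mu_fine A : measurable A -> mu A = (fine (mu A))%:E.
Proof. by move=> mA; rewrite fineK// fin_num_measure. Qed.

Lemma charge_ReIm0 A : charge_Re mu A = 0%E -> charge_Im mu A = 0%E ->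
  measurable A -> mu A = 0%E.
Proof.
move=> [r0] [i0] mA; rewrite mu_fine//; congr EFin.
by apply: Re_Im_inj; rewrite ?r0 ?i0.
Qed.

(** Four positive measures replace the charge, which gives access to monotonicity and countable
    subadditivity. *)
Lemma charge_nullP A : measurable A -> charge_null A <->
  [/\ jordan_pos (hahn_posneg (charge_Re mu)) A = 0%E,
      jordan_neg (hahn_posneg (charge_Re mu)) A = 0%E,
      jordan_pos (hahn_posneg (charge_Im mu)) A = 0%E &
      jordan_neg (hahn_posneg (charge_Im mu)) A = 0%E].
Proof.
move=> mA; split => [A0|[H1 H2 H3 H4] B mB BA].
  have [] := @jordan_null (charge_Re mu) A mA.
    by move=> B mB BA; apply: (null_ReIm (A0 B mB BA)).1.
  have [] := @jordan_null (charge_Im mu) A mA.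
    by move=> B mB BA; apply: (null_ReIm (A0 B mB BA)).2.
  by [].
have z (m : {measure set T -> \bar R}) : m A = 0%E -> m B = 0%E.
  move=> mA0; apply/eqP; rewrite eq_le measure_ge0 andbT -mA0.
  by rewrite le_measure ?inE.
apply: charge_ReIm0 => //.
  by rewrite charge_jordan// !z// sube0.
by rewrite charge_jordan// !z// sube0.
Qed.

Lemma charge_null_sub A B : A `<=` B -> charge_null B -> charge_null A.
Proof. by move=> AB B0 C mC CA; apply: B0 => // x /CA /AB. Qed.

Lemma charge_null_bigcup (F : nat -> set T) : (forall k, measurable (F k)) ->
  (forall k, charge_null (F k)) -> charge_null (\bigcup_k F k).
Proof.
move=> mF F0; have mU : measurable (\bigcup_k F k) by exact: bigcupT_measurable.
have z (m : {measure set T -> \bar R}) : (forall k, m (F k) = 0%E) ->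
    m (\bigcup_k F k) = 0%E.
  move=> H; apply/eqP; rewrite eq_le measure_ge0 andbT.
  apply: (le_trans (@measure_sigma_subadditive _ _ _ m _ _ mF mU (@subset_refl _ _))).
  by rewrite eseries0.
apply/charge_nullP => //; split; apply: z => k; by have [] := (charge_nullP (mF k)).1 (F0 k).
Qed.

Definition bmfC K h := bmf K (fun x => complex.Re (h x)) /\
  bmf K (fun x => complex.Im (h x)).

Lemma bmfC_mul K (f g : T -> R[i]) : bmfC K f -> bmfC K g -> bmfC K (fun x => f x * g x).
Proof.
move=> [rf jf] [rg jg]; split.
  have := bmf_sub (bmf_mul rf rg) (bmf_mul jf jg).
  by congr bmf; apply/funext => x; rewrite cReM.
have := bmf_add (bmf_mul rf jg) (bmf_mul jf rg).
by congr bmf; apply/funext => x; rewrite cImM.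
Qed.

Lemma bmfC_conj K (f : T -> R[i]) : bmfC K f -> bmfC K (fun x => conjc (f x)).
Proof.
move=> [rf jf]; split.
  by move: rf; congr bmf; apply/funext => x; case: (f x).
have := bmf_lin (-1) jf (bmf_cst K 0); congr bmf; apply/funext => x.
by rewrite addr0 mulN1r; case: (f x).
Qed.

Lemma bmfC_cst K c : bmfC K (fun=> c).
Proof. by split; exact: bmf_cst. Qed.

Lemma cmeasure_integral_lin K (a : R[i]) (f g : T -> R[i]) : measurable K -> bmfC K f -> bmfC K g ->
  cmeasure_integral mu K (fun x => a * f x + g x) =
  a * cmeasure_integral mu K f + cmeasure_integral mu K g.
Proof.
move=> mK [rf jf] [rg jg]; rewrite /cmeasure_integral /=.
have -> : (fun x => complex.Re (a * f x + g x)) = (fun x =>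
    complex.Re a * complex.Re (f x) + (- complex.Im a * complex.Im (f x) + complex.Re (g x))).
  by apply/funext => x; rewrite cReD cReM; ring.
have -> : (fun x => complex.Im (a * f x + g x)) = (fun x =>
    complex.Re a * complex.Im (f x) + (complex.Im a * complex.Re (f x) + complex.Im (g x))).
  by apply/funext => x; rewrite cImD cImM; ring.
have b1 := bmf_lin (- complex.Im a) jf rg.
have b2 := bmf_lin (complex.Im a) rf jg.
rewrite !(charge_integral_lin _ _ mK rf b1, charge_integral_lin _ _ mK jf rg,
  charge_integral_lin _ _ mK jf b2, charge_integral_lin _ _ mK rf jg).
by apply: Re_Im_inj; rewrite ?cReD ?cImD ?cReM ?cImM /=; ring.
Qed.

Lemma cmeasure_integral_bound K : measurable K -> exists2 M0 : R, 0 <= M0 &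
  forall h M, bmfC K h -> (forall x, K x -> absC (h x) <= M) ->
  absC (cmeasure_integral mu K h) <= M0 * M.
Proof.
move=> mK.
pose V (nu : {charge set T -> \bar R}) :=
  fine (jordan_pos (hahn_posneg nu) K) + fine (jordan_neg (hahn_posneg nu) K).
have V0 nu : 0 <= V nu by rewrite addr_ge0// fine_ge0.
exists ((V (charge_Re mu) + V (charge_Im mu)) * 2).
  by rewrite mulr_ge0// addr_ge0.
move=> h M [rh jh] hM; apply: le_trans (absC_le _) _ => /=.
have hr x : K x -> `|complex.Re (h x)| <= M by move=> /hM; apply: le_trans (absC_Re _).
have hi x : K x -> `|complex.Im (h x)| <= M by move=> /hM; apply: le_trans (absC_Im _).
apply: le_trans (lerD (ler_normB _ _) (ler_normD _ _)) _.
have := charge_integral_bound (charge_Re mu) mK rh hr.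
have := charge_integral_bound (charge_Re mu) mK jh hi.
have := charge_integral_bound (charge_Im mu) mK rh hr.
have := charge_integral_bound (charge_Im mu) mK jh hi.
rewrite -/(V (charge_Re mu)) -/(V (charge_Im mu)); lra.
Qed.

Lemma cmeasure_integral_cvg K (h_ : nat -> T -> R[i]) h (M : R) : measurable K ->
  (forall k, bmfC K (h_ k)) -> bmfC K h ->
  (forall k x, K x -> absC (h_ k x) <= M) ->
  (forall x, K x -> h_ ^~ x @ \oo --> h x) ->
  (fun k => cmeasure_integral mu K (h_ k)) @ \oo --> cmeasure_integral mu K h.
Proof.
move=> mK mh_ mh hM ch.
have cr nu : (fun k => charge_integral nu K (fun x => complex.Re (h_ k x))) @ \oo
    --> charge_integral nu K (fun x => complex.Re (h x)).
  apply: (charge_integral_cvg (M := M)) => //.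
  - by move=> k; have [[]] := mh_ k.
  - by have [[]] := mh.
  - by move=> k x Kx; apply: le_trans (absC_Re _) (hM k x Kx).
  - by move=> x Kx; apply: (cvg_comp _ _ (ch x Kx)); exact: continuous_Re.
have ci nu : (fun k => charge_integral nu K (fun x => complex.Im (h_ k x))) @ \oo
    --> charge_integral nu K (fun x => complex.Im (h x)).
  apply: (charge_integral_cvg (M := M)) => //.
  - by move=> k; have [_ []] := mh_ k.
  - by have [_ []] := mh.
  - by move=> k x Kx; apply: le_trans (absC_Im _) (hM k x Kx).
  - by move=> x Kx; apply: (cvg_comp _ _ (ch x Kx)); exact: continuous_Im.
have CE (a b : R) : a +i* b = a%:C + 'i * b%:C.
  by apply: Re_Im_inj => /=; ring.
rewrite /cmeasure_integral CE; under eq_fun do rewrite CE.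
apply: cvgD; last apply: cvgMr.
  by apply: (cvg_comp _ _ (cvgB (cr _) (ci _))); exact: continuous_real_complex.
by apply: (cvg_comp _ _ (cvgD (ci _) (cr _))); exact: continuous_real_complex.
Qed.

Lemma cmeasure_integral_negligible D K h : measurable D -> measurable K ->
  K `<=` D -> measurable_fun D (fun x => complex.Re (h x)) ->
  measurable_fun D (fun x => complex.Im (h x)) -> charge_null (D `\` K) ->
  cmeasure_integral mu D h = cmeasure_integral mu K h.
Proof.
move=> mD mK KD mr mi n0; rewrite /cmeasure_integral.
have nr B : measurable B -> B `<=` D `\` K -> charge_Re mu B = 0%E.
  by move=> mB BDK; exact: (null_ReIm (n0 B mB BDK)).1.
have ni B : measurable B -> B `<=` D `\` K -> charge_Im mu B = 0%E.
  by move=> mB BDK; exact: (null_ReIm (n0 B mB BDK)).2.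
by rewrite !(charge_integral_negligible mD mK KD mr nr,
  charge_integral_negligible mD mK KD mr ni, charge_integral_negligible mD mK KD mi nr,
  charge_integral_negligible mD mK KD mi ni).
Qed.

End complex_measure.

End bounded_measurable_functions.

Lemma cmeasure_integral_eq dd (T : measurableType dd) (R : realType)
    (mu : {charge set T -> \bar R[i]}) (D : set T) (f g : T -> R[i]) :
  (forall x, D x -> f x = g x) -> cmeasure_integral mu D f = cmeasure_integral mu D g.
Proof.
move=> fg; rewrite /cmeasure_integral /charge_integral.
have S (k : R[i] -> R) (nu : {measure set T -> \bar R}) :
    \int[nu]_(x in D) k (f x) = \int[nu]_(x in D) k (g x).
  by congr fine; apply: eq_integral => x; rewrite inE => Dx; rewrite fg.
by rewrite !(S (@complex.Re R)) !(S (@complex.Im R)).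
Qed.

Lemma cmeasure_integral0 dd (T : measurableType dd) (R : realType)
    (mu : {charge set T -> \bar R[i]}) (D : set T) :
  cmeasure_integral mu D (fun=> 0) = 0.
Proof.
rewrite /cmeasure_integral /charge_integral /=.
have S (nu : {measure set T -> \bar R}) : \int[nu]_(x in D) (0 : R) = 0.
  by rewrite /Rintegral integral0.
by rewrite !S !subr0 addr0.
Qed.

(** * Support and point masses *)

Section min_max_cvg.
Variables (R : realType) (T : Type) (F : set_system T).
Context {FF : Filter F}.
Implicit Types (f g : T -> R) (a b : R).

Lemma cvg_maxr f g a b : f @ F --> a -> g @ F --> b ->
  (fun x => Num.max (f x) (g x)) @ F --> Num.max a b.
Proof.
move=> fa gb; rewrite maxr_absE; under eq_fun do rewrite maxr_absE.
apply: cvgMl; apply: cvgD; first exact: cvgD.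
by apply: cvg_norm; exact: cvgB.
Qed.

Lemma cvg_minr f g a b : f @ F --> a -> g @ F --> b ->
  (fun x => Num.min (f x) (g x)) @ F --> Num.min a b.
Proof.
move=> fa gb; rewrite minr_absE; under eq_fun do rewrite minr_absE.
apply: cvgMl; apply: cvgB; first exact: cvgD.
by apply: cvg_norm; exact: cvgB.
Qed.

End min_max_cvg.

Section borel_sets.
Variables (R : realType) (d : nat).
Local Notation Cd := 'rV[R[i]]_d.

Lemma open_measurableC (U : set Cd) : open U -> measurable U.
Proof. by move=> oU; exact: sub_sigma_algebra. Qed.

Lemma closed_measurableC (F : set Cd) : closed F -> measurable F.
Proof.
move=> cF; rewrite -[F]setCK; apply: measurableC; apply: open_measurableC.
exact: closed_openC.
Qed.

Lemma compact_measurableC (K : set Cd) : compact K -> measurable K.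
Proof.
by move=> cK; apply: closed_measurableC; apply: compact_closed.
Qed.

Lemma measurable_set1C (p : Cd) : measurable [set p].
Proof. by apply: compact_measurableC; exact: compact_set1. Qed.

Lemma continuous_on_measurable (O : set Cd) (f : Cd -> R) : open O ->
  (forall x, O x -> f @ x --> f x) -> measurable_fun O f.
Proof.
move=> oO cf; apply: (measurability _ (RGenOpens.measurableE R)) => _ [_ [a [b ->]] <-].
have openP (A : set Cd) : (forall x, A x -> nbhs x A) -> open A by rewrite openE.
apply: open_measurableC; apply: openP => x [Ox fx]; apply: filterI.
  exact: open_nbhs_nbhs.
by apply: cf => //; apply: open_nbhs_nbhs; split => //; exact: interval_open.
Qed.

Lemma continuous_on_bmf (O K : set Cd) (f : Cd -> R) : open O -> K `<=` O ->
  compact K -> (forall x, O x -> f @ x --> f x) -> bmf K f.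
Proof.
move=> oO KO cK cf; split.
  apply: measurable_funS KO _; first exact: open_measurableC.
  exact: continuous_on_measurable.
have [M _ hM] := continuous_compact_bound cK (fun x Kx => cf x (KO x Kx)).
by exists M.
Qed.

Lemma continuous_on_bmfC (O K : set Cd) (f : Cd -> R[i]) : open O -> K `<=` O ->
  compact K -> (forall x, O x -> f @ x --> f x) -> bmfC K f.
Proof.
move=> oO KO cK cf; split; apply: (continuous_on_bmf oO KO cK) => x Ox.
  by apply: (cvg_comp _ _ (cf x Ox)); exact: continuous_Re.
by apply: (cvg_comp _ _ (cf x Ox)); exact: continuous_Im.
Qed.

Lemma continuous_bmfC (K : set Cd) (f : Cd -> R[i]) :
  compact K -> continuous f -> bmfC K f.
Proof.
move=> cK cf; apply: (continuous_on_bmfC (@openT Cd)) => // x _; exact: cf.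
Qed.

Lemma nbhs_rat_box (z : Cd) (U : set Cd) : nbhs z U ->
  exists p, rat_box p z /\ @rat_box R d p `<=` U.
Proof.
rewrite nbhsE => -[V [oV Vz] VU]; move: Vz.
rewrite (open_bigcup_rat_box oV) => -[p /= pV pz].
by exists p; split => //; exact: subset_trans VU.
Qed.

(** A product of tent functions, continuous and positive exactly on [rat_box p]; it cuts test
    functions down to a box. *)
Definition rat_bump (p : {ffun 'I_d -> rat * rat} * nat) (z : Cd) : R :=
  \prod_j (Num.max 0 (p.2.+1%:R^-1 - `|complex.Re (z ord0 j) - ratr (p.1 j).1|) *
           Num.max 0 (p.2.+1%:R^-1 - `|complex.Im (z ord0 j) - ratr (p.1 j).2|)).

Lemma rat_bump_ge0 p z : 0 <= rat_bump p z.
Proof. by apply: prodr_ge0 => j _; rewrite mulr_ge0// le_max lexx. Qed.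

Lemma rat_bump_gt0 p z : (0 < rat_bump p z) <-> rat_box p z.
Proof.
have max_gt0 (x : R) : (0 < Num.max 0 x) = (0 < x) by rewrite lt_max ltxx.
split => [H j|H]; last first.
  apply: prodr_gt0 => j _; have [h1 h2] := H j.
  by rewrite mulr_gt0// max_gt0 subr_gt0.
have : rat_bump p z != 0 by rewrite gt_eqF.
move=> /prodf_neq0/(_ j isT); rewrite mulf_eq0 negb_or => /andP[h1 h2].
by split; rewrite -subr_gt0 -max_gt0 lt_def ?h1 ?h2 le_max lexx.
Qed.

Lemma continuous_Re_coord (j : 'I_d) : continuous (fun z : Cd => complex.Re (z ord0 j)).
Proof.
move=> z; apply: (cvg_comp (fun z : Cd => z ord0 j) (@complex.Re R)).
  exact: coord_continuous.
exact: continuous_Re.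
Qed.

Lemma continuous_Im_coord (j : 'I_d) : continuous (fun z : Cd => complex.Im (z ord0 j)).
Proof.
move=> z; apply: (cvg_comp (fun z : Cd => z ord0 j) (@complex.Im R)).
  exact: coord_continuous.
exact: continuous_Im.
Qed.

Lemma continuous_rat_bump p : continuous (rat_bump p).
Proof.
move=> z.
have c0 (q : R) (f : Cd -> R) : continuous f ->
    (fun z => Num.max 0 (p.2.+1%:R^-1 - `|f z - q|)) @ z --> Num.max 0 (p.2.+1%:R^-1 - `|f z - q|).
  move=> cf; apply: (cvg_maxr (FF := nbhs_filter z)); first exact: cvg_cst.
  apply: cvgB; first exact: cvg_cst.
  by apply: cvg_norm; apply: cvgB; [exact: cf|exact: cvg_cst].
apply: (@cvg_big _ _ _ _ _ (@mul_continuous R) _ _ _ _ _ (nbhs_filter z)) => j _.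
apply: (cvgM (FF := nbhs_filter z)).
  exact: (c0 _ _ (@continuous_Re_coord j)).
exact: (c0 _ _ (@continuous_Im_coord j)).
Qed.

(** A pi-system adapted to test functions: the indicator of the set where g > 0 is the pointwise
    limit of the continuous functions min(1, k max(0, g)). *)
Definition positivity_sets : set (set Cd) :=
  [set W | exists2 g : Cd -> R, continuous g & W = [set z | 0 < g z]].

Lemma positivity_sets_setI : setI_closed positivity_sets.
Proof.
move=> _ _ [g cg ->] [h ch ->]; exists (fun z => Num.min (g z) (h z)).
  by move=> z; apply: (cvg_minr (FF := nbhs_filter z)); [exact: cg|exact: ch].
by apply/seteqP; split => z /=; rewrite lt_min => /andP.
Qed.

(** Every open set is a countable union of rational boxes, and each box is the positivity set of its
    bump. *)
Lemma measurable_positivity_sets :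
  (measurable : set (set Cd)) = <<s positivity_sets >>.
Proof.
apply/seteqP; split.
  apply: smallest_sub; first exact: smallest_sigma_algebra.
  move=> U oU; rewrite (open_bigcup_rat_box oU) bigcup_mkcond.
  apply: (@countable_bigcupT_measurable _ (g_sigma_algebraType positivity_sets)).
    exact: countableP.
  move=> p; case: ifPn => // _; apply: sub_sigma_algebra.
  exists (rat_bump p); first exact: continuous_rat_bump.
  by apply/seteqP; split => z /= /rat_bump_gt0.
apply: smallest_sub; first exact: smallest_sigma_algebra.
move=> _ [g cg ->]; apply: open_measurableC.
have -> : [set z | 0 < g z] = g @^-1` [set x | 0 < x] by [].
by apply: open_comp; [move=> z _; exact: cg|exact: open_gt].
Qed.

End borel_sets.

Section borel_complex_measures.
Variables (R : realType) (d : nat).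
Local Notation Cd := 'rV[R[i]]_d.
Variable mu : {charge set Cd -> \bar R[i]}.

(** The partition of [U] into [B], its complement in [U] and empty sets competes in the supremum, so
    the total variation of [U] dominates the modulus of the mass of [B]. *)
Lemma total_variation0_null (U : set Cd) : measurable U ->
  Defs.total_variation mu U = 0%E -> charge_null mu U.
Proof.
move=> mU tv0 B mB BU.
pose F (k : nat) := if k is 0 then B else if k is 1 then U `\` B else set0.
have mF k : measurable (F k).
  by case: k => [//|[|k]]; [exact: measurableD|exact: measurable0].
have : (\sum_(0 <= k <oo) (absC (fine (mu (F k))))%:E <= Defs.total_variation mu U)%E.
  apply: ereal_sup_ubound; exists F => //; split => //.
    apply/trivIsetP => -[|[|i]] [|[|j]] _ _ //= _; rewrite ?set0I ?setI0//.
      by rewrite setIDA setIC -setIDA setDv setI0.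
    by rewrite setIC setIDA setIC -setIDA setDv setI0.
  apply/seteqP; split.
    by move=> x [[|[|k]] _ //=]; [exact: BU|case].
  by move=> x Ux; have [Bx|Bx] := pselect (B x); [exists 0%N|exists 1%N].
rewrite tv0 => h.
have h0 k : (0 <= (absC (fine (mu (F k))))%:E)%E by rewrite lee_fin absC_ge0.
have := le_trans (nneseries_lim_ge (P := xpredT) (m := 0%N) 1 (fun k _ _ => h0 k)) h.
rewrite big_nat1 /= lee_fin => le0.
have : fine (mu B) == 0 by rewrite -absC_eq0 eq_le le0 absC_ge0.
by move=> /eqP f0; rewrite (mu_fine mu mB) f0.
Qed.

(** A Lindelof argument: the rational boxes that are null cover [A], and there are only countably
    many of them. *)
Lemma charge_null_local (A : set Cd) :
  (forall z, A z -> exists2 U, nbhs z U & charge_null mu U) -> charge_null mu A.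
Proof.
move=> loc.
pose F k : set Cd := if unpickle k is Some p then
  if `[< charge_null mu (@rat_box R d p) >] then @rat_box R d p else set0 else set0.
have null0 : charge_null mu set0.
  by move=> B _; rewrite subset0 => ->; exact: charge0.
have mbox p : measurable (@rat_box R d p).
  rewrite (_ : rat_box p = [set z | 0 < rat_bump p z]).
    have -> : [set z | 0 < @rat_bump R d p z] = rat_bump p @^-1` [set x | 0 < x] by [].
    apply: open_measurableC.
    by apply: open_comp; [move=> z _; exact: continuous_rat_bump|exact: open_gt].
  by apply/seteqP; split => z /= /rat_bump_gt0.
apply: (@charge_null_sub _ _ _ mu A (\bigcup_k F k)).
  move=> z /loc[U zU U0]; have [p [pz pU]] := nbhs_rat_box zU.
  exists (pickle p) => //; rewrite /F pickleK; case: ifPn => // /asboolPn[].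
  exact: charge_null_sub U0.
apply: charge_null_bigcup => k; rewrite /F; case: unpickle => [p|//].
  by case: ifPn => // _; exact: mbox.
by case: ifPn => // /asboolP.
Qed.

Lemma null_outside_support : charge_null mu (~` cmeasure_support mu).
Proof.
apply: charge_null_local => z /existsNP[U /not_implyP[zU /negP]].
rewrite negbK => /eqP tv0.
exists U; first exact: open_nbhs_nbhs.
by apply: total_variation0_null => //; apply: open_measurableC; case: zU.
Qed.

Lemma charge_nullU (A B : set Cd) : measurable A -> measurable B ->
  charge_null mu A -> charge_null mu B -> charge_null mu (A `|` B).
Proof.
move=> mA mB nA nB; rewrite -bigcup2E; apply: charge_null_bigcup.
  by move=> [|[|k]] //=; exact: measurable0.
by move=> [|[|k]] //= C _; rewrite subset0 => ->; exact: charge0.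
Qed.

End borel_complex_measures.

(** * Null sets detected by continuous test functions *)

Section locally_zero.
Variables (R : realType) (d : nat).
Local Notation Cd := 'rV[R[i]]_d.
Variable K : set Cd.
Hypothesis cK : compact K.

Let mK : measurable K. Proof. exact: compact_measurableC. Qed.

Lemma open_rat_box p : open (@rat_box R d p).
Proof.
rewrite (_ : rat_box p = rat_bump p @^-1` [set x | 0 < x]); last first.
  by apply/seteqP; split => z /= /rat_bump_gt0.
by apply: open_comp; [move=> z _; exact: continuous_rat_bump|exact: open_gt].
Qed.

Lemma measurable_rat_box p : measurable (@rat_box R d p).
Proof. by apply: open_measurableC; exact: open_rat_box. Qed.

Lemma charge_integral_indic (nu : {charge set Cd -> \bar R}) A : measurable A ->
  charge_integral nu K \1_A =
  fine (jordan_pos (hahn_posneg nu) (A `&` K)) - fine (jordan_neg (hahn_posneg nu) (A `&` K)).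
Proof.
by move=> mA; rewrite /charge_integral /Rintegral !integral_indic.
Qed.

Lemma charge_integral0 (nu : {charge set Cd -> \bar R}) :
  charge_integral nu K (fun=> 0) = 0.
Proof. by rewrite /charge_integral !Rintegral_cst// !mul0r subrr. Qed.

(** Restricted to the box and to [K], the two Jordan parts agree on positivity sets by dominated
    convergence, hence on all Borel sets by uniqueness of measures on a pi-system; [nu] is their
    difference. *)
Lemma real_locally_zero_null (nu : {charge set Cd -> \bar R}) p :
  (forall f : Cd -> R, continuous f -> (forall z, ~ rat_box p z -> f z = 0) ->
    charge_integral nu K f = 0) ->
  forall B, measurable B -> B `<=` rat_box p `&` K -> nu B = 0%E.
Proof.
move=> nu0; set V := rat_box p `&` K.
have mV : measurable V by apply: measurableI => //; exact: measurable_rat_box.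
pose mp := mrestr (jordan_pos (hahn_posneg nu)) mV.
pose mn := mrestr (jordan_neg (hahn_posneg nu)) mV.
have eqG A : positivity_sets A -> mp A = mn A.
  move=> [g cg AE].
  pose x (z : Cd) := Num.max 0 (g z) * rat_bump p z.
  have x0 z : 0 <= x z by rewrite mulr_ge0 ?rat_bump_ge0// le_max lexx.
  have cx : continuous x.
    move=> z; apply: (cvgM (FF := nbhs_filter z)); last exact: continuous_rat_bump.
    by apply: (cvg_maxr (FF := nbhs_filter z)); [exact: cvg_cst|exact: cg].
  (* These functions vanish off the box and increase to the indicator of the part of [A] inside
     it. *)
  pose f (k : nat) z := Num.min 1 (k%:R * x z).
  have cf k : continuous (f k).
    move=> z; apply: (cvg_minr (FF := nbhs_filter z)); first exact: cvg_cst.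
    by apply: (cvgM (FF := nbhs_filter z)); [exact: cvg_cst|exact: cx].
  have f0 k : charge_integral nu K (f k) = 0.
    apply: nu0; first exact: cf.
    move=> z /rat_bump_gt0/negP; rewrite -leNgt => b0.
    have -> : f k z = Num.min 1 (k%:R * (Num.max 0 (g z) * rat_bump p z)) by [].
    have -> : rat_bump p z = 0 by apply/eqP; rewrite eq_le b0 rat_bump_ge0.
    by rewrite !mulr0 minEle ler10.
  have mA : measurable A.
    by rewrite measurable_positivity_sets; apply: sub_sigma_algebra; exists g.
  have mAV : measurable (A `&` rat_box p).
    by apply: measurableI => //; exact: measurable_rat_box.
  have := @charge_integral_cvg _ _ _ nu K f \1_(A `&` rat_box p) 1 mK _ _ _ _.
  have -> : (fun k => charge_integral nu K (f k)) = (fun=> 0) by exact/funext.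
  rewrite charge_integral_indic// => H.
  have {H} : (fun=> 0 : R) @ \oo -->
      fine (jordan_pos (hahn_posneg nu) (A `&` rat_box p `&` K)) -
      fine (jordan_neg (hahn_posneg nu) (A `&` rat_box p `&` K)).
    apply: H.
    - move=> k; apply: measurable_funTS; apply: continuous_borel_measurable.
      exact: cf.
    - exact: measurable_indic.
    - move=> k z _; rewrite ger0_norm ?ge_min ?lexx//.
      by rewrite le_min ler01 mulr_ge0.
    move=> z _; have [[Az pz]|nAz] := pselect ((A `&` rat_box p) z).
      rewrite indicE mem_set//=.
      have xz : 0 < x z.
        by rewrite mulr_gt0//; [rewrite lt_max -/(g z); move: Az; rewrite AE /= => ->; rewrite orbT|exact/rat_bump_gt0].
      apply: cvg_near_cst; exists (Num.truncn (x z)^-1).+1 => // k /= hk.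
      rewrite /f minEle ifT// -ler_pdivrMr// div1r.
      apply: ltW; apply: lt_le_trans (truncnS_gt _) _.
      by rewrite ler_nat.
    rewrite indicE memNset//= (_ : f ^~ z = fun=> 0); first exact: cvg_cst.
    apply/funext => k; rewrite /f (_ : x z = 0) ?mulr0 ?minEle ?ler10//.
    rewrite /x; have [gz|gz] := leP (g z) 0; first by rewrite mul0r.
    have [bz|bz] := leP (rat_bump p z) 0.
      rewrite (_ : rat_bump p z = 0) ?mulr0//.
      by apply/eqP; rewrite eq_le bz rat_bump_ge0.
    by exfalso; apply: nAz; split; [rewrite AE|exact/rat_bump_gt0].
  move=> /(cvg_unique (@norm_hausdorff _ R^o) (cvg_cst 0)) /esym/eqP.
  rewrite subr_eq0 => /eqP E; rewrite /mp /mn /mrestr /V setIA.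
  have mAVK : measurable (A `&` rat_box p `&` K) by exact: measurableI.
  by rewrite -[LHS]fineK ?fin_num_measure// -[RHS]fineK ?fin_num_measure// E.
have eqM A : measurable A -> mp A = mn A.
  apply: (measure_unique (@positivity_sets R d) (fun=> setT)).
  - exact: measurable_positivity_sets.
  - exact: positivity_sets_setI.
  - move=> _; exists (fun=> 1); first exact: cst_continuous.
    by apply/seteqP; split => [z _|z _] //=; rewrite ltr01.
  - by rewrite bigcup_const.
  - exact: eqG.
  - by move=> _; rewrite /= /mrestr setTI ltey_eq fin_num_measure.
move=> B mB BV; have := eqM B mB; rewrite /mp /mn /mrestr setIidl// => E.
by rewrite charge_jordan// E subee// fin_num_measure.
Qed.

Variable mu : {charge set Cd -> \bar R[i]}.
Local Notation L := (cmeasure_integral mu K).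

Lemma locally_zero_null p :
  (forall h, continuous h -> (forall z, ~ rat_box p z -> h z = 0) -> L h = 0) ->
  charge_null mu (rat_box p `&` K).
Proof.
move=> L0.
have H (f : Cd -> R) : continuous f -> (forall z, ~ rat_box p z -> f z = 0) ->
    charge_integral (charge_Re mu) K f = 0 /\ charge_integral (charge_Im mu) K f = 0.
  move=> cf f0.
  have ch : continuous (fun z => (f z)%:C).
    by move=> z; apply: (@continuous_comp _ _ _ f (fun x : R => x%:C)); [exact: cf|exact: continuous_real_complex].
  have h0 z : ~ rat_box p z -> (f z)%:C = 0 by move=> /f0 ->.
  have := L0 _ ch h0; have -> : L (fun z => (f z)%:C) =
      charge_integral (charge_Re mu) K f +i* charge_integral (charge_Im mu) K f.
    by rewrite /cmeasure_integral /= !charge_integral0 subr0 add0r.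
  by case.
move=> B mB BV; apply: charge_ReIm0 => //.
  apply: real_locally_zero_null BV => // f cf f0; exact: (H f cf f0).1.
by apply: real_locally_zero_null BV => // f cf f0; exact: (H f cf f0).2.
Qed.

Hypothesis null_K : charge_null mu (~` K).

Lemma not_locally_nonzero_null z : ~ locally_nonzero L z ->
  exists2 U, nbhs z U & charge_null mu U.
Proof.
move=> /existsNP[U /not_implyP[zU nh]].
have [p [pz pU]] := nbhs_rat_box zU; exists (rat_box p).
  by apply: open_nbhs_nbhs; split => //; exact: open_rat_box.
have n1 : charge_null mu (rat_box p `&` K).
  apply: locally_zero_null => h ch h0; apply: contrapT => Lh; apply: nh; exists h.
  by split => // x Ux; apply: h0 => px; apply: Ux; exact: pU.
have mp := @measurable_rat_box p.
apply: (@charge_null_sub _ _ _ mu _ ((rat_box p `&` K) `|` ~` K)).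
  by move=> x px; have [Kx|Kx] := pselect (K x); [left|right].
apply: charge_nullU => //; first exact: measurableI.
exact: measurableC.
Qed.

Lemma locally_nonzero_sub z : locally_nonzero L z -> K z.
Proof.
move=> nz; apply: contrapT => Kz.
have [h [ch h0]] := nz (~` K) (open_nbhs_nbhs (conj (closed_openC (compact_closed (@norm_hausdorff _ _) cK)) Kz)).
apply; rewrite -[RHS](cmeasure_integral0 mu K); apply: cmeasure_integral_eq => x Kx.
by apply: h0 => /= /(_ Kx).
Qed.

Lemma finitely_many_points N :
  (forall p : 'I_N.+1 -> Cd, injective p -> ~ (forall k, locally_nonzero L (p k))) ->
  exists s : seq Cd, [/\ uniq s, (size s <= N)%N, (forall p, p \in s -> K p) &
    charge_null mu (~` [set` s])].
Proof.
move=> noinj.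
(* Greedy enumeration of the support of [L]: either [m] distinct points are found, or the search has
   stopped earlier with a complete list. *)
have H m : (exists s : seq Cd, [/\ uniq s, size s = m & forall p, p \in s -> locally_nonzero L p])
  \/ (exists s : seq Cd, [/\ uniq s, (size s < m)%N, (forall p, p \in s -> locally_nonzero L p) &
     forall p, locally_nonzero L p -> p \in s]).
  elim: m => [|m [[s [us ss ps]]|[s [us ss ps sp]]]]; first by left; exists [::].
    have [all|/existsNP[q /not_implyP[nq /negP qs]]] :=
        pselect (forall p, locally_nonzero L p -> p \in s).
      by right; exists s; rewrite ss.
    left; exists (q :: s); split; [by rewrite /= qs us|by rewrite /= ss|move=> r].
    by rewrite inE => /orP[/eqP ->|rs]; [exact: nq|exact: ps].
  by right; exists s; split; [exact: us|exact: ltnW|exact: ps|exact: sp].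
have [[s [us ss ps]]|[s [us ss ps sp]]] := H N.+1.
  exfalso; apply: (noinj (fun k => nth 0 s k)).
    move=> i j /eqP; rewrite nth_uniq ?ss// => /eqP ij; exact: val_inj.
  by move=> k; apply: ps; rewrite mem_nth ?ss.
exists s; split; [exact: us|exact: ss|by move=> p /ps; exact: locally_nonzero_sub|].
apply: charge_null_local => z /= zs; apply: not_locally_nonzero_null => /sp.
exact: zs.
Qed.

End locally_zero.

(** * Charges carried by finitely many points *)

Section point_masses.
Variables (R : realType) (d : nat).
Local Notation Cd := 'rV[R[i]]_d.
Variable mu : {charge set Cd -> \bar R[i]}.

Lemma set_seq_cons (x : Cd) s : [set` x :: s] = [set x] `|` [set` s].
Proof.
apply/seteqP; split => y /=; first by rewrite inE => /orP[/eqP|]; [left|right].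
by rewrite inE => -[->|->]; rewrite ?eqxx ?orbT.
Qed.

Lemma measurable_seqC (s : seq Cd) : measurable [set` s].
Proof.
elim: s => [|x s IH]; first by rewrite set_nil; exact: measurable0.
by rewrite set_seq_cons; apply: measurableU => //; exact: measurable_set1C.
Qed.

Lemma mu_setI_seq (s : seq Cd) A : measurable A -> uniq s ->
  mu (A `&` [set` s]) = (\sum_(p <- s) fine (mu [set p]) * \1_A p)%:E.
Proof.
move=> mA; elim: s => [_|x s IH /= /andP[xs us]].
  by rewrite set_nil setI0 charge0 big_nil.
rewrite set_seq_cons setIUr chargeU; last 3 first.
- by apply: measurableI => //; exact: measurable_set1C.
- by apply: measurableI => //; exact: measurable_seqC.
- apply/seteqP; split => // y /= [[_ ->] [_ sx]]; by rewrite sx in xs.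
rewrite IH// big_cons EFinD; congr (_ + _)%E.
rewrite indicE; have [Ax|Ax] := pselect (A x).
  rewrite mem_set// mulr1 (_ : A `&` [set x] = [set x]).
    by rewrite -mu_fine//; exact: measurable_set1C.
  by apply/seteqP; split => [y []//|y /= ->].
rewrite memNset// mulr0 (_ : A `&` [set x] = set0) ?charge0//.
by apply/seteqP; split => // y /= [Ay yx]; apply: Ax; rewrite -yx.
Qed.

Lemma point_mass_representation N (s : seq Cd) (z0 : Cd) :
  uniq s -> (size s <= N)%N -> charge_null mu (~` [set` s]) ->
  exists lam : 'I_N -> R[i], forall A, measurable A ->
    mu A = (\sum_(k < N) (lam k)%:E * point_mass R (nth z0 s k) A)%E.
Proof.
move=> us ss ns.
(* Exactly [N] terms are required but the list may be shorter: the missing terms get coefficient 0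
   and the default point [z0]. *)
pose c (k : nat) := if (k < size s)%N then fine (mu [set nth z0 s k]) else 0.
exists (fun k => c k) => A mA.
have ms := measurable_seqC s.
have -> : mu A = mu (A `&` [set` s]).
  have n0 : mu (A `\` [set` s]) = 0%E.
    by apply: ns; [exact: measurableD|move=> x []].
  by rewrite (chargeDI mu mA ms) n0 add0e.
rewrite mu_setI_seq//.
transitivity ((\sum_(k < N) c k * \1_A (nth z0 s k))%:E); last by rewrite -sumEFin.
congr EFin.
rewrite (big_nth z0) -(big_mkord xpredT (fun k => c k * \1_A (nth z0 s k))).
rewrite [RHS](@big_cat_nat _ _ _ (size s))//=.
have -> : \sum_(size s <= k < N) c k * \1_A (nth z0 s k) = 0.
  rewrite big_nat_cond big1// => k /andP[/andP[sk _] _].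
  by rewrite /c ltnNge sk mul0r.
rewrite addr0 !big_mkord; apply: eq_bigr => k _.
by rewrite /c ltn_ord.
Qed.

End point_masses.

(** * The exponential algebra *)

Section complex_differentiability.
Variable R : realType.
Local Notation C := R[i].

(** A division-free form of the complex derivative, in which h = 0 is harmless and remainders are
    estimated by moduli. *)
Definition cdiff (f : C -> C) (z c : C) := forall e : R, 0 < e ->
  exists2 r : R, 0 < r & forall h, absC h < r ->
    absC (f (z + h) - f z - c * h) <= e * absC h.

Lemma differentiable_cdiff (f : C -> C) (z : C) :
  differentiable f z <-> exists c, cdiff f z c.
Proof.
rewrite -derivable1_diffP; split.
  move=> /cvg_ex[/= c H]; exists c => e e0.
  have /cvgC_absP/(_ e e0) := H.
  rewrite near_withinE => /nbhs_ballP[/= _ /pos_real_complex[r r0 ->] Hr].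
  exists r => // h hr.
  have [->|h0] := eqVneq h 0; first by rewrite addr0 subrr mulr0 subrr absC0 mulr0.
  have := Hr h; rewrite -ball_normE /= sub0r normrN normCE ltcR => /(_ hr h0).
  have E (k : C) : (h *: (1 : C) = h) by rewrite /GRing.scale /= mulr1.
  rewrite E // => H1.
  have -> : f (z + h) - f z - c * h = - (c - h^-1 * (f (h + z) - f z)) * h.
    by rewrite (addrC z h); field.
  by rewrite absCM absCN ler_wpM2r ?absC_ge0// ltW.
move=> [c H]; apply/cvg_ex; exists c; apply/cvgC_absP => e e0.
have [r r0 Hr] := H (e / 2) (divr_gt0 e0 (ltr0Sn _ 1)).
rewrite near_withinE; apply/nbhs_ballP; exists r%:C; first by rewrite /= ltcR.
move=> h; rewrite -ball_normE /= sub0r normrN normCE ltcR => hr h0.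
have E (k : C) : (h *: (1 : C) = h) by rewrite /GRing.scale /= mulr1.
rewrite /= E //.
have -> : c - h^-1 *: (f (h + z) - f z) = - (f (z + h) - f z - c * h) / h.
  by rewrite (addrC z h) /GRing.scale /=; field.
rewrite absCM absCN absCV ltr_pdivrMr ?absC_gt0//.
apply: le_lt_trans (Hr h hr) _; rewrite ltr_pM2r ?absC_gt0//.
by rewrite ltr_pdivrMr// ltr_pMr// ltr1n.
Qed.

Lemma is_derive_approx (f : R -> R) (x l : R) : is_derive x 1 f l ->
  forall e : R, 0 < e -> exists2 r : R, 0 < r & forall h, `|h| < r ->
    `|f (x + h) - f x - l * h| <= e * `|h|.
Proof.
move=> [/cvg_ex[/= l' H] fl] e e0.
have ll' : l' = l by rewrite -fl /derive; apply/esym/cvg_lim.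
have /cvgrPdist_lt/(_ e e0) := H; rewrite near_withinE => /nbhs_ballP[/= r r0 Hr].
exists r => // h hr; have [->|h0] := eqVneq h 0.
  by rewrite addr0 subrr mulr0 subrr normr0 mulr0.
have := Hr h; rewrite -ball_normE /= sub0r normrN => /(_ hr h0).
have E (k : R) : (h *: (1 : R) = h) by rewrite /GRing.scale /= mulr1.
rewrite E // ll' => H1.
have -> : f (x + h) - f x - l * h = - (l - h^-1 * (f (h + x) - f x)) * h.
  by rewrite (addrC x h); field.
by rewrite normrM normrN ler_wpM2r// ltW.
Qed.

Lemma expCD (z w : C) : expC (z + w) = expC z * expC w.
Proof.
case: z w => a b [a' b']; rewrite /expC /= expRD cosD sinD.
by apply: Re_Im_inj => /=; ring.
Qed.

Lemma expC0 : expC (0 : C) = 1.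
Proof.
by rewrite /expC /= expR0 cos0 sin0; apply: Re_Im_inj => /=; ring.
Qed.

Lemma absC_cos_sin (x : R) : absC (cos x +i* sin x) = 1.
Proof. by rewrite /= cos2Dsin2 sqrtr1. Qed.

Lemma absC_expC (z : C) : absC (expC z) = expR (complex.Re z).
Proof.
by rewrite /expC absCM absC_cos_sin mulr1 absC_real ger0_norm ?expR_ge0.
Qed.

Lemma conjc_expC (z : C) : conjc (expC z) = expC (conjc z).
Proof.
case: z => a b; rewrite /expC /= cosN sinN.
by apply: Re_Im_inj => /=; ring.
Qed.

Lemma expC_near0 (e : R) : 0 < e -> exists2 r : R, 0 < r & forall h : C, absC h < r ->
  absC (expC h - 1 - h) <= e * absC h.
Proof.
(* The remainder is split below into (e^x - 1 - x) e^(iy), (1 + x) (e^(iy) - 1 - iy) and ixy, which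
   cost 1, 4 and 1 times [e6] times the modulus of h; hence the 6. The bound 1 on [e6] gives |1 + x|
   <= 2. *)
move=> e0; have [e6 [e60 e61 e6e]] : exists e6, [/\ 0 < e6, e6 <= 1 & 6 * e6 <= e].
  exists (Num.min 1 (e / 6)).
  split; [by rewrite lt_min ltr01 divr_gt0|by rewrite ge_min lexx|].
  by rewrite -ler_pdivlMl// mulrC ge_min lexx orbT.
have [r1 r10 H1] := is_derive_approx (is_derive_expR (0 : R)) e60.
have [r2 r20 H2] := is_derive_approx (is_derive_cos (0 : R)) e60.
have [r3 r30 H3] := is_derive_approx (is_derive_sin (0 : R)) e60.
exists (Num.min (Num.min r1 r2) (Num.min r3 e6)).
  by rewrite !lt_min r10 r20 r30 e60.
move=> h; rewrite !lt_min => /andP[/andP[hr1 hr2] /andP[hr3 he6]].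
have hx := absC_Re h; have hy := absC_Im h.
have {}H1 := H1 _ (le_lt_trans hx hr1).
have {}H2 := H2 _ (le_lt_trans hy hr2).
have {}H3 := H3 _ (le_lt_trans hy hr3).
rewrite !add0r expR0 mul1r in H1.
rewrite !add0r cos0 sin0 oppr0 mul0r subr0 in H2.
rewrite !add0r cos0 sin0 mul1r subr0 in H3.
case: h hr1 hr2 hr3 he6 hx hy H1 H2 H3 => x y.
set a := absC _ => _ _ _ ae6 hx hy H1 H2 H3.
rewrite /= in hx hy H1 H2 H3.
have -> : expC (x +i* y) - 1 - (x +i* y) =
    (expR x - 1 - x)%:C * (cos y +i* sin y) +
    (1 + x)%:C * ((cos y - 1) +i* (sin y - y)) + 0 +i* (x * y).
  by rewrite /expC; apply: Re_Im_inj => /=; ring.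
apply: le_trans (absCD _ _) _; apply: le_trans (lerD (absCD _ _) (lexx _)) _.
rewrite !absCM !absC_real absC_cos_sin mulr1.
have xy : absC (0 +i* (x * y)) <= e6 * a.
  apply: le_trans (absC_le _) _; rewrite /= normr0 add0r normrM.
  by apply: ler_pM => //; apply: le_trans (ltW ae6).
have cs : absC ((cos y - 1) +i* (sin y - y)) <= 2 * e6 * a.
  apply: le_trans (absC_le _) _ => /=.
  have : e6 * `|y| <= e6 * a by rewrite ler_pM2l.
  by move: H2 H3; lra.
have x1 : `|1 + x| <= 2.
  apply: le_trans (ler_normD _ _) _; rewrite normr1.
  by have := le_trans hx (ltW ae6); lra.
have a0 : 0 <= a by exact: absC_ge0.
have h1 : e6 * `|x| <= e6 * a by rewrite ler_pM2l.
have h2 : `|1 + x| * absC ((cos y - 1) +i* (sin y - y)) <= 2 * (2 * e6 * a).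
  by apply: ler_pM => //; exact: absC_ge0.
have : 6 * e6 * a <= e * a by rewrite ler_wpM2r.
by move: H1 h1 h2 xy; lra.
Qed.

Lemma differentiable_expC (z : C) : differentiable (@expC R) z.
Proof.
apply/differentiable_cdiff; exists (expC z) => e e0.
have z0 : 0 < absC (expC z) by rewrite absC_expC expR_gt0.
have [r r0 H] := expC_near0 (divr_gt0 e0 z0).
exists r => // h /H hr.
rewrite expCD (_ : _ - _ - _ = expC z * (expC h - 1 - h)); last by ring.
rewrite absCM -ler_pdivlMl//; apply: le_trans hr _.
by rewrite mulrA (mulrC _ e).
Qed.

End complex_differentiability.

Section exponential_algebra.
Variables (R : realType) (d : nat).
Local Notation C := R[i].
Local Notation Cd := 'rV[R[i]]_d.
Implicit Types (a z : Cd).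

Definition lform a z : C := \sum_(j < d) a ord0 j * z ord0 j.

Inductive exp_alg : (Cd -> C) -> Prop :=
| exp_pure c a : exp_alg (fun z => c * expC (lform a z))
| exp_add f g : exp_alg f -> exp_alg g -> exp_alg (fun z => f z + g z).

Lemma lform0 z : lform 0 z = 0.
Proof. by apply: big1 => j _; rewrite mxE mul0r. Qed.

Lemma lformDl a b z : lform (a + b) z = lform a z + lform b z.
Proof. by rewrite -big_split; apply: eq_bigr => j _; rewrite mxE mulrDl. Qed.

Lemma lformBr a z w : lform a (z - w) = lform a z - lform a w.
Proof.
rewrite -sumrN -big_split; apply: eq_bigr => j _ /=.
by rewrite !mxE mulrBr.
Qed.

Lemma exp_alg_cst c : exp_alg (fun=> c).
Proof.
have := exp_pure c 0; congr exp_alg; apply/funext => z.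
by rewrite lform0 expC0 mulr1.
Qed.

Lemma exp_alg_mul f g : exp_alg f -> exp_alg g -> exp_alg (fun z => f z * g z).
Proof.
elim=> [c a|f1 f2 _ IH1 _ IH2 /[dup] /IH1 H1 /IH2 H2].
  elim=> [c' a'|g1 g2 _ IH1 _ IH2].
    have := exp_pure (c * c') (a + a'); congr exp_alg; apply/funext => z.
    by rewrite lformDl expCD; ring.
  by have := exp_add IH1 IH2; congr exp_alg; apply/funext => z; rewrite mulrDr.
by have := exp_add H1 H2; congr exp_alg; apply/funext => z; rewrite mulrDl.
Qed.

Lemma differentiable_lform a z : differentiable (lform a) z.
Proof.
have -> : lform a = \sum_(j < d) (a ord0 j \*: (fun z : Cd => z ord0 j)).
  by apply/funext => w; rewrite fct_sumE.
apply: differentiable_sum => j; apply: differentiableZ.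
exact: differentiable_coord.
Qed.

Lemma exp_alg_differentiable f z : exp_alg f -> differentiable f z.
Proof.
elim=> [c a|f1 f2 _ IH1 _ IH2]; last exact: (differentiableD IH1 IH2).
apply: (@differentiableZ _ _ _ (fun z => expC (lform a z)) c).
apply: (@differentiable_comp _ _ _ _ (lform a) (@expC R)).
  exact: differentiable_lform.
exact: differentiable_expC.
Qed.

Lemma exp_alg_continuous f : exp_alg f -> continuous f.
Proof.
by move=> Ef z; apply: differentiable_continuous; exact: exp_alg_differentiable.
Qed.

(** The complex exponential is not injective, so [a] is chosen to make a.(z - w) real and nonzero;
    then already the moduli of the two values differ. *)
Lemma exp_alg_separates z w : z <> w -> exists2 f, exp_alg f & f z <> f w.
Proof.
move=> zw.
have [j zwj] : exists j, z ord0 j != w ord0 j.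
  apply: contrapT => /forallNP H; apply: zw; apply/rowP => j.
  by have /negP := H j; rewrite negbK => /eqP.
pose a : Cd := \row_k (if k == j then conjc (z ord0 j - w ord0 j) else 0).
exists (fun x => 1 * expC (lform a x)); first exact: exp_pure.
have la : lform a (z - w) = (absC (z ord0 j - w ord0 j) ^+ 2)%:C.
  rewrite /lform (bigD1 j)//= big1 ?addr0; last first.
    by move=> k kj; rewrite mxE (negbTE kj) mul0r.
  by rewrite !mxE eqxx mulrC mulcJ.
rewrite !mul1r -[in expC (lform a z)](subrK w z).
have -> : lform a (z - w + w) = lform a (z - w) + lform a w by rewrite lformBr !subrK.
rewrite expCD la => /(congr1 (@ComplexField.Normc.normc R)).
rewrite absCM !absC_expC /= -[RHS]mul1r => /mulIf h.
have /expR_inj/eqP := etrans (h (lt0r_neq0 (expR_gt0 _))) (esym (expR0 R)).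
by rewrite expf_eq0/= absC_eq0 subr_eq0 (negbTE zwj).
Qed.

End exponential_algebra.

(** * Gaussian integrals and exponentials in the Bargmann space *)

Section density.
Variables (R : realType) (d : nat).
Local Notation Cd := 'rV[R[i]]_d.

Let dens (z : Cd) : \bar R := (gaussian_density z)%:E.

Let dens_ge0 z : (0 <= dens z)%E.
Proof. by rewrite lee_fin gaussian_density_ge0. Qed.

Let mdens : measurable_fun setT dens.
Proof. by apply/measurable_EFinP; exact: measurable_gaussian_density. Qed.

Import HBNNSimple.

(** One half of the change-of-density formula, enough to prove integrals finite. It is checked on
    simple functions below [f], the Gaussian measure of a level set being an integral by
    definition. *)
Lemma integral_gaussianC_le (f : Cd -> R) : measurable_fun setT f ->
  (forall z, 0 <= f z) ->
  (\int[@gaussianC R d]_z (f z)%:E <=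
   \int[lebesgueC R d]_z (f z * gaussian_density z)%:E)%E.
Proof.
move=> mf f0; rewrite ge0_integralTE//=.
apply: ge_ereal_sup => _ [h /= hf <-].
have mh : measurable_fun setT h by exact: measurable_funP.
have mA y : measurable (h @^-1` [set y]).
  by rewrite -[X in measurable X]setTI; exact: mh.
have mi y : measurable_fun setT (fun z => (y * \1_(h @^-1` [set y]) z)%:E).
  by apply/measurable_EFinP; apply: measurable_funM => //; exact: measurable_indic.
have i0 y z : (0 <= (y * \1_(h @^-1` [set y]) z)%:E)%E by exact: nnfun_muleindic_ge0.
rewrite sintegralE.
have -> : (\sum_(y \in range h) y%:E * @gaussianC R d (h @^-1` [set y]) =
    \sum_(y \in range h) \int[lebesgueC R d]_z
      ((y * \1_(h @^-1` [set y]) z)%:E * dens z))%E.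
  apply: eq_fsbigr => y /set_mem[z _ hy].
  have y0 : 0 <= y by rewrite -hy.
  under eq_integral do rewrite EFinM -muleA.
  rewrite ge0_integralZl//; last 2 first.
  - apply: emeasurable_funM => //; apply/measurable_EFinP; exact: measurable_indic.
  - by move=> x _; rewrite mule_ge0// lee_fin.
  congr (_ * _)%E; rewrite [LHS]integral_mkcond; apply: eq_integral => x _.
  by rewrite epatch_indic muleC.
rewrite -ge0_integral_fsum//; last 2 first.
- by move=> y; exact: emeasurable_funM.
- by move=> y z _; rewrite mule_ge0.
apply: ge0_le_integral => //.
- by move=> z _; apply: fsume_ge0 => y _; rewrite mule_ge0.
- by apply: emeasurable_fsum => // y; exact: emeasurable_funM.
- apply/measurable_EFinP; apply: measurable_funM => //.
  exact: measurable_gaussian_density.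
move=> z _; rewrite -ge0_mule_fsuml => [|y]; last exact: i0.
rewrite fsumEFin// -fimfunE EFinM lee_wpmul2r//.
by have := hf z; rewrite lee_fin.
Qed.

End density.

Section lebesgue_fubini.
Variable R : realType.
Local Notation leb := (@lebesgue_measure R).

(** A name for planar Lebesgue measure, to which the sigma-finite structure required by Fubini's
    theorem can be attached. *)
Definition lebesgue2 : set (measurableTypeR R * measurableTypeR R) -> \bar R :=
  (leb \x leb)%E.

HB.instance Definition _ := Measure.on lebesgue2.

Let lebesgue2_sigma_finite : sigma_finite setT lebesgue2.
Proof. by apply: sigma_finite_product; exact: sigma_finiteT. Qed.

HB.instance Definition _ := Measure_isSigmaFinite.Build _ _ _
  lebesgue2 lebesgue2_sigma_finite.

Local Open Scope ereal_scope.

Lemma lebesgueC_fubini n (f : 'rV[R[i]]_n.+1 -> \bar R) : measurable_fun setT f ->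
  (forall z, 0 <= f z) ->
  \int[lebesgueC R n.+1]_z f z =
  \int[lebesgue2]_p \int[lebesgueC R n]_v f (consC (p, v)).
Proof.
move=> mf f0.
transitivity (\int[lebesgue2 \x lebesgueC R n]_q f (consC q)).
  exact: (ge0_integral_pushforward (measurable_consC (n := n))).
apply: (@fubini_tonelli1 _ _ _ _ _ lebesgue2 (lebesgueC R n) (f \o @consC R n)).
  by apply: measurableT_comp => //; exact: measurable_consC.
by move=> q; exact: f0.
Qed.

Lemma lebesgue2_fubini (f : measurableTypeR R * measurableTypeR R -> \bar R) :
  measurable_fun setT f -> (forall z, 0 <= f z) ->
  \int[lebesgue2]_p f p = \int[leb]_x \int[leb]_y f (x, y).
Proof. by move=> mf f0; exact: fubini_tonelli1. Qed.

Lemma lebesgue2_fubini_swap (f : measurableTypeR R * measurableTypeR R -> \bar R) :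
  measurable_fun setT f -> (forall z, 0 <= f z) ->
  \int[lebesgue2]_p f p = \int[leb]_y \int[leb]_x f (x, y).
Proof. by move=> mf f0; exact: fubini_tonelli2. Qed.

Lemma measurable_lebesgueC_section n (f : 'rV[R[i]]_n.+1 -> \bar R) :
  measurable_fun setT f -> (forall z, 0 <= f z) ->
  measurable_fun setT (fun p => \int[lebesgueC R n]_v f (consC (p, v))).
Proof.
move=> mf f0.
apply: (@measurable_fun_fubini_tonelli_F _ _ _ _ _ (lebesgueC R n) (f \o @consC R n)).
  by apply: measurableT_comp => //; exact: measurable_consC.
by move=> q; exact: f0.
Qed.

(** A point lies in the slice where its first real coordinate is fixed, and that slice is null for
    the product measure. *)
Lemma lebesgueC_set1 n (p : 'rV[R[i]]_n.+1) : lebesgueC R n.+1 [set p] = 0.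
Proof.
have sub : consC (n:=n) @^-1` [set p] `<=`
    ([set complex.Re (p ord0 ord0)] `*` setT) `*` setT.
  move=> [[x y] v] /= <-; rewrite consC_head /=; split => //; split.
apply/eqP; rewrite eq_le measure_ge0 andbT.
have -> : lebesgueC R n.+1 [set p] =
  (lebesgue2 \x lebesgueC R n) (consC (n:=n) @^-1` [set p]) by [].
apply: (@le_trans _ _ ((lebesgue2 \x lebesgueC R n)
    (([set complex.Re (p ord0 ord0)] `*` setT) `*` setT))).
  apply: le_measure => //; rewrite inE.
    rewrite -[X in measurable X]setTI; apply: measurable_consC => //.
    exact: measurable_set1C.
  by apply: measurableX => //; apply: measurableX.
have E0 : lebesgue2 ([set complex.Re (p ord0 ord0)] `*` setT) = 0.
  apply: (etrans (@product_measure1E _ _ _ _ R leb leb _ _ (measurable_set1 _) measurableT)).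
  by rewrite [X in X * _](lebesgue_measure_set1 (complex.Re (p ord0 ord0))) mul0e.
have mX : measurable ([set complex.Re (p ord0 ord0)] `*` [set: measurableTypeR R]).
  exact: measurableX.
rewrite (@product_measure1E _ _ _ _ R lebesgue2 (lebesgueC R n) _ _ mX measurableT).
by rewrite [X in X * _]E0 mul0e.
Qed.

End lebesgue_fubini.

Section gaussian_integrability.
Variable R : realType.
Local Notation leb := (@lebesgue_measure R).

(** Completing the square turns the integrand into a multiple of the normal density with mean [c]
    and variance 1. *)
Lemma exp_quadratic_lty (c : R) :
  (\int[leb]_x (expR (c * x - x ^+ 2 / 2))%:E < +oo)%E.
Proof.
have p1 : 0 < normal_peak (1 : R) by apply: normal_peak_gt0; rewrite oner_neq0.
pose k := expR (c ^+ 2 / 2) / normal_peak 1.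
have E (x : R) : expR (c * x - x ^+ 2 / 2) = k * normal_pdf c 1 x.
  rewrite normal_pdfE ?oner_neq0//= /normal_fun /k -mulrA (mulKf (lt0r_neq0 p1)).
  by rewrite -expRD; congr expR; rewrite expr1n; field.
under eq_integral do rewrite E EFinM.
rewrite ge0_integralZl//.
- by rewrite integral_normal_pdf mule1 ltry.
- by apply/measurable_EFinP; exact: measurable_normal_pdf.
- by move=> x _; rewrite lee_fin normal_pdf_ge0.
by rewrite lee_fin mulr_ge0 ?expR_ge0// invr_ge0 ltW.
Qed.

Let mexp (c : R) : measurable_fun setT (fun x : measurableTypeR R => (expR (c * x - x ^+ 2 / 2))%:E).
Proof.
apply/measurable_EFinP; apply: measurableT_comp => //.
apply: measurable_funB; first exact: measurable_funM.
by apply: measurable_funM => //; apply: measurable_funX.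
Qed.

Lemma exp_quadratic2_lty (c c' : R) :
  (\int[@lebesgue2 R]_p (expR ((c * p.1 - p.1 ^+ 2 / 2) + (c' * p.2 - p.2 ^+ 2 / 2)))%:E < +oo)%E.
Proof.
rewrite lebesgue2_fubini; last 2 first.
- apply/measurable_EFinP; apply: measurableT_comp => //.
  apply: measurable_funD; apply: measurable_funB;
    do ?[apply: measurable_funM => //; try apply: measurable_funX => //].
- by move=> z; rewrite lee_fin expR_ge0.
have E0 (k x : R) : (0 <= (expR (k * x - x ^+ 2 / 2))%:E)%E by rewrite lee_fin expR_ge0.
have inner (x : R) : (\int[leb]_y
    (expR ((c * x - x ^+ 2 / 2) + (c' * y - y ^+ 2 / 2)))%:E =
    (expR (c * x - x ^+ 2 / 2))%:E * \int[leb]_y (expR (c' * y - y ^+ 2 / 2))%:E)%E.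
  under eq_integral do rewrite expRD EFinM.
  by rewrite ge0_integralZl.
under eq_integral do rewrite inner.
have I0 k : (0 <= \int[leb]_y (expR (k * y - y ^+ 2 / 2))%:E)%E.
  by apply: integral_ge0.
have := exp_quadratic_lty c'; have := I0 c'.
case: (\int[leb]_y (expR (c' * y - y ^+ 2 / 2))%:E)%E => // r r0 _.
rewrite ge0_integralZr//.
by rewrite muleC; apply: lte_mul_pinfty => //; exact: exp_quadratic_lty.
Qed.

End gaussian_integrability.

Section bargmann_membership.
Variable R : realType.
Local Notation C := R[i].

Lemma rowC_consC n (P : 'rV[C]_n.+1 -> Type) :
  (forall p v, P (consC (p, v))) -> forall z, P z.
Proof.
move=> H z; have := H (complex.Re (z ord0 ord0), complex.Im (z ord0 ord0))
  (rsubmx (z : 'rV_(1 + n))).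
congr P; apply/rowP => j.
have [->|[k ->]] : j = ord0 \/ exists k, j = lift ord0 k.
  by case: (unliftP ord0 j) => [k ->|->]; [right; exists k|left].
  by rewrite consC_head; case: (z _ _).
rewrite consC_tail mxE; congr (z _ _).
exact: rshift1.
Qed.

Lemma lform_consC n (p q : measurableTypeR R * measurableTypeR R) (v w : 'rV[C]_n) :
  lform (consC (p, v)) (consC (q, w)) = (p.1 +i* p.2) * (q.1 +i* q.2) + lform v w.
Proof.
rewrite /lform big_ord_recl !consC_head; congr (_ + _).
by apply: eq_bigr => j _; rewrite !consC_tail.
Qed.

Lemma sqnorm_consC n (p : measurableTypeR R * measurableTypeR R) (v : 'rV[C]_n) :
  sqnorm (consC (p, v)) = p.1 ^+ 2 + p.2 ^+ 2 + sqnorm v.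
Proof.
rewrite /sqnorm big_ord_recl !consC_head; congr (_ + _).
  by rewrite /= sqr_sqrtr// addr_ge0 ?sqr_ge0.
by apply: eq_bigr => j _; rewrite !consC_tail.
Qed.

(** The squared modulus of exp(a.z), whence the 2, times the Gaussian weight without its constant (2
    pi)^-d. *)
Definition gexp n (a z : 'rV[C]_n) : R :=
  expR (2 * complex.Re (lform a z) - sqnorm z / 2).

Lemma continuous_sqnorm n : continuous (@sqnorm R n).
Proof.
have H : continuous (fun z : 'rV[C]_n => \sum_(j < n) absC (z ord0 j) ^+ 2).
  apply: continuous_big; first exact: add_continuous.
  move=> j _ z.
  apply: (@continuous_comp _ _ _ (fun w : 'rV[C]_n => absC (w ord0 j)) (fun x : R => x ^+ 2)).
    apply: (@continuous_comp _ _ _ (fun w : 'rV[C]_n => w ord0 j)); first exact: coord_continuous.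
    exact: continuous_absC.
  exact: exprn_continuous.
by [].
Qed.

Lemma continuous_lform n (a : 'rV[C]_n) : continuous (lform a).
Proof. by move=> z; apply: differentiable_continuous; exact: differentiable_lform. Qed.

Lemma continuous_gexp n (a : 'rV[C]_n) : continuous (gexp a).
Proof.
have H : continuous (fun z => 2 * complex.Re (lform a z) - sqnorm z / 2).
  move=> z.
  have h1 := @continuous_ReC _ _ _ (@continuous_lform n a) z.
  have h2 := @continuous_sqnorm n z.
  exact: (cvgB (cvgM (cvg_cst _) h1) (cvgM h2 (cvg_cst _))).
move=> z; apply: (@continuous_comp _ _ _ (fun z => 2 * complex.Re (lform a z) - sqnorm z / 2)).
  exact: H.
exact: continuous_expR.
Qed.

Lemma integral_gexp_lty n (a : 'rV[C]_n) :
  (\int[lebesgueC R n]_z (gexp a z)%:E < +oo)%E.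
Proof.
elim: n a => [|n IH] a.
  rewrite /lebesgueC integral_dirac//=; first by rewrite diracE mem_set// mul1e ltry.
  apply/measurable_EFinP; apply: continuous_borel_measurable; exact: continuous_gexp.
have g0 m (b z : 'rV[C]_m) : (0 <= (gexp b z)%:E)%E by rewrite lee_fin expR_ge0.
have mg m (b : 'rV[C]_m) : measurable_fun setT (fun z => (gexp b z)%:E).
  apply/measurable_EFinP; apply: continuous_borel_measurable; exact: continuous_gexp.
elim/rowC_consC: a => q a.
rewrite lebesgueC_fubini//.
(* The coefficients of the two real coordinates in twice the real part of the product of the complex
   numbers [q] and [p]. *)
pose c := 2 * q.1; pose c' := - 2 * q.2.
pose h (p : measurableTypeR R * measurableTypeR R) :=
  expR ((c * p.1 - p.1 ^+ 2 / 2) + (c' * p.2 - p.2 ^+ 2 / 2)).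
have inner p : (\int[lebesgueC R n]_v (gexp (consC (q, a)) (consC (p, v)))%:E =
    (h p)%:E * \int[lebesgueC R n]_v (gexp a v)%:E)%E.
  rewrite -ge0_integralZl// ?lee_fin ?expR_ge0//.
  apply: eq_integral => v _; rewrite -EFinM -expRD /gexp lform_consC sqnorm_consC cReD cReM /=.
  by congr (expR _)%:E; rewrite /c /c'; ring.
under eq_integral do rewrite inner.
have := IH a; have : (0 <= \int[lebesgueC R n]_v (gexp a v)%:E)%E by apply: integral_ge0.
case: (\int[lebesgueC R n]_v (gexp a v)%:E)%E => // r r0 _.
have mh : measurable_fun setT (fun p => (h p)%:E).
  apply/measurable_EFinP; apply: measurableT_comp => //.
  apply: measurable_funD; apply: measurable_funB;
    do ?[apply: measurable_funM => //; try apply: measurable_funX => //].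
rewrite ge0_integralZr// => [|p _]; last by rewrite lee_fin expR_ge0.
by rewrite muleC; apply: lte_mul_pinfty => //; exact: exp_quadratic2_lty.
Qed.

End bargmann_membership.

Section square_integrable.
Context dd (T : measurableType dd) (R : realType).
Variables (m : {measure set T -> \bar R}) (D : set T).
Hypothesis mD : measurable D.

Lemma absC_sqrD (z w : R[i]) :
  absC (z + w) ^+ 2 <= 2 * absC z ^+ 2 + 2 * absC w ^+ 2.
Proof.
have h := absCD z w; have h0 := absC_ge0 (z + w).
have : absC (z + w) ^+ 2 <= (absC z + absC w) ^+ 2.
  by rewrite ler_sqr ?nnegrE// addr_ge0 ?absC_ge0.
have := sqr_ge0 (absC z - absC w); nra.
Qed.

Lemma square_integrable_add (f g : T -> R[i]) :
  measurable_fun D (fun x => absC (f x)) -> measurable_fun D (fun x => absC (g x)) ->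
  measurable_fun D (fun x => absC (f x + g x)) ->
  (\int[m]_(x in D) (absC (f x) ^+ 2)%:E < +oo)%E ->
  (\int[m]_(x in D) (absC (g x) ^+ 2)%:E < +oo)%E ->
  (\int[m]_(x in D) (absC (f x + g x) ^+ 2)%:E < +oo)%E.
Proof.
move=> mf mg mfg If Ig.
have E0 (h : T -> R[i]) x : (0 <= (absC (h x) ^+ 2)%:E)%E by rewrite lee_fin sqr_ge0.
have msq (h : T -> R[i]) : measurable_fun D (fun x => absC (h x)) ->
    measurable_fun D (fun x => (absC (h x) ^+ 2)%:E).
  by move=> mh; apply/measurable_EFinP; exact: measurable_funX.
apply: (@le_lt_trans _ _ (\int[m]_(x in D) (2%:E * (absC (f x) ^+ 2)%:E +
    2%:E * (absC (g x) ^+ 2)%:E))%E).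
  apply: ge0_le_integral => //.
  - by move=> x _; exact: (E0 (fun x => f x + g x)).
  - exact: (msq (fun x => f x + g x)).
  - by apply: emeasurable_funD; apply: emeasurable_funM => //; exact: msq.
  - by move=> x _; rewrite -!EFinM -EFinD lee_fin absC_sqrD.
rewrite ge0_integralD//; last 4 first.
- by move=> x _; rewrite mule_ge0.
- by apply: emeasurable_funM => //; exact: msq.
- by move=> x _; rewrite mule_ge0.
- by apply: emeasurable_funM => //; exact: msq.
rewrite !ge0_integralZl//; try exact: msq.
by rewrite lte_add_pinfty// lte_mul_pinfty.
Qed.

End square_integrable.

Section bargmann_space.
Variables (R : realType) (d : nat).
Local Notation C := R[i].
Local Notation Cd := 'rV[R[i]]_d.

Lemma continuous_measurable_absC (f : Cd -> C) : continuous f ->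
  measurable_fun setT (fun z => absC (f z)).
Proof. by move=> cf; apply: continuous_borel_measurable; exact: continuous_absCf. Qed.

Lemma exp_alg_bargmann (f : Cd -> C) : exp_alg f -> bargmann_space f.
Proof.
move=> Ef; split; first by move=> z; exact: exp_alg_differentiable.
elim: Ef => [c a|f1 f2 E1 I1 E2 I2]; last first.
  have m1 := continuous_measurable_absC (exp_alg_continuous E1).
  have m2 := continuous_measurable_absC (exp_alg_continuous E2).
  have m12 := continuous_measurable_absC (exp_alg_continuous (exp_add E1 E2)).
  exact: (square_integrable_add measurableT m1 m2 m12 I1 I2).
apply: le_lt_trans (integral_gaussianC_le _ _) _.
- apply: measurable_funX; apply: continuous_measurable_absC.
  exact: (exp_alg_continuous (exp_pure c a)).
- by move=> z; rewrite sqr_ge0.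
have E z : absC (c * expC (lform a z)) ^+ 2 * gaussian_density z =
    (absC c ^+ 2 * (2 * pi) ^- d) * gexp a z.
  have -> : gexp a z = expR (complex.Re (lform a z)) ^+ 2 * expR (- sqnorm z / 2).
    by rewrite -expRM_natl -expRD mulNr.
  by rewrite absCM absC_expC exprMn /gaussian_density; ring.
under eq_integral do rewrite E EFinM.
rewrite ge0_integralZl//; last 3 first.
- apply/measurable_EFinP; apply: continuous_borel_measurable; exact: continuous_gexp.
- by move=> z _; rewrite lee_fin expR_ge0.
- by rewrite lee_fin mulr_ge0 ?sqr_ge0// invr_ge0 exprn_ge0// mulr_ge0// pi_ge0.
rewrite lte_mul_pinfty ?integral_gexp_lty// lee_fin.
by rewrite mulr_ge0 ?sqr_ge0// invr_ge0 exprn_ge0// mulr_ge0// pi_ge0.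
Qed.

End bargmann_space.

(** * From finite rank to vanishing determinants *)

Section rank_determinant.
Variables (R : realType) (T : ptopologicalType).
Local Notation C := R[i].
Variables (L : (T -> C) -> C) (E H : set (T -> C)) (N : nat).
Variable Top : (T -> C) -> (T -> C).
Hypothesis E_lin : forall a f g, E f -> E g -> E (fun x => a * f x + g x).
Hypothesis E0 : E (fun=> 0).
Hypothesis T_lin : forall a f g, E f -> E g ->
  Top (fun x => a * f x + g x) = a *: Top f + Top g.
Hypothesis L_lin : forall a f g h, E f -> E g -> E h ->
  L (fun x => (a * f x + g x) * conjc (h x)) =
  a * L (fun x => f x * conjc (h x)) + L (fun x => g x * conjc (h x)).
Hypothesis T0_L0 : forall u g, E u -> E g -> Top u = 0 -> L (fun x => u x * conjc (g x)) = 0.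
Variable res : (T -> C) -> (T -> C).
Hypothesis E_H : forall f, E f -> H (res f) /\ Top (res f) = Top f.
Hypothesis rankN : has_rank H Top N.

(** The coordinates of the [Top (f i)] in a basis of the range form a matrix with N + 1 rows and N
    columns. A nonzero row vector in its left kernel gives a combination of the [f i] killed by
    [Top], and by [T0_L0] the same vector kills the matrix of the statement. The map [res] carries
    an exponential function to its representative in the Hilbert space. *)
Lemma rank_det0 (f g : 'I_N.+1 -> T -> C) :
  (forall i, E (f i)) -> (forall i, E (g i)) ->
  \det (\matrix_(i, j) L (fun x => f i x * conjc (g j x))) = 0.
Proof.
move=> Ef Eg; have [e [_ Eim]] := rankN.
have /choice[A HA] : forall i, exists a : 'I_N -> C, Top (f i) = \sum_(k < N) a k *: e k.
  move=> i; have [Hf Tf] := E_H (Ef i).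
  have : (Top @` H) (Top (f i)) by exists (res (f i)).
  by rewrite Eim => -[a _ <-]; exists a.
pose M : 'M[C]_(N.+1, N) := \matrix_(i, k) A i k.
have [c c0 cM] : exists2 c : 'rV[C]_N.+1, c != 0 & c *m M = 0.
  have : (\rank (kermx M) != 0)%N.
    by rewrite mxrank_ker -lt0n subn_gt0 ltnS rank_leq_col.
  rewrite mxrank_eq0 => /rowV0Pn[c /sub_kermxP cM c0].
  by exists c.
have lin_sum (s : seq 'I_N.+1) :
   E (fun x => \sum_(i <- s) c ord0 i * f i x) /\
   (Top (fun x => \sum_(i <- s) c ord0 i * f i x) = \sum_(i <- s) c ord0 i *: Top (f i) /\
    forall j, L (fun x => (\sum_(i <- s) c ord0 i * f i x) * conjc (g j x)) =
      \sum_(i <- s) c ord0 i * L (fun x => f i x * conjc (g j x))).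
  elim: s => [|i s [IH1 [IH2 IH3]]].
    have -> : (fun x => \sum_(i <- [::]) c ord0 i * f i x) = (fun=> 0).
      by apply/funext => x; rewrite big_nil.
    have z0 : (fun x : T => -1 * 0 + 0 : C) = (fun=> 0).
      by apply/funext => x; rewrite mulr0 addr0.
    split => //; split.
      have := T_lin (-1) E0 E0; rewrite z0 big_nil => ->.
      by rewrite scaleN1r addNr.
    move=> j; have := L_lin (-1) E0 E0 (Eg j).
    have -> : (fun x => (-1 * 0 + 0) * conjc (g j x)) = (fun x => 0 * conjc (g j x)).
      by apply/funext => x; rewrite mulr0 addr0.
    have -> : (fun x => (\sum_(i <- [::]) c ord0 i * f i x) * conjc (g j x)) =
        (fun x => 0 * conjc (g j x)).
      by apply/funext => x; rewrite big_nil.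
    by move=> ->; rewrite big_nil mulN1r addNr.
  have -> : (fun x => \sum_(i <- i :: s) c ord0 i * f i x) =
      (fun x => c ord0 i * f i x + \sum_(i <- s) c ord0 i * f i x).
    by apply/funext => x; rewrite big_cons.
  split; first exact: (E_lin _ (Ef i) IH1).
  split; first by rewrite (T_lin _ (Ef i) IH1) IH2 big_cons.
  move=> j; rewrite big_cons -IH3 -(L_lin _ (Ef i) IH1 (Eg j)).
  by congr L; apply/funext => x; rewrite big_cons.
have [Eu [Tu Lu]] := lin_sum (index_enum 'I_N.+1).
have Tu0 : Top (fun x => \sum_(i <- index_enum 'I_N.+1) c ord0 i * f i x) = 0.
  rewrite Tu; under eq_bigr do rewrite HA scaler_sumr.
  rewrite exchange_big big1// => k _.
  under eq_bigr do rewrite scalerA.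
  rewrite -scaler_suml; have /rowP/(_ k) := cM; rewrite !mxE => cMk.
  rewrite [X in X *: _](_ : _ = 0) ?scale0r//.
  by rewrite -[RHS]cMk; apply: eq_bigr => i _; rewrite mxE.
apply/eqP/det0P; exists c => //; apply/rowP => j; rewrite !mxE.
rewrite -[RHS](T0_L0 Eu (Eg j) Tu0) Lu; apply: eq_bigr => i _.
by rewrite mxE.
Qed.

End rank_determinant.

Lemma lebesgueC_point (R : realType) (n : nat) (p : 'rV[R[i]]_n) :
  (0 < n)%N -> lebesgueC R n [set p] = 0%E.
Proof. by case: n p => // n p _; exact: lebesgueC_set1. Qed.

Section determinant_criterion.
Variables (R : realType) (d N : nat).
Local Notation C := R[i].
Local Notation Cd := 'rV[R[i]]_d.
Variables (mu : {charge set Cd -> \bar R[i]}) (K : set Cd).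
Hypothesis cK : compact K.
Hypothesis null_K : charge_null mu (~` K).
Local Notation L := (cmeasure_integral mu K).

Let mK : measurable K. Proof. exact: compact_measurableC. Qed.

Lemma exp_alg_bmfC f : exp_alg f -> bmfC K f.
Proof. by move=> Ef; apply: continuous_bmfC => //; exact: exp_alg_continuous. Qed.

Lemma det0_points :
  (forall f g : 'I_N.+1 -> Cd -> C, (forall i, exp_alg (f i)) ->
    (forall i, exp_alg (g i)) ->
    \det (\matrix_(i, j) L (fun x => f i x * conjc (g j x))) = 0) ->
  exists s : seq Cd, [/\ uniq s, (size s <= N)%N, (forall p, p \in s -> K p) &
    charge_null mu (~` [set` s])].
Proof.
move=> det0; apply: finitely_many_points => // p pinj.
have [M0 M00 HM0] := cmeasure_integral_bound mu mK.
have H := locally_nonzero_finite (L := L) (E := @exp_alg R d) (n := N.+1) (M0 := M0) cK _ M00 _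
  (@exp_alg_cst R d) (@exp_add R d) (@exp_alg_mul R d) (@exp_alg_continuous R d)
  (@exp_alg_separates R d) det0 pinj.
apply: H.
- move=> a f g cf cg; apply: cmeasure_integral_lin; first exact: mK.
    exact: (continuous_bmfC cK cf).
  exact: (continuous_bmfC cK cg).
- by move=> f M cf M_ge0 hM; apply: HM0; [exact: (continuous_bmfC cK cf)|exact: hM].
Qed.

(** Absolute continuity removes the mass of each atom, points being Lebesgue null. In dimension 0
    the measure [lebesgueC] is a Dirac mass, hence the condition on [d]. *)
Lemma abs_continuous_points (s : seq Cd) : (0 < d)%N -> uniq s ->
  charge_null mu (~` [set` s]) -> abs_continuous_lebesgue mu ->
  forall A, measurable A -> mu A = 0%E.
Proof.
move=> d0 us ns ac A mA.
have ms := measurable_seqC s.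
have n0 : mu (A `\` [set` s]) = 0%E.
  by apply: ns; [exact: measurableD|move=> x []].
rewrite (chargeDI mu mA ms) n0 add0e mu_setI_seq// big1// => p _.
rewrite ac ?mul0r//; first exact: measurable_set1C.
exact: lebesgueC_point.
Qed.

End determinant_criterion.

Section toeplitz_determinant.
Variables (R : realType) (d N : nat).
Local Notation C := R[i].
Local Notation Cd := 'rV[R[i]]_d.
Variables (mu : {charge set Cd -> \bar R[i]}) (K : set Cd).
Hypothesis cK : compact K.
Local Notation L := (cmeasure_integral mu K).
Variables (H : set (Cd -> C)) (Top : (Cd -> C) -> (Cd -> C)) (b : Cd -> Cd -> C).
Variable res : (Cd -> C) -> (Cd -> C).
Hypothesis b_bmfC : forall z, bmfC K (b z).
Hypothesis TopE : forall u z, exp_alg u -> Top u z = L (fun w => b z w * u w).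
Hypothesis Top0 : forall u g, exp_alg u -> exp_alg g -> Top u = 0 ->
  L (fun x => u x * conjc (g x)) = 0.
Hypothesis resH : forall f, exp_alg f -> H (res f) /\ Top (res f) = Top f.

(** The argument shared by both cases: [b] is a version of the kernel that is bounded on [K] and
    represents the operator by integrals over [K]. The cases differ mainly in the proof of
    [Top0]. *)
Lemma toeplitz_rank_det0 : has_rank H Top N ->
  forall f g : 'I_N.+1 -> Cd -> C, (forall i, exp_alg (f i)) ->
    (forall i, exp_alg (g i)) ->
    \det (\matrix_(i, j) L (fun x => f i x * conjc (g j x))) = 0.
Proof.
move=> rk f g Ef Eg.
have mK := compact_measurableC cK.
have Elin (a : C) (u v : Cd -> C) : exp_alg u -> exp_alg v -> exp_alg (fun x => a * u x + v x).
  move=> Eu Ev; apply: exp_add => //; apply: exp_alg_mul => //; exact: exp_alg_cst.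
apply: (@rank_det0 R Cd L (@exp_alg R d) H N Top _ _ _ _ Top0 res) => //.
- exact: exp_alg_cst.
- move=> a u v Eu Ev; apply/funext => z.
  rewrite [RHS]/GRing.add /= /GRing.scale /= !TopE//; last exact: Elin.
  rewrite -cmeasure_integral_lin//; last 2 first.
  + exact: (bmfC_mul (b_bmfC z) (exp_alg_bmfC cK Eu)).
  + exact: (bmfC_mul (b_bmfC z) (exp_alg_bmfC cK Ev)).
  by congr L; apply/funext => w; ring.
- move=> a u v h Eu Ev Eh; rewrite -cmeasure_integral_lin//; last 2 first.
  + exact: (bmfC_mul (exp_alg_bmfC cK Eu) (bmfC_conj (exp_alg_bmfC cK Eh))).
  + exact: (bmfC_mul (exp_alg_bmfC cK Ev) (bmfC_conj (exp_alg_bmfC cK Eh))).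
  by congr L; apply/funext => w; ring.
Qed.

End toeplitz_determinant.

(** * The determinant identity for Bargmann operators *)

Section bargmann_case.
Variables (R : realType) (d N : nat).
Local Notation C := R[i].
Local Notation Cd := 'rV[R[i]]_d.
Variables (mu : {charge set Cd -> \bar R[i]}) (K : set Cd).
Hypothesis cK : compact K.
Hypothesis null_K : charge_null mu (~` K).
Local Notation L := (cmeasure_integral mu K).
Local Notation Top := (toeplitz (@bargmann_kernel R d) [set: Cd] mu).

Let mK : measurable K. Proof. exact: compact_measurableC. Qed.

Lemma exp_alg_expC (a : Cd) : exp_alg (fun z => expC (lform a z)).
Proof.
by have := exp_pure 1 a; congr exp_alg; apply/funext => z; rewrite mul1r.
Qed.

Lemma bargmann_kernelE (z w : Cd) : bargmann_kernel z w =
  conjc (expC (lform (\row_j (conjc (z ord0 j) / 2)) w)).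
Proof.
rewrite conjc_expC /bargmann_kernel; congr expC.
rewrite /hdot /lform mulr_suml rmorph_sum; apply: eq_bigr => j _.
rewrite mxE /= !conjcM conjcK -/(conjc (w ord0 j)).
have -> : conjc (2^-1) = 2^-1 :> C.
  by rewrite conjc_inv; congr (_^-1); exact: conjc_nat.
by rewrite mulrAC.
Qed.

Lemma bargmann_toeplitzE u z : exp_alg u ->
  Top u z = L (fun w => bargmann_kernel z w * u w).
Proof.
move=> Eu; rewrite /toeplitz.
have c : continuous (fun w => bargmann_kernel z w * u w).
  under eq_fun do rewrite bargmann_kernelE.
  apply: (continuousC_mul _ (exp_alg_continuous Eu)); apply: continuousC_conj.
  exact: exp_alg_continuous (exp_alg_expC _).
apply: cmeasure_integral_negligible => //.
- by apply: continuous_borel_measurable; exact: continuous_ReC.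
- by apply: continuous_borel_measurable; exact: continuous_ImC.
by apply: charge_null_sub null_K => x [].
Qed.

Lemma bargmann_rank_det0 : has_rank (@bargmann_space R d) Top N ->
  forall f g : 'I_N.+1 -> Cd -> C, (forall i, exp_alg (f i)) ->
    (forall i, exp_alg (g i)) ->
    \det (\matrix_(i, j) L (fun x => f i x * conjc (g j x))) = 0.
Proof.
have bk z : bmfC K (bargmann_kernel z).
  have := bmfC_conj (exp_alg_bmfC cK (exp_alg_expC (\row_j (conjc (z ord0 j) / 2)))).
  by congr bmfC; apply/funext => w; rewrite bargmann_kernelE.
have TE u z := @bargmann_toeplitzE u z.
apply: (toeplitz_rank_det0 cK (res := id) bk TE).
- move=> u h Eu Eh Tu0; elim: Eh => [c a|h1 h2 E1 IH1 E2 IH2].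
    (* With z = 2 conj(a) the kernel P(z, w) is the conjugate of exp(a.w), so the vanishing of
       [Top u] at [z] is the claim for this exponential. *)
    pose z : Cd := \row_j (2 * conjc (a ord0 j)).
    have := @cmeasure_integral_lin _ _ _ mu K (conjc c)
      (fun w => bargmann_kernel z w * u w) (fun=> 0) mK
      (bmfC_mul (bk z) (exp_alg_bmfC cK Eu)) (bmfC_cst _ 0).
    rewrite -(TE _ z Eu) Tu0 cmeasure_integral0 addr0 mulr0 => <-.
    apply: cmeasure_integral_eq => w _; rewrite addr0 bargmann_kernelE.
    have -> : \row_j (conjc (z ord0 j) / 2) = a.
      apply/rowP => j; rewrite !mxE conjcM conjcK.
      have -> : conjc 2 = 2 :> C by exact: conjc_nat.
      by rewrite mulrC mulKf// pnatr_eq0.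
    by rewrite conjcM; ring.
  have := @cmeasure_integral_lin _ _ _ mu K 1
    (fun w => u w * conjc (h1 w)) (fun w => u w * conjc (h2 w)) mK
    (bmfC_mul (exp_alg_bmfC cK Eu) (bmfC_conj (exp_alg_bmfC cK E1)))
    (bmfC_mul (exp_alg_bmfC cK Eu) (bmfC_conj (exp_alg_bmfC cK E2))).
  rewrite IH1 IH2 mulr0 addr0 => <-; apply: cmeasure_integral_eq => w _.
  by rewrite conjcD; ring.
- by move=> u Eu; split => //; exact: exp_alg_bargmann.
Qed.

End bargmann_case.

(** * Goursat's theorem *)

Section segment_integral.
Variable R : realType.
Local Notation C := R[i].
Local Notation leb := (@lebesgue_measure R).
Implicit Types (a b x y : R) (g h : R -> C).

(** The limit is two-sided at the endpoints as well, since the integrands come from functions on the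
    plane. *)
Definition cont_on a b g := forall x, a <= x <= b -> g y @[y --> x] --> g x.

Definition cint a b g : C :=
  (\int[leb]_(x in `[a, b]) complex.Re (g x)) +i*
  (\int[leb]_(x in `[a, b]) complex.Im (g x)).

Lemma cont_on_integrable a b (f : R -> R) :
  (forall x, a <= x <= b -> f y @[y --> x] --> f x) ->
  leb.-integrable `[a, b] (EFin \o f).
Proof.
move=> cf; apply: continuous_compact_integrable; first exact: segment_compact.
by apply: continuous_in_subspaceT => x; rewrite inE /= in_itv; exact: cf.
Qed.

Lemma cont_on_Re a b g : cont_on a b g -> leb.-integrable `[a, b] (EFin \o (fun x => complex.Re (g x))).
Proof.
move=> cg; apply: cont_on_integrable => x xab.
by apply: (cvg_comp _ _ (cg x xab)); exact: continuous_Re.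
Qed.

Lemma cont_on_Im a b g : cont_on a b g -> leb.-integrable `[a, b] (EFin \o (fun x => complex.Im (g x))).
Proof.
move=> cg; apply: cont_on_integrable => x xab.
by apply: (cvg_comp _ _ (cg x xab)); exact: continuous_Im.
Qed.

Lemma cont_on_cst a b (c : C) : cont_on a b (fun=> c).
Proof. by move=> x _; exact: cvg_cst. Qed.

Lemma cont_on_lin a b (c : C) g h : cont_on a b g -> cont_on a b h ->
  cont_on a b (fun x => c * g x + h x).
Proof.
move=> cg ch x xab; apply: cvgD; last exact: ch.
exact: (cvgM (cvg_cst c) (cg x xab)).
Qed.

Lemma cint_split a m b g : a <= m -> m <= b -> cont_on a b g ->
  cint a b g = cint a m g + cint m b g.
Proof.
move=> am mb cg.
have S (f : R -> R) : leb.-integrable `[a, b] (EFin \o f) ->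
    \int[leb]_(x in `[a, b]) f x =
    \int[leb]_(x in `[a, m]) f x + \int[leb]_(x in `[m, b]) f x.
  move=> fi; have fi2 : leb.-integrable `]m, b] (EFin \o f).
    apply: integrableS fi => //; move=> x /=; rewrite !in_itv/= => /andP[mx ->].
    by rewrite andbT (le_trans am)// ltW.
  by rewrite -[X in _ + X]Rintegral_itv_obnd_cbnd// -(Rintegral_itvB fi) ?bnd_simp// addrC subrK.
by rewrite /cint !S//; [exact: cont_on_Im|exact: cont_on_Re].
Qed.

Lemma cint_lin a b (c : C) g h : cont_on a b g -> cont_on a b h ->
  cint a b (fun x => c * g x + h x) = c * cint a b g + cint a b h.
Proof.
move=> cg ch; rewrite /cint.
have rg := cont_on_Re cg; have ig := cont_on_Im cg.
have rh := cont_on_Re ch; have ih := cont_on_Im ch.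
have iZ (k : R) (f : R -> R) : leb.-integrable `[a, b] (EFin \o f) ->
  leb.-integrable `[a, b] (EFin \o (fun x => k * f x)).
  by move=> fi; exact: (integrableZl _ k fi).
have iD (f1 f2 : R -> R) : leb.-integrable `[a, b] (EFin \o f1) ->
    leb.-integrable `[a, b] (EFin \o f2) ->
    leb.-integrable `[a, b] (EFin \o (fun x => f1 x + f2 x)).
  by move=> fi1 fi2; exact: (integrableD _ fi1 fi2).
have -> : (fun x => complex.Re (c * g x + h x)) = (fun x =>
    complex.Re c * complex.Re (g x) + (- complex.Im c * complex.Im (g x) + complex.Re (h x))).
  by apply/funext => x; rewrite cReD cReM; ring.
have -> : (fun x => complex.Im (c * g x + h x)) = (fun x =>
    complex.Re c * complex.Im (g x) + (complex.Im c * complex.Re (g x) + complex.Im (h x))).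
  by apply/funext => x; rewrite cImD cImM; ring.
rewrite !RintegralD//; try (by apply: iZ); try (by apply: iD => //; apply: iZ).
rewrite !RintegralZl//.
by apply: Re_Im_inj; rewrite ?cReD ?cImD ?cReM ?cImM /=; ring.
Qed.

Lemma cint0 a b : cint a b (fun=> 0) = 0.
Proof. by rewrite /cint !Rintegral_cst// !mul0r. Qed.

Lemma lebesgue_segment a b : a <= b -> fine (leb `[a, b]) = b - a.
Proof.
rewrite lebesgue_measure_itv /= lte_fin le_eqVlt => /predU1P[->|->//].
by rewrite ltxx subrr.
Qed.

Lemma cint_cst a b (c : C) : a <= b -> cint a b (fun=> c) = (b - a)%:C * c.
Proof.
move=> ab; rewrite /cint !Rintegral_cst// lebesgue_segment//.
by apply: Re_Im_inj; rewrite ?cReM ?cImM /=; ring.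
Qed.

Lemma cint_sub a b g h : cont_on a b g -> cont_on a b h ->
  cint a b (fun x => g x - h x) = cint a b g - cint a b h.
Proof.
move=> cg ch; have := cint_lin (-1) ch cg.
rewrite mulN1r addrC => <-; congr cint; apply/funext => x.
by rewrite mulN1r addrC.
Qed.

(** The factor 2 is the price of estimating the real and imaginary parts separately. *)
Lemma cint_bound a b g (M : R) : a <= b -> cont_on a b g ->
  (forall x, a <= x <= b -> absC (g x) <= M) -> absC (cint a b g) <= 2 * M * (b - a).
Proof.
move=> ab cg gM; apply: le_trans (absC_le _) _ => /=.
have S (f : R -> R) : leb.-integrable `[a, b] (EFin \o f) ->
    (forall x, a <= x <= b -> `|f x| <= M) ->
    `|\int[leb]_(x in `[a, b]) f x| <= M * (b - a).
  move=> fi fM; apply: le_trans (le_normr_Rintegral _ fi) _ => //.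
  have -> : M * (b - a) = \int[leb]_(x in `[a, b]) M.
    by rewrite Rintegral_cst// lebesgue_segment.
  apply: le_Rintegral => //; first exact: integrable_norm.
  by apply: cont_on_integrable => x _; exact: cvg_cst.
have h1 := S _ (cont_on_Re cg) (fun x xab => le_trans (absC_Re (g x)) (gM x xab)).
have h2 := S _ (cont_on_Im cg) (fun x xab => le_trans (absC_Im (g x)) (gM x xab)).
have -> : 2 * M * (b - a) = M * (b - a) + M * (b - a) by ring.
exact: lerD h1 h2.
Qed.

Lemma absC_cint_le a b g : cont_on a b g ->
  ((absC (cint a b g))%:E <= 2%:E * \int[leb]_(x in `[a, b]) (absC (g x))%:E)%E.
Proof.
move=> cg.
have ig : leb.-integrable `[a, b] (EFin \o (fun x => absC (g x))).
  apply: cont_on_integrable => x xab.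
  by apply: (cvg_comp _ _ (cg x xab)); exact: continuous_absC.
have -> : (\int[leb]_(x in `[a, b]) (absC (g x))%:E =
    (\int[leb]_(x in `[a, b]) absC (g x))%R%:E)%E.
  by rewrite /Rintegral fineK//; exact: integrable_fin_num.
rewrite -EFinM lee_fin; apply: le_trans (absC_le _) _ => /=.
rewrite mulrDl !mul1r; apply: lerD.
  apply: le_trans (le_normr_Rintegral _ (cont_on_Re cg)) _ => //.
  apply: le_Rintegral => //; first exact: integrable_norm (cont_on_Re cg).
  by move=> x _; exact: absC_Re.
apply: le_trans (le_normr_Rintegral _ (cont_on_Im cg)) _ => //.
apply: le_Rintegral => //; first exact: integrable_norm (cont_on_Im cg).
by move=> x _; exact: absC_Im.
Qed.

Lemma cint_Re_ge a b g (m : R) : a <= b -> cont_on a b g ->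
  (forall x, a <= x <= b -> m <= complex.Re (g x)) ->
  m * (b - a) <= complex.Re (cint a b g).
Proof.
move=> ab cg gm; rewrite /=.
have -> : m * (b - a) = \int[leb]_(x in `[a, b]) m.
  by rewrite Rintegral_cst// lebesgue_segment.
apply: le_Rintegral => //.
- by apply: cont_on_integrable => x _; exact: cvg_cst.
- exact: cont_on_Re.
Qed.

End segment_integral.

(** * Contour integrals over rectangles *)

Section rectangle_integral.
Variable R : realType.
Local Notation C := R[i].
Implicit Types (a b c d x y : R) (f g : C -> C).

Definition rect a b c d : set C :=
  [set z | a <= complex.Re z <= b /\ c <= complex.Im z <= d].

Definition ccont (D : set C) f := forall z, D z -> f w @[w --> z] --> f z.

(** The contour integral along the boundary, counterclockwise: dz is dx on horizontal sides and i dy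
    on vertical ones. *)
Definition rint f a b c d : C :=
  cint a b (fun x => f (x +i* c)) + 'i * cint c d (fun y => f (b +i* y)) -
  cint a b (fun x => f (x +i* d)) - 'i * cint c d (fun y => f (a +i* y)).

Lemma cvg_hor x y : (x' +i* y) @[x' --> x] --> (x +i* y).
Proof.
apply/cvgC_absP => e e0.
have /cvgrPdist_lt/(_ e e0) : (id : R -> R) @ x --> x by exact: cvg_id.
apply: filterS => x' h; have -> : (x +i* y) - (x' +i* y) = (x - x')%:C.
  by apply: Re_Im_inj => /=; ring.
by rewrite absC_real.
Qed.

Lemma cvg_ver x y : (x +i* y') @[y' --> y] --> (x +i* y).
Proof.
apply/cvgC_absP => e e0.
have /cvgrPdist_lt/(_ e e0) : (id : R -> R) @ y --> y by exact: cvg_id.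
apply: filterS => y' h; have -> : (x +i* y) - (x +i* y') = 'i * (y - y')%:C.
  by apply: Re_Im_inj => /=; ring.
by rewrite absCM absC_real /= expr0n expr1n add0r sqrtr1 mul1r.
Qed.

Lemma ccont_hor a b c d f y : ccont (rect a b c d) f -> c <= y <= d ->
  cont_on a b (fun x => f (x +i* y)).
Proof.
move=> cf ycd x xab; apply: (cvg_comp (fun x => x +i* y) f (@cvg_hor x y)).
by apply: cf; split.
Qed.

Lemma ccont_ver a b c d f x : ccont (rect a b c d) f -> a <= x <= b ->
  cont_on c d (fun y => f (x +i* y)).
Proof.
move=> cf xab y ycd; apply: (cvg_comp (fun y => x +i* y) f (@cvg_ver x y)).
by apply: cf; split.
Qed.

Lemma rect_sub a b c d a' b' c' d' : a <= a' -> b' <= b -> c <= c' -> d' <= d ->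
  rect a' b' c' d' `<=` rect a b c d.
Proof.
move=> aa bb cc dd z [/andP[h1 h2] /andP[h3 h4]]; split.
  by rewrite (le_trans aa h1) (le_trans h2 bb).
by rewrite (le_trans cc h3) (le_trans h4 dd).
Qed.

Lemma rint_vsplit f a m b c d : a <= m -> m <= b -> c <= d ->
  ccont (rect a b c d) f -> rint f a b c d = rint f a m c d + rint f m b c d.
Proof.
move=> am mb cd cf; rewrite /rint.
rewrite (cint_split am mb (ccont_hor cf _)) ?lexx ?cd//.
rewrite (cint_split am mb (ccont_hor cf _)) ?lexx ?cd//.
ring.
Qed.

Lemma rint_hsplit f a b c m d : c <= m -> m <= d -> a <= b ->
  ccont (rect a b c d) f -> rint f a b c d = rint f a b c m + rint f a b m d.
Proof.
move=> cm md ab cf; rewrite /rint.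
rewrite (cint_split cm md (ccont_ver cf _)) ?lexx ?ab//.
rewrite (cint_split cm md (ccont_ver cf _)) ?lexx ?ab//.
ring.
Qed.

(** Continuity is demanded at boundary points only, so that the rule covers 1 / (z - w), which is
    singular inside. *)
Lemma rint_lin a b c d (k : C) f g : a <= b -> c <= d ->
  (forall z, rect a b c d z -> complex.Re z = a \/ complex.Re z = b \/
     complex.Im z = c \/ complex.Im z = d -> f w @[w --> z] --> f z) ->
  (forall z, rect a b c d z -> complex.Re z = a \/ complex.Re z = b \/
     complex.Im z = c \/ complex.Im z = d -> g w @[w --> z] --> g z) ->
  rint (fun z => k * f z + g z) a b c d = k * rint f a b c d + rint g a b c d.
Proof.
move=> ab cd cf cg.
have H (h : C -> C) y : (forall z, rect a b c d z -> complex.Re z = a \/ complex.Re z = b \/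
     complex.Im z = c \/ complex.Im z = d -> h w @[w --> z] --> h z) ->
     y = c \/ y = d -> cont_on a b (fun x => h (x +i* y)).
  move=> ch ycd x xab; apply: (cvg_comp (fun x => x +i* y) h (@cvg_hor x y)).
  apply: ch; last by right; right.
  by split => //=; case: ycd => ->; rewrite lexx cd.
have V (h : C -> C) x : (forall z, rect a b c d z -> complex.Re z = a \/ complex.Re z = b \/
     complex.Im z = c \/ complex.Im z = d -> h w @[w --> z] --> h z) ->
     x = a \/ x = b -> cont_on c d (fun y => h (x +i* y)).
  move=> ch xab y ycd; apply: (cvg_comp (fun y => x +i* y) h (@cvg_ver x y)).
  apply: ch; last by case: xab; [left|right; left].
  by split => //=; case: xab => ->; rewrite lexx ab.
rewrite /rint.
rewrite (cint_lin k (H f c cf (or_introl erefl)) (H g c cg (or_introl erefl))).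
rewrite (cint_lin k (H f d cf (or_intror erefl)) (H g d cg (or_intror erefl))).
rewrite (cint_lin k (V f a cf (or_introl erefl)) (V g a cg (or_introl erefl))).
rewrite (cint_lin k (V f b cf (or_intror erefl)) (V g b cg (or_intror erefl))).
ring.
Qed.

Lemma absC_i : absC ('i : C) = 1.
Proof. by rewrite /= expr0n expr1n add0r sqrtr1. Qed.

Lemma rint_bound f a b c d (M : R) : a <= b -> c <= d ->
  ccont (rect a b c d) f -> (forall z, rect a b c d z -> absC (f z) <= M) ->
  absC (rint f a b c d) <= 4 * M * ((b - a) + (d - c)).
Proof.
move=> ab cd cf fM.
have h1 y : c <= y <= d -> absC (cint a b (fun x => f (x +i* y))) <= 2 * M * (b - a).
  by move=> ycd; apply: cint_bound => //; [exact: (ccont_hor cf)|move=> x xab; apply: fM; split].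
have h2 x : a <= x <= b -> absC (cint c d (fun y => f (x +i* y))) <= 2 * M * (d - c).
  by move=> xab; apply: cint_bound => //; [exact: (ccont_ver cf)|move=> y ycd; apply: fM; split].
have c1 : c <= c <= d by rewrite lexx.
have d1 : c <= d <= d by rewrite lexx andbT.
have a1 : a <= a <= b by rewrite lexx.
have b1 : a <= b <= b by rewrite lexx andbT.
have := h1 c c1; have := h1 d d1; have := h2 a a1; have := h2 b b1.
rewrite /rint => k1 k2 k3 k4.
apply: le_trans (absCD _ _) _; rewrite absCN absCM absC_i mul1r.
apply: le_trans (lerD (absCD _ _) (lexx _)) _; rewrite absCN.
apply: le_trans (lerD (lerD (absCD _ _) (lexx _)) (lexx _)) _.
rewrite absCM absC_i mul1r.
apply: le_trans (lerD (lerD (lerD k4 k1) k3) k2) _.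
by rewrite le_eqVlt; apply/orP; left; apply/eqP; ring.
Qed.

Lemma affine_continuous (l k : C) : continuous (fun z : C => l * z + k).
Proof.
apply: (@continuousC_lin R C l (fun z => z) (fun=> k)).
  by move=> z; exact: cvg_id.
exact: continuousC_cst.
Qed.

Lemma rint_affine a b c d (k l : C) : a <= b -> c <= d ->
  rint (fun z => l * z + k) a b c d = 0.
Proof.
move=> ab cd; rewrite /rint.
have ccid : ccont (rect a b c d) (fun z => l * z + k).
  by move=> z _; exact: affine_continuous.
have c1 : c <= c <= d by rewrite lexx.
have d1 : c <= d <= d by rewrite lexx andbT.
have a1 : a <= a <= b by rewrite lexx.
have b1 : a <= b <= b by rewrite lexx andbT.
have e1 := cint_sub (ccont_hor ccid c1) (ccont_hor ccid d1).
have e2 := cint_sub (ccont_ver ccid b1) (ccont_ver ccid a1).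
transitivity ((cint a b (fun x => l * (x +i* c) + k) - cint a b (fun x => l * (x +i* d) + k)) +
  'i * (cint c d (fun y => l * (b +i* y) + k) - cint c d (fun y => l * (a +i* y) + k))).
  by ring.
rewrite -e1 -e2.
have -> : (fun x => l * (x +i* c) + k - (l * (x +i* d) + k)) = (fun=> l * 'i * (c - d)%:C).
  apply/funext => x; have -> : x +i* c = x%:C + 'i * c%:C by apply: Re_Im_inj => /=; ring.
  have -> : x +i* d = x%:C + 'i * d%:C by apply: Re_Im_inj => /=; ring.
  by rewrite raddfB /=; ring.
have -> : (fun y => l * (b +i* y) + k - (l * (a +i* y) + k)) = (fun=> l * (b - a)%:C).
  apply/funext => y; have -> : b +i* y = b%:C + 'i * y%:C by apply: Re_Im_inj => /=; ring.
  have -> : a +i* y = a%:C + 'i * y%:C by apply: Re_Im_inj => /=; ring.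
  by rewrite raddfB /=; ring.
by rewrite !cint_cst// !raddfB /=; ring.
Qed.

Lemma nested_intervals (l u : nat -> R) : (forall n, l n <= l n.+1) ->
  (forall n, u n.+1 <= u n) -> (forall n, l n <= u n) ->
  exists p, forall n, l n <= p <= u n.
Proof.
move=> li ud lu.
have lm m n : (m <= n)%N -> l m <= l n.
  by move=> /subnK <-; elim: (n - m)%N => // k IH; rewrite addSn (le_trans IH).
have um m n : (m <= n)%N -> u n <= u m.
  by move=> /subnK <-; elim: (n - m)%N => // k IH; rewrite addSn (le_trans _ IH).
have ub n : ubound (range l) (u n).
  move=> _ [m _ <-]; apply: (@le_trans _ _ (l (maxn m n))).
    by apply: lm; exact: leq_maxl.
  by apply: le_trans (lu _) _; apply: um; exact: leq_maxr.
have hs : has_sup (range l) by split; [exists (l 0%N), 0%N|exists (u 0%N); exact: ub].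
exists (sup (range l)) => n; apply/andP; split.
  by apply: (ub_le_sup hs.2); exists n.
by apply: ge_sup; [exact: hs.1|exact: ub].
Qed.

(** Bisection: one quarter of a rectangle carries at least a quarter of the integral. Near the
    common point of the nested rectangles [f] is affine up to e times the distance, and affine
    functions integrate to 0, so the n-th integral is at most a constant times e / 4^n. This
    contradicts the lower bound kap / 4^n once e is small. *)
Theorem goursat f a b c d : a <= b -> c <= d ->
  (forall z, rect a b c d z -> differentiable f z) -> rint f a b c d = 0.
Proof.
move=> ab cd df.
have cf : ccont (rect a b c d) f.
  by move=> z /df; exact: differentiable_continuous.
apply/eqP; rewrite -absC_eq0 -[_ == 0]negbK; apply/negP => k0.
set kap := absC _ in k0.
have kap0 : 0 < kap by rewrite lt_def k0 absC_ge0.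
pose w n := (b - a) / 2 ^+ n; pose h n := (d - c) / 2 ^+ n.
have p2 n : 0 < 2 ^+ n :> R by rewrite exprn_gt0.
have w0 n : 0 <= w n by rewrite divr_ge0 ?subr_ge0// ltW.
have h0 n : 0 <= h n by rewrite divr_ge0 ?subr_ge0// ltW.
have wS n : w n = w n.+1 + w n.+1.
  by rewrite /w exprS; field; rewrite gt_eqF.
have hS n : h n = h n.+1 + h n.+1.
  by rewrite /h exprS; field; rewrite gt_eqF.
(* [s] is the lower left corner of an n-th generation rectangle that carries at least its share of
   the integral. *)
pose bad n (s : R * R) := [/\ a <= s.1, s.1 + w n <= b, c <= s.2, s.2 + h n <= d &
  kap / 4 ^+ n <= absC (rint f s.1 (s.1 + w n) s.2 (s.2 + h n))].
have step n (s : R * R) : exists t : R * R, bad n s -> [/\ bad n.+1 t,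
    s.1 <= t.1, t.1 + w n.+1 <= s.1 + w n, s.2 <= t.2 & t.2 + h n.+1 <= s.2 + h n].
  have [[as_ sb cs sd ks]|nb] := pselect (bad n s); last by exists s.
  have cfs : ccont (rect s.1 (s.1 + w n) s.2 (s.2 + h n)) f.
    by move=> z zs; apply: cf; exact: (rect_sub as_ sb cs sd).
  have [W0 H0] := (w0 n.+1, h0 n.+1).
  have E1 := @rint_vsplit f s.1 (s.1 + w n.+1) (s.1 + w n) s.2 (s.2 + h n) _ _ _ cfs.
  have lx : s.1 <= s.1 + w n.+1 by rewrite lerDl.
  have lx' : s.1 + w n.+1 <= s.1 + w n by rewrite (wS n) addrA lerDl.
  have ly : s.2 <= s.2 + h n.+1 by rewrite lerDl.
  have ly' : s.2 + h n.+1 <= s.2 + h n by rewrite (hS n) addrA lerDl.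
  have {}E1 := E1 lx lx' (le_trans ly ly').
  have cf1 : ccont (rect s.1 (s.1 + w n.+1) s.2 (s.2 + h n)) f.
    by move=> z zs; apply: cfs; apply: (rect_sub _ _ _ _ zs).
  have cf2 : ccont (rect (s.1 + w n.+1) (s.1 + w n) s.2 (s.2 + h n)) f.
    by move=> z zs; apply: cfs; apply: (rect_sub _ _ _ _ zs).
  have E2 := rint_hsplit ly ly' lx cf1.
  have E3 := rint_hsplit ly ly' lx' cf2.
  have XE : s.1 + w n = (s.1 + w n.+1) + w n.+1 by rewrite (wS n) addrA.
  have YE : s.2 + h n = (s.2 + h n.+1) + h n.+1 by rewrite (hS n) addrA.
  have K4 : kap / 4 ^+ n = 4 * (kap / 4 ^+ n.+1).
    by rewrite exprS; field; rewrite gt_eqF// exprn_gt0.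
  apply: contrapT => /forallNP nt.
  have small (x y : R) : (x = s.1 \/ x = s.1 + w n.+1) -> (y = s.2 \/ y = s.2 + h n.+1) ->
      absC (rint f x (x + w n.+1) y (y + h n.+1)) < kap / 4 ^+ n.+1.
    move=> xs ys; rewrite ltNge; apply/negP => big; apply: (nt (x, y)) => _ /=.
    have x1 : s.1 <= x by case: xs => ->.
    have x2 : x + w n.+1 <= s.1 + w n by case: xs => ->//; rewrite -XE.
    have y1 : s.2 <= y by case: ys => ->.
    have y2 : y + h n.+1 <= s.2 + h n by case: ys => ->//; rewrite -YE.
    split => //; split => //=.
    - exact: le_trans as_ x1.
    - exact: le_trans x2 sb.
    - exact: le_trans cs y1.
    - exact: le_trans y2 sd.
  have s1 := small s.1 s.2 (or_introl erefl) (or_introl erefl).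
  have s2 := small s.1 _ (or_introl erefl) (or_intror erefl).
  have s3 := small _ s.2 (or_intror erefl) (or_introl erefl).
  have s4 := small _ _ (or_intror erefl) (or_intror erefl).
  rewrite -XE in s3 s4; rewrite -YE in s2 s4.
  move: ks; rewrite leNgt => /negP; apply.
  rewrite E1 E2 E3 K4; apply: le_lt_trans (absCD _ _) _.
  apply: le_lt_trans (lerD (absCD _ _) (absCD _ _)) _.
  by move: s1 s2 s3 s4; lra.
have /choice[F HF] : forall ns : nat * (R * R), exists t : R * R, bad ns.1 ns.2 -> [/\ bad ns.1.+1 t,
    ns.2.1 <= t.1, t.1 + w ns.1.+1 <= ns.2.1 + w ns.1, ns.2.2 <= t.2 &
    t.2 + h ns.1.+1 <= ns.2.2 + h ns.1] by move=> [n s]; exact: step.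
pose s := fix s n := if n is n'.+1 then F (n', s n') else (a, c).
have bads n : bad n (s n).
  elim: n => [|n IH]; last by have [] := HF (n, s n) IH.
  by rewrite /bad /w /h /= !expr0 !divr1 !subrKC !lexx; split.
have HFs n := HF (n, s n) (bads n).
have [p1 Hp1] := @nested_intervals (fun n => (s n).1) (fun n => (s n).1 + w n)
  (fun n => let: And5 _ x _ _ _ := HFs n in x) (fun n => let: And5 _ _ x _ _ := HFs n in x)
  (fun n => ler_wpDr (w0 n) (lexx _)).
have [p2' Hp2] := @nested_intervals (fun n => (s n).2) (fun n => (s n).2 + h n)
  (fun n => let: And5 _ _ _ x _ := HFs n in x) (fun n => let: And5 _ _ _ _ x := HFs n in x)
  (fun n => ler_wpDr (h0 n) (lexx _)).
pose p := p1 +i* p2'.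
have pr : rect a b c d p.
  have := Hp1 0%N; have := Hp2 0%N.
  by rewrite /w /h /= !expr0 !divr1 !subrKC; split.
have /differentiable_cdiff[l Hl] := df p pr.
pose S := (b - a) + (d - c).
have S0 : 0 <= S by rewrite addr_ge0 ?subr_ge0.
(* [rint_bound] will give 4 e S^2 / 4^n, and this choice makes 4 e S^2 smaller than [kap]. *)
pose e := kap / (8 * (S ^+ 2 + 1)).
have q0 : 0 < 8 * (S ^+ 2 + 1) by have := sqr_ge0 S; lra.
have e0 : 0 < e by rewrite divr_gt0.
have [r r0 Hr] := Hl e e0.
pose n := (Num.truncn (S / r)).+1.
have Sn : S / 2 ^+ n < r.
  rewrite ltr_pdivrMr// -ltr_pdivrMl// mulrC; apply: lt_le_trans (truncnS_gt _) _.
  by rewrite -natrX ler_nat ltnW// ltn_expl.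
have [as_ sb cs sd ks] := bads n.
have del : w n + h n = S / 2 ^+ n by rewrite /w /h -mulrDl.
have cfs : ccont (rect (s n).1 ((s n).1 + w n) (s n).2 ((s n).2 + h n)) f.
  by move=> z zs; apply: cf; exact: (rect_sub as_ sb cs sd).
have W0 := w0 n; have H0 := h0 n.
have lx : (s n).1 <= (s n).1 + w n by rewrite lerDl.
have ly : (s n).2 <= (s n).2 + h n by rewrite lerDl.
(* Subtracting the first-order expansion at [p] leaves the integral unchanged and makes the
   integrand of order e times the distance to [p]. *)
pose g z := f z - f p - l * (z - p).
have fE : (fun z => f z) = (fun z => 1 * g z + (l * z + (f p - l * p))).
  by apply/funext => z; rewrite /g; ring.
have cg : ccont (rect (s n).1 ((s n).1 + w n) (s n).2 ((s n).2 + h n)) g.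
  move=> z zs; have -> : g = (fun z => f z + (- l * z + (l * p - f p))).
    by apply/funext => y; rewrite /g; ring.
  exact: (cvgD (cfs z zs) (@affine_continuous (- l) (l * p - f p) z)).
have gE : rint f (s n).1 ((s n).1 + w n) (s n).2 ((s n).2 + h n) =
    rint g (s n).1 ((s n).1 + w n) (s n).2 ((s n).2 + h n).
  rewrite [f in LHS]fE rint_lin//; first by rewrite rint_affine// addr0 mul1r.
    by move=> z zs _; exact: cg.
  by move=> z _ _; exact: affine_continuous.
have gb z : rect (s n).1 ((s n).1 + w n) (s n).2 ((s n).2 + h n) z ->
    absC (g z) <= e * (S / 2 ^+ n).
  move=> [/andP[z1 z2] /andP[z3 z4]].
  have zp : absC (z - p) <= S / 2 ^+ n.
    apply: le_trans (absC_le _) _; rewrite cReB cImB /= -del.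
    have /andP[q1 q2] := Hp1 n; have /andP[q3 q4] := Hp2 n.
    by apply: lerD; rewrite ler_norml; apply/andP; split; lra.
  have := Hr (z - p) (le_lt_trans zp Sn); rewrite subrKC => h1.
  by apply: le_trans h1 _; rewrite ler_wpM2l// ltW.
have := rint_bound lx ly cg gb; rewrite -gE => B.
have := le_trans ks B.
have -> : (s n).1 + w n - (s n).1 = w n by rewrite addrC addKr.
have -> : (s n).2 + h n - (s n).2 = h n by rewrite addrC addKr.
rewrite del; apply/negP; rewrite -ltNge.
have -> : 4 * (e * (S / 2 ^+ n)) * (S / 2 ^+ n) = (4 * e * S ^+ 2) / 4 ^+ n.
  have -> : 4 ^+ n = 2 ^+ n * 2 ^+ n :> R by rewrite -exprMn; congr (_ ^+ _); ring.
  by field; rewrite gt_eqF.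
rewrite ltr_pM2r ?invr_gt0 ?exprn_gt0//.
have -> : 4 * e * S ^+ 2 = kap * (4 * S ^+ 2 / (8 * (S ^+ 2 + 1))) by rewrite /e; ring.
rewrite gtr_pMr// ltr_pdivrMr// mul1r; have := sqr_ge0 S; lra.
Qed.

End rectangle_integral.

(** * Goursat's theorem with an exceptional point *)

Section cauchy_rectangle.
Variable R : realType.
Local Notation C := R[i].
Local Notation leb := (@lebesgue_measure R).
Implicit Types (a b c d r : R) (f g : C -> C) (w z : C).

(** Four strips around a small square centred at [w] avoid [w] and contribute 0; the integral over
    the square tends to 0 with its side, [f] being bounded near [w]. *)
Lemma goursat_excised f a b c d w :
  a < complex.Re w < b -> c < complex.Im w < d ->
  ccont (rect a b c d) f ->
  (forall z, rect a b c d z -> z != w -> differentiable f z) ->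
  rint f a b c d = 0.
Proof.
move=> /andP[aw wb] /andP[cw wd] cf df.
have wr : rect a b c d w by split; rewrite !ltW.
set w1 := complex.Re w in aw wb; set w2 := complex.Im w in cw wd.
have center s : 0 < s -> a <= w1 - s -> w1 + s <= b -> c <= w2 - s -> w2 + s <= d ->
    rint f a b c d = rint f (w1 - s) (w1 + s) (w2 - s) (w2 + s).
  move=> s0 as_ sb cs sd.
  have l1 : w1 - s <= w1 + s by lra.
  have l2 : w2 - s <= w2 + s by lra.
  have ab : a <= b by lra.
  have cd : c <= d by lra.
  have m1 : w1 - s <= b by lra.
  have m2 : w2 - s <= d by lra.
  have sub a' b' c' d' : a <= a' -> b' <= b -> c <= c' -> d' <= d ->
      ccont (rect a' b' c' d') f.
    by move=> ? ? ? ? z zs; apply: cf; apply: (rect_sub _ _ _ _ zs).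
  have zero a' b' c' d' : a <= a' -> b' <= b -> c <= c' -> d' <= d -> a' <= b' -> c' <= d' ->
      ~ rect a' b' c' d' w -> rint f a' b' c' d' = 0.
    move=> ? ? ? ? ? ? nw; apply: goursat => // z zs; apply: df.
      exact: (rect_sub _ _ _ _ zs).
    by apply/eqP => zw; apply: nw; rewrite -zw.
  have cf1 : ccont (rect (w1 - s) b c d) f by apply: sub.
  have cf2 : ccont (rect (w1 - s) (w1 + s) c d) f by apply: sub.
  have cf3 : ccont (rect (w1 - s) (w1 + s) (w2 - s) d) f by apply: sub.
  have Z1 : rint f a (w1 - s) c d = 0.
    by apply: zero => // -[/andP[_]]; rewrite -/w1; lra.
  have Z2 : rint f (w1 + s) b c d = 0.
    apply: zero => //; first by lra.
    by move=> [/andP[]]; rewrite -/w1; lra.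
  have Z3 : rint f (w1 - s) (w1 + s) c (w2 - s) = 0.
    by apply: zero => // -[_ /andP[_]]; rewrite -/w2; lra.
  have Z4 : rint f (w1 - s) (w1 + s) (w2 + s) d = 0.
    apply: zero => //; first by lra.
    by move=> [_ /andP[]]; rewrite -/w2; lra.
  rewrite (rint_vsplit as_ m1 cd cf) Z1 add0r.
  rewrite (rint_vsplit l1 sb cd cf1) Z2 addr0.
  rewrite (rint_hsplit cs m2 l1 cf2) Z3 add0r.
  by rewrite (rint_hsplit l2 sd l1 cf3) Z4 addr0.
apply/eqP; rewrite -absC_eq0 eq_le absC_ge0 andbT.
have /cvgC_absP/(_ 1 ltr01) := cf w wr.
move=> /nbhs_ballP[_ /pos_real_complex[e e0 ->]]; rewrite -ball_normE => He.
apply/ler_addgt0Pl => eta eta0; rewrite addr0.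
set M := absC (f w) + 1.
have M0 : 0 < M by rewrite ltr_wpDl// absC_ge0.
(* The square has half side [s]: the bound s *+ 2 < e keeps it where [f] is within 1 of [f w], and
   16 M s is the value of [rint_bound] for sides 2 s. *)
have [s [s0 [s1 [s2 [s3 [s4 [s5 s6]]]]]]] : exists s : R, 0 < s /\ a <= w1 - s /\
    w1 + s <= b /\ c <= w2 - s /\ w2 + s <= d /\ s *+ 2 < e /\ 16 * M * s <= eta.
  pose s := Num.min (Num.min (Num.min (w1 - a) (b - w1)) (Num.min (w2 - c) (d - w2)))
     (Num.min (e / 4) (eta / (16 * M))).
  have : 0 < s.
    rewrite /s !lt_min !subr_gt0 aw wb cw wd /= !divr_gt0//.
    by rewrite mulr_gt0.
  have : s <= s by [].
  rewrite {2}/s !le_min => /andP[/andP[/andP[h1 h2] /andP[h3 h4]] /andP[h5 h6]] s0.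
  exists s; do 5?[split; first lra].
  split; first by lra.
  by move: h6; rewrite ler_pdivlMr ?mulr_gt0// mulrC.
rewrite (center s)//; apply: le_trans s6.
have l1 : w1 - s <= w1 + s by lra.
have l2 : w2 - s <= w2 + s by lra.
apply: le_trans (@rint_bound _ f _ _ _ _ M l1 l2 _ _) _.
- by move=> z zs; apply: cf; apply: (rect_sub _ _ _ _ zs).
- move=> z [/andP[z1 z2] /andP[z3 z4]].
  have : absC (f w - f z) < 1.
    apply: He; rewrite /= normCE ltcR.
    apply: le_lt_trans (absC_le _) (le_lt_trans _ s5).
    rewrite cReB cImB mulr2n lerD// ler_norml -/w1 -/w2; lra.
  move=> h; rewrite /M; apply: le_trans (_ : absC (f w) + absC (f z - f w) <= _).
    by rewrite -{1}(subrK (f w) (f z)) addrC absCD.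
  by rewrite lerD2l ltW// -absCN opprB.
- by rewrite le_eqVlt; apply/orP; left; apply/eqP; ring.
Qed.


End cauchy_rectangle.

(** * The sub-mean-value estimate *)

(** Serves for functions altered away from [x]: difference quotients filled in at one point, and
    extensions by 0 from an open set. *)
Lemma differentiable_near (K : numFieldType) (V W : normedModType K) (f g : V -> W) (x : V) :
  {near x, f =1 g} -> differentiable f x -> differentiable g x.
Proof.
move=> fg df; have [dfc dfx] := (diff_locallyP x f).1 df.
have gx : g x = f x by rewrite (nbhs_singleton fg).
have Hg : g \o shift x = cst (g x) + 'd f x +o_ 0 id.
  apply/eqaddoP => _/posnumP[e].
  have := (@eqaddoP _ _ _ _ _ _ _ _).1 dfx e%:num [gt0 of e%:num].
  have : \forall h \near (0 : V), f (h + x) = g (h + x).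
    by have := fg; rewrite (near_shift 0) subr0; apply: filterS => h /=.
  apply: filterS2 => h E /=.
  by rewrite gx /= !fctE /= E.
apply/diff_locallyP; rewrite (diff_unique dfc Hg).
by split.
Qed.

(** * Cauchy's formula on rectangles, with a lower bound for the winding integral *)

Section cauchy_rectangle.
Variable R : realType.
Local Notation C := R[i].
Local Notation leb := (@lebesgue_measure R).
Implicit Types (a b c d r : R) (f g : C -> C) (w z : C).

(** The value [l] fills the gap at [w]; for the derivative of [f] at [w] the function becomes
    continuous there. *)
Definition difference_quotient f w l z : C :=
  if z == w then l else (f z - f w) * (z - w)^-1.

Lemma differentiable_subr w z : differentiable (fun x : C => x - w) z.
Proof.
apply/differentiable_cdiff; exists 1 => e e0; exists 1; rewrite ?ltr01// => h _.
have -> : z + h - w - (z - w) - 1 * h = 0 by ring.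
by rewrite absC0 mulr_ge0// ?absC_ge0// ltW.
Qed.


Lemma differentiable_subV w z : z != w -> differentiable (fun x : C => (x - w)^-1) z.
Proof.
rewrite -subr_eq0 => zw.
exact: (differentiableV (differentiable_subr w z) zw).
Qed.

Lemma near_neq w z : z != w -> \forall x \near z, x != w.
Proof.
move=> zw; have := near_absC z (_ : 0 < absC (z - w)).
rewrite absC_gt0 subr_eq0 => /(_ zw); apply: filterS => x.
by apply: contraTneq => ->; rewrite ltxx.
Qed.

Lemma difference_quotient_differentiable f w l z : differentiable f z -> z != w ->
  differentiable (difference_quotient f w l) z.
Proof.
move=> df zw.
have : differentiable ((f - cst (f w)) * (fun x => (x - w)^-1) : C -> C) z.
  apply: differentiableM; first by apply: differentiableB.
  exact: differentiable_subV.
apply: differentiable_near; have := near_neq zw; apply: filterS => x.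
by rewrite /difference_quotient => /negPf ->; rewrite !fctE.
Qed.

Lemma difference_quotient_continuous f w : differentiable f w ->
  exists l, difference_quotient f w l x @[x --> w] --> difference_quotient f w l w.
Proof.
move=> /differentiable_cdiff[l Hl]; exists l.
apply/(cvgC_absP (FF := nbhs_filter w)) => e e0.
have [r r0 Hr] := Hl (e / 2) (divr_gt0 e0 (ltr0Sn _ 1)).
have := near_absC w r0; apply: filterS => x xr.
rewrite /difference_quotient eqxx; have [_|xw] := eqVneq x w.
  by rewrite subrr absC0.
have xw0 : x - w != 0 by rewrite subr_eq0.
move: xr; rewrite absCB => /Hr; rewrite [w + _]addrC subrK => h.
rewrite absCB (_ : _ - l = (f x - f w - l * (x - w)) * (x - w)^-1); last first.
  by rewrite [RHS]mulrBl -[l * _ * _]mulrA divff// mulr1.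
rewrite absCM absCV ltr_pdivrMr ?absC_gt0//.
apply: le_lt_trans h _.
have : 0 < absC (x - w) by rewrite absC_gt0.
set t := absC _; nra.
Qed.

(** On the boundary f(z) / (z - w) is f(w) / (z - w) plus the difference quotient. The latter is
    continuous at [w] and differentiable elsewhere, so [goursat_excised] makes its integral 0. *)
Lemma cauchy_singular_part f a b c d w :
  a < complex.Re w < b -> c < complex.Im w < d ->
  (forall z, rect a b c d z -> differentiable f z) ->
  rint (fun z => f z * (z - w)^-1) a b c d = f w * rint (fun z => (z - w)^-1) a b c d.
Proof.
move=> wab wcd df.
have wr : rect a b c d w.
  by move/andP: wab wcd => [? ?] /andP[? ?]; split; rewrite !ltW.
have [l gl] := difference_quotient_continuous (df w wr).
pose g := difference_quotient f w l.
have ab : a <= b by move/andP: wab => [? ?]; exact/ltW/(lt_trans _ (y := complex.Re w)).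
have cd : c <= d by move/andP: wcd => [? ?]; exact/ltW/(lt_trans _ (y := complex.Im w)).
have dg z : rect a b c d z -> z != w -> differentiable g z.
  by move=> zr; apply: difference_quotient_differentiable; exact: df.
have cg : ccont (rect a b c d) g.
  move=> z zr; have [->|zw] := eqVneq z w; first exact: gl.
  by apply: differentiable_continuous; exact: dg.
have g0 := goursat_excised wab wcd cg dg.
have bd z : complex.Re z = a \/ complex.Re z = b \/
     complex.Im z = c \/ complex.Im z = d -> z != w.
  move=> h; apply/eqP => zw; move: h wab wcd; rewrite zw.
  by case=> [|[|[|]]] ->; rewrite !ltxx ?andbF.
have ci z : rect a b c d z -> complex.Re z = a \/ complex.Re z = b \/
     complex.Im z = c \/ complex.Im z = d -> (x - w)^-1 @[x --> z] --> (z - w)^-1.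
  by move=> _ /bd zw; exact: (differentiable_continuous (differentiable_subV zw)).
have H := rint_lin (f w) ab cd ci (fun z zr _ => cg z zr).
rewrite g0 addr0 in H; rewrite -H.
have E z : z != w -> f z * (z - w)^-1 = f w * (z - w)^-1 + g z.
  by move=> /negPf zw; rewrite /g /difference_quotient zw -mulrDl [f w + _]addrC subrK.
have Eb x y : x = a \/ x = b \/ y = c \/ y = d -> (x +i* y) != w by move=> h; apply: bd.
rewrite /rint; congr (_ + _ * _ - _ - _ * _); congr cint; apply/funext => x; apply: E; apply: Eb; tauto.
Qed.

Lemma cint_mul_Re_ge a b (k : C) (g : R -> C) (m : R) : a <= b -> cont_on a b g ->
  (forall x, a <= x <= b -> m <= complex.Re (k * g x)) ->
  m * (b - a) <= complex.Re (k * cint a b g).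
Proof.
move=> ab cg gm; have c0 := @cont_on_cst R a b 0.
have := cint_lin k cg c0; rewrite cint0 addr0 => <-.
apply: (cint_Re_ge ab (cont_on_lin (c := k) cg c0)).
by move=> x xab; rewrite addr0; exact: gm.
Qed.

(** Since r <= 2 t and |s| <= r, the denominator is at most r t + 2 r t = 3 r t. *)
Lemma inv_component_ge r s t : r / 2 <= t <= r -> - r <= s <= r -> 0 < r ->
  forall D, D = t ^+ 2 + s ^+ 2 -> (4 * r)^-1 <= t / D.
Proof.
move=> /andP[t1 t2] /andP[s1 s2] r0 _ ->.
have t0 : 0 < t by lra.
have D : 0 < t ^+ 2 + s ^+ 2 by rewrite ltr_wpDr ?sqr_ge0// exprn_gt0.
rewrite ler_pdivlMr// ler_pdivrMl ?mulr_gt0//.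
have : t ^+ 2 <= r * t by rewrite expr2 ler_pM2r.
have s0 : 0 <= (r - s) * (r + s) by rewrite mulr_ge0//; lra.
have r2 : r * r <= 2 * (r * t) by rewrite [leRHS]mulrCA ler_pM2l//; lra.
rewrite !expr2; nra.
Qed.

Lemma cReV z : complex.Re z^-1 = complex.Re z / (complex.Re z ^+ 2 + complex.Im z ^+ 2).
Proof. by case: z. Qed.

Lemma cImV z : complex.Im z^-1 = - complex.Im z / (complex.Re z ^+ 2 + complex.Im z ^+ 2).
Proof. by case: z => x y /=; rewrite mulNr. Qed.

(** After multiplication by -i the integrand has on each side real part at least 1 / (4 r), because
    the sides stay at distance between r / 2 and r from [w]. Each side is at least [r] long and so
    contributes at least 1 / 4. *)
Lemma winding_ge1 a b c d w r : 0 < r ->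
  complex.Re w - r <= a <= complex.Re w - r / 2 ->
  complex.Re w + r / 2 <= b <= complex.Re w + r ->
  complex.Im w - r <= c <= complex.Im w - r / 2 ->
  complex.Im w + r / 2 <= d <= complex.Im w + r ->
  1 <= absC (rint (fun z => (z - w)^-1) a b c d).
Proof.
case: w => w1 w2; set w := w1 +i* w2; rewrite /=.
move=> r0 /andP[a1 a2] /andP[b1 b2] /andP[c1 c2] /andP[d1 d2].
have ab : a <= b by lra.
have cd : c <= d by lra.
have cv x y : x != w1 \/ y != w2 -> {for (x +i* y), continuous (fun z : C => (z - w)^-1)}.
  move=> xy; apply: differentiable_continuous; apply: differentiable_subV.
  by apply/eqP => -[xw yw]; move: xy; rewrite xw yw !eqxx; case.
have ch y : y != w2 -> cont_on a b (fun x => ((x +i* y) - w)^-1).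
  move=> yw x _; apply: (cvg_comp (fun x => x +i* y) (fun z => (z - w)^-1) (@cvg_hor R x y)).
  by apply: cv; right.
have cw x : x != w1 -> cont_on c d (fun y => ((x +i* y) - w)^-1).
  move=> xw y _; apply: (cvg_comp (fun y => x +i* y) (fun z => (z - w)^-1) (@cvg_ver R x y)).
  by apply: cv; left.
set m := (4 * r)^-1.
have m0 : 0 < m by rewrite invr_gt0 mulr_gt0.
have S l : r <= l -> 4^-1 <= m * l.
  by move=> rl; rewrite /m invfM -mulrA ler_peMr ?invr_ge0// ler_pdivlMl// mulr1.
have h1 : m * (b - a) <= complex.Re (- 'i * cint a b (fun x => ((x +i* c) - w)^-1)).
  apply: cint_mul_Re_ge ab (ch _ _) _ => [|x /andP[? ?]]; first by lra.
  rewrite cReM cReV cImV /=; set D := _ ^+ 2 + _ ^+ 2.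
  suff : m <= (w2 - c) / D by lra.
  by apply: (@inv_component_ge r (x - w1) (w2 - c) _ _ r0); rewrite ?/D; [lra|lra|ring].
have h2 : m * (d - c) <= complex.Re (1 * cint c d (fun y => ((b +i* y) - w)^-1)).
  apply: cint_mul_Re_ge cd (cw _ _) _ => [|y /andP[? ?]]; first by lra.
  rewrite cReM cReV cImV /=; set D := _ ^+ 2 + _ ^+ 2.
  suff : m <= (b - w1) / D by lra.
  by apply: (@inv_component_ge r (y - w2) (b - w1) _ _ r0); rewrite ?/D; [lra|lra|ring].
have h3 : m * (b - a) <= complex.Re ('i * cint a b (fun x => ((x +i* d) - w)^-1)).
  apply: cint_mul_Re_ge ab (ch _ _) _ => [|x /andP[? ?]]; first by lra.
  rewrite cReM cReV cImV /=; set D := _ ^+ 2 + _ ^+ 2.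
  suff : m <= (d - w2) / D by lra.
  by apply: (@inv_component_ge r (x - w1) (d - w2) _ _ r0); rewrite ?/D; [lra|lra|ring].
have h4 : m * (d - c) <= complex.Re (- 1 * cint c d (fun y => ((a +i* y) - w)^-1)).
  apply: cint_mul_Re_ge cd (cw _ _) _ => [|y /andP[? ?]]; first by lra.
  rewrite cReM cReV cImV /=; set D := _ ^+ 2 + _ ^+ 2.
  suff : m <= (w1 - a) / D by lra.
  by apply: (@inv_component_ge r (y - w2) (w1 - a) _ _ r0); rewrite ?/D; [lra|lra|ring].
have rab : r <= b - a by lra.
have rcd : r <= d - c by lra.
move: (S _ rab) (S _ rcd) => s1 s2.
apply: le_trans (_ : complex.Re (- 'i * rint (fun z => (z - w)^-1) a b c d) <= _); last first.
  apply: le_trans (ler_norm _) _; apply: le_trans (absC_Re _) _.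
  by rewrite absCM absCN absC_i mul1r.
have -> : - 'i * rint (fun z => (z - w)^-1) a b c d =
   - 'i * cint a b (fun x => ((x +i* c) - w)^-1) + 1 * cint c d (fun y => ((b +i* y) - w)^-1) +
   'i * cint a b (fun x => ((x +i* d) - w)^-1) + - 1 * cint c d (fun y => ((a +i* y) - w)^-1).
  have ii : 'i * 'i = -1 :> C by rewrite -expr2 sqr_i.
  rewrite /rint; set I1 := cint _ _ _; set I2 := cint _ _ _; set I3 := cint _ _ _; set I4 := cint _ _ _.
  rewrite !(mulrDr, mulrN, mulNr, mulrA) !ii; ring.
rewrite !cReD; lra.
Qed.

End cauchy_rectangle.

Section sub_mean_value.
Variable R : realType.
Local Notation C := R[i].
Local Notation leb := (@lebesgue_measure R).
Implicit Types (a b c d r : R) (f g : C -> C) (w z : C).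

(** A function above its average everywhere would have too large an integral; the slack [e] makes
    the contradiction strict. *)
Lemma exists_le_average (A : measurableTypeR R -> \bar R) (l u s e : R) : l < u -> 0 < e ->
  measurable_fun setT A -> (forall x, (0 <= A x)%E) ->
  (\int[leb]_x A x <= s%:E)%E ->
  exists2 x, l <= x <= u & (A x <= (s / (u - l) + e)%:E)%E.
Proof.
move=> lu e0 mA A0 As; apply: contrapT => H.
have lt x : l <= x <= u -> ((s / (u - l) + e)%:E <= A x)%E.
  move=> xlu; apply: ltW; rewrite ltNge; apply/negP => h; apply: H.
  by exists x.
have ul : 0 < u - l by rewrite subr_gt0.
have s0 : 0 <= s.
  by rewrite -lee_fin (le_trans _ As)//; apply: integral_ge0 => x _; exact: A0.
have : ((s / (u - l) + e)%:E * (u - l)%:E <= s%:E)%E.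
  apply: le_trans As.
  apply: (@le_trans _ _ (\int[leb]_(x in `[l, u]) A x)%E); last first.
    apply: ge0_subset_integral => //; exact: measurable_itv.
  apply: (@le_trans _ _ (\int[leb]_(x in `[l, u]) (cst (s / (u - l) + e)%:E x))%E).
    rewrite integral_cst; last exact: measurable_itv.
    have E : leb `[l, u] = (u - l)%:E by rewrite lebesgue_measure_itv /= lte_fin lu -EFinB.
    by rewrite -[in leLHS]E lexx.
  apply: ge0_le_integral => //.
  - by move=> x _; rewrite lee_fin addr_ge0 ?divr_ge0// ltW.
  - by apply: measurable_funTS.
rewrite -EFinM lee_fin mulrDl divfK ?gt_eqF// gerDl leNgt.
by rewrite mulr_gt0.
Qed.

Lemma cint_kernel_le a b (h : R -> C) (k : R -> C) (A : measurableTypeR R -> \bar R) r :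
  0 < r -> cont_on a b (fun x => h x * k x) ->
  measurable_fun setT A -> (forall x, (0 <= A x)%E) ->
  (forall x, a <= x <= b -> ((absC (h x))%:E <= A x)%E) ->
  (forall x, a <= x <= b -> absC (k x) <= r) ->
  ((absC (cint a b (fun x => (h x * k x)%R)))%:E <= (2 * r)%:E * \int[leb]_x A x)%E.
Proof.
move=> r0 cg mA A0 hA kr.
apply: le_trans (absC_cint_le cg) _.
rewrite EFinM -muleA lee_pmul2l//.
rewrite -ge0_integralZl//; last by rewrite lee_fin ltW.
apply: (@le_trans _ _ (\int[leb]_(x in `[a, b]) (r%:E * A x))%E); last first.
  apply: ge0_subset_integral => //.
    by apply: measurable_funeM.
  by move=> x _; rewrite mule_ge0// lee_fin ltW.
have mg : measurable_fun `[a, b] (fun x => (absC (h x * k x))%:E).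
  apply: (measurable_int leb); apply: cont_on_integrable => x xab.
  by apply: (cvg_comp _ _ (cg x xab)); exact: continuous_absC.
apply: ge0_le_integral => //.
- by move=> x _; rewrite lee_fin absC_ge0.
- by apply: measurable_funTS; exact: measurable_funeM.
move=> x; rewrite /= in_itv /= => xab.
rewrite absCM mulrC EFinM; apply: lee_pmul.
- by rewrite lee_fin absC_ge0.
- by rewrite lee_fin absC_ge0.
- by rewrite lee_fin kr.
- exact: hA.
Qed.

Lemma absC_subV_le z w r : 0 < r ->
  r / 2 <= `|complex.Re z - complex.Re w| \/ r / 2 <= `|complex.Im z - complex.Im w| ->
  absC (z - w)^-1 <= 2 / r.
Proof.
move=> r0 h; have zw : r / 2 <= absC (z - w).
  case: h => /le_trans; apply.
    by have := absC_Re (z - w); rewrite cReB.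
  by have := absC_Im (z - w); rewrite cImB.
rewrite absCV -[2 / r]invf_div lef_pV2//.
  by rewrite posrE (lt_le_trans _ zw)// divr_gt0.
by rewrite posrE divr_gt0.
Qed.

(** The four sides of a rectangle are picked at distance between r / 2 and r from [w], on lines
    where the integral of [G] is at most about its average 2 s / r, and Cauchy's formula is applied
    to that rectangle. Each side costs 4 / r, namely 2 for the real and imaginary parts times the
    kernel bound 2 / r, so the total is 32 / r^2. A majorant [G] instead of the modulus of [f] makes
    the estimate usable in an induction on the dimension. *)
Lemma sub_mean_value f w r (G : measurableTypeR R * measurableTypeR R -> \bar R) : 0 < r ->
  measurable_fun setT G -> (forall p, (0 <= G p)%E) ->
  let Q := rect (complex.Re w - r) (complex.Re w + r) (complex.Im w - r) (complex.Im w + r) in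
  (forall z, Q z -> differentiable f z) ->
  (forall z, Q z -> ((absC (f z))%:E <= G (complex.Re z, complex.Im z))%E) ->
  ((absC (f w))%:E <= (32 / r ^+ 2)%:E * \int[@lebesgue2 R]_p G p)%E.
Proof.
move=> r0 mG G0 Q df fG.
have I0 : (0 <= \int[@lebesgue2 R]_p G p)%E by apply: integral_ge0 => p _; exact: G0.
have k0 : 0 < 32 / r ^+ 2 by rewrite divr_gt0// exprn_gt0.
have [Ioo|] := eqVneq (\int[@lebesgue2 R]_p G p)%E +oo%E.
  by rewrite Ioo gt0_muley ?lte_fin// leey.
rewrite -ltey => Ifin.
have [s sE] : exists s : R, (\int[@lebesgue2 R]_p G p = s%:E)%E.
  by exists (fine (\int[@lebesgue2 R]_p G p)%E); rewrite fineK// ge0_fin_numE.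
rewrite sE -EFinM lee_fin; apply/ler_addgt0Pr => eta eta0.
pose A y := (\int[leb]_x G (x, y))%E.
pose B x := (\int[leb]_y G (x, y))%E.
have mA : measurable_fun setT A.
  by apply: (@measurable_fun_fubini_tonelli_G _ _ _ _ _ leb G).
have mB : measurable_fun setT B.
  by apply: (@measurable_fun_fubini_tonelli_F _ _ _ _ _ leb G).
have A0 y : (0 <= A y)%E by apply: integral_ge0 => x _; exact: G0.
have B0 x : (0 <= B x)%E by apply: integral_ge0 => y _; exact: G0.
have AS : (\int[leb]_y A y <= s%:E)%E by rewrite -sE (lebesgue2_fubini_swap mG).
have BS : (\int[leb]_x B x <= s%:E)%E by rewrite -sE (lebesgue2_fubini mG).
(* Four sides at 4 / r each turn the slack [e] into [eta]. *)
pose e := eta * r / 16.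
have e0 : 0 < e by rewrite divr_gt0// mulr_gt0.
pose M := s / (r / 2) + e.
set w1 := complex.Re w in Q df fG *; set w2 := complex.Im w in Q df fG *.
have pick (F : measurableTypeR R -> \bar R) l u : measurable_fun setT F -> (forall x, (0 <= F x)%E) ->
    (\int[leb]_x F x <= s%:E)%E -> u - l = r / 2 -> exists2 x, l <= x <= u & (F x <= M%:E)%E.
  move=> mF F0 FS lu; have ltlu : l < u by lra.
  by have := exists_le_average ltlu e0 mF F0 FS; rewrite lu.
have [|c cr cM] := pick A (w2 - r) (w2 - r / 2) mA A0 AS; first by lra.
have [|d dr dM] := pick A (w2 + r / 2) (w2 + r) mA A0 AS; first by lra.
have [|a ar aM] := pick B (w1 - r) (w1 - r / 2) mB B0 BS; first by lra.
have [|b br bM] := pick B (w1 + r / 2) (w1 + r) mB B0 BS; first by lra.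
have [wab wcd] : a < w1 < b /\ c < w2 < d by split; apply/andP; split; lra.
have QS : rect a b c d `<=` Q by apply: rect_sub; lra.
have ab : a <= b by lra.
have cd : c <= d by lra.
have dfz z : rect a b c d z -> differentiable f z by move/QS; exact: df.
have E := cauchy_singular_part wab wcd dfz.
pose k z := f z * (z - w)^-1.
have ck z : Q z -> z != w -> {for z, continuous k}.
  move=> zQ zw; apply: differentiable_continuous.
  exact: (differentiableM (df z zQ) (differentiable_subV zw)).
have le1 : absC (f w) <= absC (rint k a b c d).
  rewrite E absCM ler_peMr ?absC_ge0//; apply: (@winding_ge1 _ a b c d w r) => //.
apply: le_trans le1 _.
have side (g : R -> C) (F : measurableTypeR R -> \bar R) l u :
    (forall t, g t' @[t' --> t] --> g t) -> measurable_fun setT F ->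
    (forall t, (0 <= F t)%E) -> (\int[leb]_t F t <= M%:E)%E ->
    (forall t, r / 2 <= `|complex.Re (g t) - w1| \/ r / 2 <= `|complex.Im (g t) - w2|) ->
    (forall t, l <= t <= u -> Q (g t) /\ ((absC (f (g t)))%:E <= F t)%E) ->
    absC (cint l u (fun t => k (g t))) <= 4 / r * M.
  move=> cg mF F0 FM gw gQ; rewrite -lee_fin.
  have r20 : 0 < 2 / r by rewrite divr_gt0.
  apply: (@le_trans _ _ ((2 * (2 / r))%:E * \int[leb]_t F t)%E); last first.
    have -> : 4 / r * M = 2 * (2 / r) * M by ring.
    by rewrite [leRHS]EFinM lee_pmul2l// lte_fin mulr_gt0.
  apply: (cint_kernel_le r20 _ mF F0) => [t /gQ[gtQ _]|t /gQ[]//|t _].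
    apply: (cvg_comp g k (cg t)); apply: ck gtQ _; apply/eqP => gtw.
    by have := gw t; rewrite gtw /w1 /w2 !subrr !normr0; case; rewrite leNgt divr_gt0.
  exact: absC_subV_le.
have hor y : w2 - r <= y <= w2 + r -> r / 2 <= `|y - w2| -> (A y <= M%:E)%E ->
    absC (cint a b (fun x => k (x +i* y))) <= 4 / r * M.
  move=> yr yw AM; apply: (side (fun x => x +i* y) (fun x => G (x, y))) => //.
  - by move=> x; exact: cvg_hor.
  - by apply: measurableT_comp => //; exact: measurable_pair2.
  - by move=> x; right.
  - move=> x xab; have xQ : Q (x +i* y) by split => //=; lra.
    by split => //; exact: (fG _ xQ).
have ver x : w1 - r <= x <= w1 + r -> r / 2 <= `|x - w1| -> (B x <= M%:E)%E ->
    absC (cint c d (fun y => k (x +i* y))) <= 4 / r * M.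
  move=> xr xw BM; apply: (side (fun y => x +i* y) (fun y => G (x, y))) => //.
  - by move=> y; exact: cvg_ver.
  - by apply: measurableT_comp => //; exact: measurable_pair1.
  - by move=> y; left.
  - move=> y yab; have yQ : Q (x +i* y) by split => //=; lra.
    by split => //; exact: (fG _ yQ).
have hc : absC (cint a b (fun x => k (x +i* c))) <= 4 / r * M.
  by apply: hor cM; [lra|rewrite ler0_norm; lra].
have hd : absC (cint a b (fun x => k (x +i* d))) <= 4 / r * M.
  by apply: hor dM; [lra|rewrite ger0_norm; lra].
have ha : absC (cint c d (fun y => k (a +i* y))) <= 4 / r * M.
  by apply: ver aM; [lra|rewrite ler0_norm; lra].
have hb : absC (cint c d (fun y => k (b +i* y))) <= 4 / r * M.
  by apply: ver bM; [lra|rewrite ger0_norm; lra].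
have -> : 32 / r ^+ 2 * s + eta = 4 / r * M + 4 / r * M + 4 / r * M + 4 / r * M.
  by rewrite /M /e; field; rewrite gt_eqF.
rewrite /rint.
apply: le_trans (absCD _ _) _; rewrite absCN absCM absC_i mul1r lerD//.
apply: le_trans (absCD _ _) _; rewrite absCN lerD//.
apply: le_trans (absCD _ _) _; rewrite absCM absC_i mul1r lerD//.
Qed.

End sub_mean_value.

(** * From one complex variable to cubes in several *)

Section cube_mean_value.
Variable R : realType.
Local Notation C := R[i].

Definition cube n (w : 'rV[C]_n) (r : R) : set 'rV[C]_n :=
  [set z | forall j, `|complex.Re (z ord0 j) - complex.Re (w ord0 j)| <= r /\
                     `|complex.Im (z ord0 j) - complex.Im (w ord0 j)| <= r].

Lemma consC_affine_tail n (p : measurableTypeR R * measurableTypeR R) (v : 'rV[C]_n) :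
  consC (p, v) = \sum_(j < n) v ord0 j *: consC ((0, 0), delta_mx ord0 j) + consC (p, 0).
Proof.
apply/rowP => k; rewrite [RHS]mxE summxE.
case: (unliftP ord0 k) => [i ->|->].
  rewrite !consC_tail mxE addr0 (bigD1 i)//= big1 => [|j ji].
    by rewrite mxE consC_tail mxE !eqxx mulr1 addr0.
  by rewrite mxE consC_tail mxE eqxx eq_sym (negPf ji) mulr0.
rewrite !consC_head big1 ?add0r// => j _.
by rewrite mxE consC_head mulr0.
Qed.

Lemma differentiable_consC_tail n (p : measurableTypeR R * measurableTypeR R) (v : 'rV[C]_n) :
  differentiable (fun v => consC (p, v)) v.
Proof.
have -> : (fun v : 'rV[C]_n => consC (p, v)) =
    \sum_(j < n) (fun v : 'rV[C]_n => v ord0 j *: consC ((0, 0), delta_mx ord0 j)) +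
    cst (consC (p, 0)).
  by apply/funext => x; rewrite !fctE fct_sumE consC_affine_tail.
apply: differentiableD; last exact: differentiable_cst.
apply: differentiable_sum => j; apply: differentiableZl.
exact: differentiable_coord.
Qed.

Lemma differentiable_consC_head n (v : 'rV[C]_n) (z : C) :
  differentiable (fun z => consC ((complex.Re z, complex.Im z), v)) z.
Proof.
have -> : (fun z : C => consC ((complex.Re z, complex.Im z), v)) =
    (fun z => z *: consC ((1, 0), (0 : 'rV[C]_n))) + cst (consC ((0, 0), v)).
  apply/funext => x; rewrite !fctE; apply/rowP => k; rewrite [RHS]mxE [X in _ = X + _]mxE.
  case: (unliftP ord0 k) => [i ->|->].
    by rewrite !consC_tail mxE mulr0 add0r.
  by rewrite !consC_head /= addr0 mulr1; case: x.
apply: differentiableD; last exact: differentiable_cst.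
exact: differentiableZl.
Qed.

Lemma consC_cube n (p q : measurableTypeR R * measurableTypeR R) (v w : 'rV[C]_n) r :
  `|p.1 - q.1| <= r -> `|p.2 - q.2| <= r -> cube w r v ->
  cube (consC (q, w)) r (consC (p, v)).
Proof.
move=> h1 h2 vw j; case: (unliftP ord0 j) => [i ->|->].
  by rewrite !consC_tail; exact: vw.
by rewrite !consC_head.
Qed.

Lemma cube_center n (w : 'rV[C]_n) r : 0 < r -> cube w r w.
Proof. by move=> r0 j; rewrite !subrr !normr0 ltW. Qed.

(** Induction on the dimension: for a fixed first variable the induction hypothesis bounds [u] by an
    integral over the remaining ones, and this integral is the majorant in the one-variable
    estimate. *)
Lemma cube_mean_value r : 0 < r -> forall n (w : 'rV[C]_n) (u : 'rV[C]_n -> C)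
    (G : 'rV[C]_n -> \bar R),
  measurable_fun setT G -> (forall z, (0 <= G z)%E) ->
  (forall z, cube w r z -> differentiable u z) ->
  (forall z, cube w r z -> ((absC (u z))%:E <= G z)%E) ->
  ((absC (u w))%:E <= ((32 / r ^+ 2) ^+ n)%:E * \int[lebesgueC R n]_z G z)%E.
Proof.
move=> r0; elim=> [|n IH] w u G mG G0 du uG.
  rewrite expr0 mul1e integral_dirac//= diracT mul1e.
  have -> : (0 : 'rV[C]_0) = w by apply/rowP => -[].
  by apply: uG; exact: cube_center.
move: w u G mG G0 du uG; elim/rowC_consC => [[w1 w2] w] u G mG G0 du uG.
have k0 : 0 < 32 / r ^+ 2 by rewrite divr_gt0// exprn_gt0.
pose G' p := (((32 / r ^+ 2) ^+ n)%:E * \int[lebesgueC R n]_v G (consC (p, v)))%E.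
have mG' : measurable_fun setT G' by apply: measurable_funeM; exact: measurable_lebesgueC_section.
have Q z : rect (w1 - r) (w1 + r) (w2 - r) (w2 + r) z ->
    `|complex.Re z - w1| <= r /\ `|complex.Im z - w2| <= r.
  by move=> [/andP[? ?] /andP[? ?]]; rewrite !ler_norml; split; lra.
have H := @sub_mean_value R (fun z => u (consC ((complex.Re z, complex.Im z), w))) (w1 +i* w2) r G' r0 mG'.
have E : (\int[@lebesgue2 R]_p G' p = ((32 / r ^+ 2) ^+ n)%:E * \int[lebesgueC R n.+1]_z G z)%E.
  rewrite lebesgueC_fubini// -ge0_integralZl//.
  - exact: measurable_lebesgueC_section.
  - by move=> p _; apply: integral_ge0 => v _; exact: G0.
  - by rewrite lee_fin exprn_ge0// ltW.
rewrite exprS EFinM -muleA -E; apply: H.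
- move=> p; apply: mule_ge0; first by rewrite lee_fin exprn_ge0// ltW.
  by apply: integral_ge0 => v _; exact: G0.
- move=> z /Q[h1 h2].
  apply: (@differentiable_comp _ _ _ _ (fun z : C => consC ((complex.Re z, complex.Im z), w)) u).
    exact: differentiable_consC_head.
  by apply: du; apply: consC_cube => //; exact: cube_center.
- move=> z /Q[h1 h2]; apply: (IH w (fun v => u (consC ((complex.Re z, complex.Im z), v)))).
  + apply: (measurableT_comp (f := G) (g := fun v => consC ((complex.Re z, complex.Im z), v))) => //.
    apply: (measurableT_comp (f := @consC R n) (g := pair (complex.Re z, complex.Im z))).
      exact: measurable_consC.
    exact: measurable_pair1.
  + by move=> v; exact: G0.
  + move=> v vw.
    apply: (@differentiable_comp _ _ _ _ (fun v => consC ((complex.Re z, complex.Im z), v)) u).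
      exact: differentiable_consC_tail.
    by apply: du; exact: consC_cube.
  + by move=> v vw; apply: uG; exact: consC_cube.
Qed.

End cube_mean_value.

(** * Bergman spaces *)

Section bergman_space.
Variables (R : realType) (d : nat).
Local Notation C := R[i].
Local Notation Cd := 'rV[R[i]]_d.
Local Notation m := (lebesgueC R d).
Variable O : set Cd.
Hypothesis oO : open O.
Local Notation H := (bergman_space O).
Local Notation inner := (bergman_inner O).
Implicit Types (u v : Cd -> C).

Let mO : measurable O. Proof. exact: open_measurableC. Qed.

Lemma bergman_cvg u z : H u -> O z -> u x @[x --> z] --> u z.
Proof. by move=> [du _ _] Oz; apply: differentiable_continuous; exact: du. Qed.

Lemma bergman_measurable_comp u (k : C -> R) : continuous k -> H u ->
  measurable_fun O (fun z => k (u z)).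
Proof.
move=> ck Hu; apply: continuous_on_measurable => // z Oz.
by apply: (cvg_comp _ _ (bergman_cvg Hu Oz)); exact: ck.
Qed.

Definition sqint u : R := \int[m]_(z in O) (absC (u z) ^+ 2).

Lemma bergman_sq_measurable u : H u -> measurable_fun O (fun z => (absC (u z) ^+ 2)%:E).
Proof.
move=> Hu; apply/measurable_EFinP; apply: measurable_funX.
by apply: bergman_measurable_comp Hu; exact: continuous_absC.
Qed.

Lemma sqintE u : H u -> (\int[m]_(z in O) (absC (u z) ^+ 2)%:E = (sqint u)%:E)%E.
Proof.
move=> [_ _ fin]; rewrite /sqint /Rintegral fineK// ge0_fin_numE//.
by apply: integral_ge0 => z _; rewrite lee_fin sqr_ge0.
Qed.

Lemma sqint_ge0 u : 0 <= sqint u.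
Proof. by apply: Rintegral_ge0 => z _; rewrite sqr_ge0. Qed.

Lemma bergman_lin a u v : H u -> H v -> H (fun z => a * u z + v z).
Proof.
move=> Hu Hv; have [du u0 iu] := Hu; have [dv v0 iv] := Hv.
have dau z : O z -> differentiable (fun z => a * u z) z.
  by move=> Oz; exact: (differentiableZ a (du z Oz)).
have cau k : continuous k -> measurable_fun O (fun z => k (a * u z) : R).
  move=> ck; apply: continuous_on_measurable => // z Oz.
  by apply: (cvg_comp _ _ (differentiable_continuous (dau z Oz))); exact: ck.
split.
- by move=> z Oz; exact: (differentiableD (dau z Oz) (dv z Oz)).
- by move=> z nOz; rewrite u0// v0// mulr0 addr0.
apply: square_integrable_add => //.
- by apply: cau; exact: continuous_absC.
- by apply: bergman_measurable_comp Hv; exact: continuous_absC.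
- apply: continuous_on_measurable => // z Oz.
  apply: (cvg_comp _ _ (differentiable_continuous (differentiableD (dau z Oz) (dv z Oz)))).
  exact: continuous_absC.
under eq_integral do rewrite absCM exprMn EFinM.
have a0 : (0 <= (absC a ^+ 2)%:E :> \bar R)%E by rewrite lee_fin sqr_ge0.
rewrite ge0_integralZl//; first exact: lte_mul_pinfty.
  exact: bergman_sq_measurable.
by move=> z _; rewrite lee_fin sqr_ge0.
Qed.

Lemma bergman_inner_integrable u v (k : C -> R) : H u -> H v -> continuous k ->
  (forall z, `|k z| <= absC z) -> m.-integrable O (EFin \o (fun z => k (u z * conjc (v z)))).
Proof.
move=> Hu Hv ck kle.
have mk : measurable_fun O (fun z => k (u z * conjc (v z))).
  apply: continuous_on_measurable => // z Oz.
  have c1 : conjc (v x) @[x --> z] --> conjc (v z).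
    by apply: (cvg_comp _ _ (bergman_cvg Hv Oz)); exact: continuous_conjC.
  by apply: (cvg_comp _ _ (cvgM (bergman_cvg Hu Oz) c1)); exact: ck.
apply/integrableP; split; first exact/measurable_EFinP.
apply: (@le_lt_trans _ _ (\int[m]_(z in O) ((absC (u z) ^+ 2)%:E + (absC (v z) ^+ 2)%:E))%E).
  apply: ge0_le_integral => //.
  - apply/measurable_EFinP; exact: measurableT_comp.
  - by apply: emeasurable_funD; exact: bergman_sq_measurable.
  - move=> z _ /=; rewrite -EFinD lee_fin (le_trans (kle _))// absCM absCJ.
    have := sqr_ge0 (absC (u z) - absC (v z)).
    have := absC_ge0 (u z); have := absC_ge0 (v z); nra.
rewrite ge0_integralD//; try exact: bergman_sq_measurable.
- by rewrite !sqintE// -EFinD ltey.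
- by move=> z _; rewrite lee_fin sqr_ge0.
- by move=> z _; rewrite lee_fin sqr_ge0.
Qed.

Lemma innerE u v : inner u v = Cintegral m O (fun z => u z * conjc (v z)).
Proof. by []. Qed.

Lemma Cintegral_Re_integrable u v : H u -> H v ->
  m.-integrable O (EFin \o (fun z => complex.Re (u z * conjc (v z)))).
Proof.
move=> Hu Hv; apply: (bergman_inner_integrable Hu Hv (@continuous_Re R)).
exact: absC_Re.
Qed.

Lemma Cintegral_Im_integrable u v : H u -> H v ->
  m.-integrable O (EFin \o (fun z => complex.Im (u z * conjc (v z)))).
Proof.
move=> Hu Hv; apply: (bergman_inner_integrable Hu Hv (@continuous_Im R)).
exact: absC_Im.
Qed.

Lemma inner_lin a u v w : H u -> H v -> H w ->
  inner (fun z => a * u z + v z) w = a * inner u w + inner v w.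
Proof.
move=> Hu Hv Hw; rewrite !innerE /Cintegral.
have S (p q : R) (f g h : Cd -> R) : m.-integrable O (EFin \o f) ->
    m.-integrable O (EFin \o g) -> m.-integrable O (EFin \o h) ->
    \int[m]_(z in O) (p * f z + (q * g z + h z)) =
    p * \int[m]_(z in O) f z + (q * \int[m]_(z in O) g z + \int[m]_(z in O) h z).
  move=> fi gi hi.
  have pf : m.-integrable O (EFin \o (fun z => p * f z)) by exact: (integrableZl _ p fi).
  have qg : m.-integrable O (EFin \o (fun z => q * g z)) by exact: (integrableZl _ q gi).
  have qgh : m.-integrable O (EFin \o (fun z => q * g z + h z)) by exact: (integrableD _ qg hi).
  by rewrite (RintegralD _ pf qgh)// (RintegralD _ qg hi)// !RintegralZl.
have r1 := Cintegral_Re_integrable Hu Hw; have i1 := Cintegral_Im_integrable Hu Hw.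
have r2 := Cintegral_Re_integrable Hv Hw; have i2 := Cintegral_Im_integrable Hv Hw.
have Er := S (complex.Re a) (- complex.Im a) _ _ _ r1 i1 r2.
have Ei := S (complex.Re a) (complex.Im a) _ _ _ i1 r1 i2.
apply: Re_Im_inj.
  rewrite cReD cReM /= -mulNr -addrA -Er; congr Rintegral.
  by apply/funext => z; rewrite mulrDl -mulrA cReD (cReM a); ring.
rewrite cImD cImM /= -addrA -Ei; congr Rintegral.
by apply/funext => z; rewrite mulrDl -mulrA cImD (cImM a); ring.
Qed.

Lemma inner_conj u v : H u -> H v -> inner v u = conjc (inner u v).
Proof.
move=> Hu Hv; rewrite !innerE /Cintegral; apply: Re_Im_inj => /=.
  by congr Rintegral; apply/funext => z; rewrite !cReM; case: (u z) (v z) => [? ?] [? ?] /=; ring.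
rewrite -mulN1r -RintegralZl//; last exact: Cintegral_Im_integrable.
by congr Rintegral; apply/funext => z; rewrite !cImM; case: (u z) (v z) => [? ?] [? ?] /=; ring.
Qed.

Lemma inner_diag u : inner u u = (sqint u)%:C.
Proof.
rewrite innerE /Cintegral /sqint; apply: Re_Im_inj => /=.
  by congr Rintegral; apply/funext => z; rewrite mulcJ.
rewrite (_ : (fun z => _) = cst 0) ?Rintegral_cst ?mul0r//.
by apply/funext => z; rewrite mulcJ.
Qed.

(** The step t = - (x, h) / (|h|^2 + 1) is nearly the optimal one; the added 1 makes it meaningful
    when h has norm 0. With k = 1 / (|h|^2 + 1) the change of the squared norm is (- 2 k + k^2
    |h|^2) |(x, h)|^2, and k |h|^2 <= 1. *)
Lemma sqint_decrease x h : H x -> H h -> exists t : C,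
  sqint (fun z => t * h z + x z) + absC (inner x h) ^+ 2 / (sqint h + 1) <= sqint x.
Proof.
move=> Hx Hh; set p := inner x h; set q := sqint h.
have q0 : 0 <= q := sqint_ge0 h.
have Q0 : 0 < q + 1 by rewrite ltr_wpDl.
pose k := (q + 1)^-1; pose t := - (p * k%:C); exists t.
set y := (fun z => t * h z + x z).
have Hy : H y by exact: bergman_lin.
have E : inner y y = (sqint x + (- 2 * k + k ^+ 2 * q) * absC p ^+ 2)%:C.
  have hx : inner h x = conjc p by exact: inner_conj.
  have hy : inner h y = conjc t * q%:C + conjc p.
    by rewrite (inner_conj Hy Hh) inner_lin// inner_diag conjcD conjcM conjc_real.
  have xy : inner x y = conjc t * p + (sqint x)%:C.
    by rewrite (inner_conj Hy Hx) inner_lin// inner_diag conjcD conjcM hx conjcK conjc_real.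
  have tE : conjc t = - (conjc p * k%:C).
    rewrite -[in RHS](conjc_real k) -conjcM /t.
    by case: (p * _) => ? ? /=.
  rewrite {1}/y inner_lin// hy xy tE /t.
  have -> : - (p * k%:C) * (- (conjc p * k%:C) * q%:C + conjc p) +
      (- (conjc p * k%:C) * p + (sqint x)%:C) =
    (sqint x)%:C + (- 2 * k%:C + k%:C ^+ 2 * q%:C) * (p * conjc p) by ring.
  by rewrite mulcJ; apply: Re_Im_inj; rewrite /= ?expr2 /=; ring.
have {}E : sqint y = sqint x + (- 2 * k + k ^+ 2 * q) * absC p ^+ 2.
  by move: E; rewrite inner_diag => -[].
rewrite E -/k -addrA gerDl [_ ^+ 2 * k]mulrC -mulrDl mulr_le0_ge0 ?sqr_ge0//.
have kq : k * q <= 1 by rewrite /k mulrC ler_pdivrMr// mul1r lerDl.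
have k0 : 0 <= k by rewrite invr_ge0 ltW.
rewrite expr2; nra.
Qed.

End bergman_space.

Section bergman_estimates.
Variables (R : realType) (d : nat).
Local Notation C := R[i].
Local Notation Cd := 'rV[R[i]]_d.
Local Notation m := (lebesgueC R d).
Variable O : set Cd.
Hypothesis oO : open O.
Local Notation H := (bergman_space O).
Local Notation inner := (bergman_inner O).
Implicit Types (u v : Cd -> C).

Let mO : measurable O. Proof. exact: open_measurableC. Qed.

(** [sqint_decrease] converts near minimality into near orthogonality: a squared norm within 1 / (n
    + 1) of the infimum leaves only that much to gain along any direction in [S]. *)
Lemma minimizing_sequence (S D : set (Cd -> C)) : S `<=` H -> D `<=` H -> D !=set0 ->
  (forall x h t, D x -> S h -> D (fun z => t * h z + x z)) ->
  exists (x_ : nat -> Cd -> C) (M : R), (forall n, D (x_ n)) /\ (forall n, sqint O (x_ n) <= M) /\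
    forall n h, S h -> absC (inner (x_ n) h) ^+ 2 <= (sqint O h + 1) / n.+1%:R.
Proof.
move=> SH DH [x0 Dx0] Dsh.
pose V := [set sqint O x | x in D].
have Vinf : has_inf V.
  by split; [exists (sqint O x0); exists x0|exists 0 => _ [x _ <-]; exact: sqint_ge0].
have /choice[x_ Hx_] : forall n : nat, exists x, D x /\ sqint O x < inf V + n.+1%:R^-1.
  move=> n; have [_ [x Dx <-] lt] := @inf_adherent R V n.+1%:R^-1 ltac:(by rewrite invr_gt0) Vinf.
  by exists x.
exists x_, (inf V + 1); split; first by move=> n; case: (Hx_ n).
split=> [n|n h Sh].
  have [_ /ltW lt] := Hx_ n; apply: le_trans lt _.
  by rewrite lerD2l invf_le1 ?ler1n.
have [Dx lt] := Hx_ n; have [t Ht] := sqint_decrease oO (DH _ Dx) (SH _ Sh).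
have low : inf V <= sqint O (fun z => t * h z + x_ n z).
  apply: ge_inf; first by case: Vinf.
  by exists (fun z => t * h z + x_ n z) => //; exact: Dsh.
have q0 : 0 < sqint O h + 1 by rewrite ltr_wpDl// sqint_ge0.
have : absC (inner (x_ n) h) ^+ 2 / (sqint O h + 1) <= n.+1%:R^-1.
  rewrite -(lerD2l (inf V)); apply: le_trans (ltW lt); apply: le_trans Ht.
  by rewrite lerD2r.
by rewrite ler_pdivrMr// mulrC.
Qed.

Lemma uniform_cube (K : set Cd) : compact K -> K `<=` O ->
  exists2 r : R, 0 < r & forall w, K w -> cube w r `<=` O.
Proof.
move=> cK KO.
apply: (@compact_directed _ K R [set r | 0 < r] (fun r w => cube w r `<=` O)) => //.
- by exists 1 => /=.
- move=> r s /= r0 s0; exists (Num.min r s); first by rewrite /= lt_min r0 s0.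
  move=> w [] h z wz; apply: h => j; have [h1 h2] := wz j.
    by move: h1 h2; rewrite !le_min => /andP[? _] /andP[? _].
  by move: h1 h2; rewrite !le_min => /andP[_ ?] /andP[_ ?].
move=> z Kz; have /nbhs_ballP[_ /pos_real_complex[e e0 ->] zeO] : nbhs z O by apply: open_nbhs_nbhs; split => //; exact: KO.
(* A point within e / 4 of [z] followed by a displacement in a cube of radius e / 8, of modulus at
   most e / 4 per coordinate, stays inside the ball of radius e. *)
exists (e / 8); first by rewrite /= divr_gt0.
have : nbhs z (ball z (e / 4)%:C) by apply: nbhsx_ballx; rewrite ltcR divr_gt0.
apply: filterS => w [_ zw] x wx; apply: zeO; split => [|i j]; first by rewrite ltcR.
have := zw i j; rewrite (ord1 i) -!ball_normE /= !normCE !ltcR => h.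
have [h1 h2] := wx j.
have := absCD (z ord0 j - w ord0 j) (w ord0 j - x ord0 j).
rewrite addrA subrK => h3; apply: le_lt_trans h3 _.
have := absC_le (w ord0 j - x ord0 j); rewrite cReB cImB (distrC (complex.Re (w _ _))) (distrC (complex.Im (w _ _))).
lra.
Qed.

(** The mean value estimate is applied to the square of [u], which is again holomorphic, so that its
    integral majorant is the squared norm. *)
Lemma bergman_local_bound (K : set Cd) : compact K -> K `<=` O ->
  exists2 M : R, 0 <= M & forall u w, H u -> K w -> absC (u w) ^+ 2 <= M * sqint O u.
Proof.
move=> cK KO; have [r r0 Hr] := uniform_cube cK KO.
exists ((32 / r ^+ 2) ^+ d); first by rewrite exprn_ge0// divr_ge0// exprn_ge0// ltW.
move=> u w Hu Kw; rewrite -lee_fin [leRHS]EFinM -sqintE// integral_mkcond.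
have -> : absC (u w) ^+ 2 = absC ((u * u) w) by rewrite !fctE absCM.
apply: (cube_mean_value r0).
- by apply/(measurable_restrictT _ mO); exact: bergman_sq_measurable.
- by move=> z; apply: erestrict_ge0 => x _; rewrite lee_fin sqr_ge0.
- move=> z /(Hr w Kw) Oz; have [du _ _] := Hu.
  exact: (differentiableM (du z Oz) (du z Oz)).
- by move=> z /(Hr w Kw) Oz; rewrite patchE mem_set// !fctE absCM.
Qed.

End bergman_estimates.

Section restriction.
Variables (R : realType) (d : nat).
Local Notation C := R[i].
Local Notation Cd := 'rV[R[i]]_d.
Local Notation m := (lebesgueC R d).
Variable O : set Cd.
Implicit Types (f : Cd -> C).

Lemma bounded_coordinates : bounded_set O ->
  exists2 M : R, 0 < M & forall z j, O z -> absC (z ord0 j) <= M.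
Proof.
move=> [M [Mr HM]]; pose e : C := `|M| + 1.
have e0 : 0 < e by rewrite ltr_wpDl.
have eM : M < e by rewrite (le_lt_trans (real_ler_norm Mr))// ltrDl.
have [r r0 rE] : exists2 r : R, 0 < r & e + 1 = r%:C.
  by apply: pos_real_complex; rewrite addr_gt0.
exists r => // z j Oz.
have : ball (0 : Cd) (e + 1) z.
  rewrite -ball_normE /= sub0r normrN; apply: le_lt_trans (HM e eM z Oz) _.
  by rewrite ltrDl.
move=> [_ /(_ ord0 j)]; rewrite -ball_normE /= mxE sub0r normrN rE normCE ltcR.
exact: ltW.
Qed.

Definition zero_extend f : Cd -> C := fun z => if `[< O z >] then f z else 0.

Lemma zero_extendE f z : O z -> zero_extend f z = f z.
Proof. by move=> Oz; rewrite /zero_extend asboolT. Qed.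

Lemma exp_alg_square_integrable f : open O -> bounded_set O -> exp_alg f ->
  (\int[m]_(z in O) (absC (f z) ^+ 2)%:E < +oo)%E.
Proof.
move=> oO bO; have mO := open_measurableC oO.
have [M M0 HM] := bounded_coordinates bO.
have mC g : exp_alg g -> measurable_fun O (fun z => absC (g z)).
  by move=> Eg; apply: measurable_funTS; exact: continuous_measurable_absC (exp_alg_continuous Eg).
elim=> [c a|f1 f2 E1 I1 E2 I2]; last first.
  exact: (square_integrable_add mO (mC _ E1) (mC _ E2) (mC _ (exp_add E1 E2)) I1 I2).
(* [B] pays for the Gaussian factor of [gexp], which is bounded below on the bounded set [O];
   finiteness then follows from [integral_gexp_lty]. *)
pose B := absC c ^+ 2 * expR (\sum_(j < d) M ^+ 2 / 2).
have B0 : 0 <= B by rewrite mulr_ge0 ?sqr_ge0 ?expR_ge0.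
have mg : measurable_fun setT (fun z => (gexp a z)%:E).
  by apply/measurable_EFinP; apply: continuous_borel_measurable; exact: continuous_gexp.
apply: (@le_lt_trans _ _ (\int[m]_(z in O) (B%:E * (gexp a z)%:E))%E).
  apply: ge0_le_integral => //.
  - by move=> z _; rewrite lee_fin sqr_ge0.
  - by apply/measurable_EFinP; apply: measurable_funX; exact: mC (exp_pure c a).
  - by apply: measurable_funTS; exact: measurable_funeM.
  move=> z Oz; rewrite -EFinM lee_fin absCM absC_expC exprMn /B -[leRHS]mulrA.
  rewrite ler_wpM2l ?sqr_ge0// -expRM_natl /gexp -expRD ler_expR.
  have : sqnorm z / 2 <= \sum_(j < d) M ^+ 2 / 2.
    rewrite -mulr_suml ler_pM2r ?invr_gt0// /sqnorm; apply: ler_sum => j _.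
    by rewrite ler_sqr ?nnegrE ?absC_ge0 ?(ltW M0)// HM.
  lra.
rewrite ge0_integralZl//.
- rewrite lte_mul_pinfty ?lee_fin//.
  apply: le_lt_trans (integral_gexp_lty a).
  by apply: ge0_subset_integral => // z _; rewrite lee_fin expR_ge0.
- exact: measurable_funTS.
- by move=> z _; rewrite lee_fin expR_ge0.
Qed.

Lemma bergman_zero_extend f : open O -> bounded_set O -> exp_alg f ->
  bergman_space O (zero_extend f).
Proof.
move=> oO bO Ef; split.
- move=> z Oz; apply: (differentiable_near _ (exp_alg_differentiable z Ef)).
  have : nbhs z O by exact: open_nbhs_nbhs.
  by apply: filterS => x Ox; rewrite zero_extendE.
- by move=> z nOz; rewrite /zero_extend asboolF.
- apply: le_lt_trans (exp_alg_square_integrable oO bO Ef).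
  rewrite le_eqVlt; apply/orP; left; apply/eqP; apply: eq_integral => z.
  by rewrite inE => Oz; rewrite zero_extendE.
Qed.

End restriction.

(** * The determinant identity for Bergman operators *)

Section bergman_case.
Variables (R : realType) (d N : nat).
Local Notation C := R[i].
Local Notation Cd := 'rV[R[i]]_d.
Variables (O K : set Cd) (B : Cd -> Cd -> C) (mu : {charge set Cd -> \bar R[i]}).
Hypothesis oO : open O.
Hypothesis bO : bounded_set O.
Hypothesis kB : is_bergman_kernel O B.
Hypothesis cK : compact K.
Hypothesis KO : K `<=` O.
Hypothesis null_K : charge_null mu (~` K).
Local Notation H := (bergman_space O).
Local Notation L := (cmeasure_integral mu K).
Local Notation Top := (toeplitz B O mu).

Let mK : measurable K. Proof. exact: compact_measurableC. Qed.
Let mO : measurable O. Proof. exact: open_measurableC. Qed.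

(** The reproducing property gives regularity of [B] in its first argument, while the operator
    integrates over the second; Hermitian symmetry exchanges them. For [z] outside [O] the kernel
    functions, extended by 0, vanish. *)
Let b z w : C := if `[< O z >] then conjc (B w z) else 0.

Lemma bergman_kernel_conj z w : O z -> O w -> B z w = conjc (B w z).
Proof.
move=> Oz Ow; have [Hz rz] := kB Oz; have [Hw rw] := kB Ow.
by rewrite (rz _ Hw) (rw _ Hz) (inner_conj oO Hz Hw).
Qed.

Let bE z w : O w -> B z w = b z w.
Proof.
move=> Ow; rewrite /b; case: asboolP => [Oz|nOz]; first exact: bergman_kernel_conj.
by have [[_ + _] _] := kB Ow; apply.
Qed.

Lemma bergman_bmfC u : H u -> bmfC K u.
Proof.
move=> Hu; apply: (continuous_on_bmfC oO KO cK) => z Oz.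
exact: bergman_cvg Hu Oz.
Qed.

Let b_bmfC z : bmfC K (b z).
Proof.
rewrite /b; case: asboolP => [Oz|_]; last exact: bmfC_cst.
by apply: bmfC_conj; apply: bergman_bmfC; have [] := kB Oz.
Qed.

Let b_cvg z w : O w -> b z x @[x --> w] --> b z w.
Proof.
move=> Ow; rewrite /b; case: asboolP => [Oz|_]; last exact: (@continuousC_cst R Cd 0 w).
have [Hz _] := kB Oz.
apply: (cvg_comp _ _ (bergman_cvg Hz Ow)); exact: continuous_conjC.
Qed.

Lemma bergman_toeplitzE u f z : exp_alg f -> (forall w, O w -> u w = f w) ->
  Top u z = L (fun w => b z w * f w).
Proof.
move=> Ef uf; rewrite /toeplitz.
have -> : cmeasure_integral mu O (fun w => B z w * u w) =
    cmeasure_integral mu O (fun w => b z w * f w).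
  by apply: cmeasure_integral_eq => w Ow; rewrite bE// uf.
have c w : O w -> b z x * f x @[x --> w] --> b z w * f w.
  by move=> Ow; apply: (cvgM (b_cvg Ow)); exact: exp_alg_continuous.
apply: cmeasure_integral_negligible => //.
- apply: continuous_on_measurable => // w Ow.
  by apply: (cvg_comp _ _ (c w Ow)); exact: continuous_Re.
- apply: continuous_on_measurable => // w Ow.
  by apply: (cvg_comp _ _ (c w Ow)); exact: continuous_Im.
by apply: charge_null_sub null_K => x [].
Qed.

Let L_conj_lin (u x h : Cd -> C) t : exp_alg u -> H x -> H h ->
  L (fun w => u w * conjc (t * h w + x w)) =
  conjc t * L (fun w => u w * conjc (h w)) + L (fun w => u w * conjc (x w)).
Proof.
move=> Eu Hx Hh; have bu := exp_alg_bmfC cK Eu.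
rewrite -cmeasure_integral_lin//.
- by congr L; apply/funext => w; rewrite conjcD conjcM; ring.
- exact: (bmfC_mul bu (bmfC_conj (bergman_bmfC Hh))).
- exact: (bmfC_mul bu (bmfC_conj (bergman_bmfC Hx))).
Qed.

(* A minimizing sequence of the distance from [v] to the functions orthogonal to
   [u] is asymptotically orthogonal to every kernel function, hence tends to 0
   pointwise, and it is bounded on [K]. *)
Lemma toeplitz0_orthogonal u v : exp_alg u -> H v -> Top u = 0 ->
  L (fun w => u w * conjc (v w)) = 0.
Proof.
move=> Eu Hv Tu0.
(* [S] is the set of functions orthogonal to [u] with respect to [L], and [D] is the coset of [v]
   modulo [S]. *)
pose S := [set s | H s /\ L (fun w => u w * conjc (s w)) = 0].
pose D := [set x | H x /\ L (fun w => u w * conjc (x w)) = L (fun w => u w * conjc (v w))].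
have [||||x_ [Mq [Dx [qx ox]]]] := @minimizing_sequence R d O oO S D.
- by move=> s [].
- by move=> x [].
- by exists v.
- move=> x h t [Hx Lx] [Hh Lh]; split; first exact: bergman_lin.
  by rewrite L_conj_lin// Lh mulr0 add0r.
have Hx n : H (x_ n) by case: (Dx n).
have Lx n : L (fun w => u w * conjc (x_ n w)) = L (fun w => u w * conjc (v w)) by case: (Dx n).
(* For [z] in [O], the vanishing of [Top u] at [z] says that the kernel function at [z] belongs to
   [S]. *)
have SB z : O z -> S (B ^~ z).
  move=> Oz; have [Hz _] := kB Oz; split => //.
  have E : L (fun w => b z w * u w) = 0.
    by rewrite -(bergman_toeplitzE z Eu (fun w _ => erefl)) Tu0.
  by rewrite -[RHS]E; congr L; apply/funext => w; rewrite /b asboolT// mulrC.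
have xle z n : O z -> absC (x_ n z) ^+ 2 <= (sqint O (B ^~ z) + 1) / n.+1%:R.
  move=> Oz; have [_ rz] := kB Oz; rewrite (rz _ (Hx n)).
  exact: ox (SB z Oz).
have [M M0 HM] := bergman_local_bound oO cK KO.
have [Mu HMu] : exists Mu : R, forall w, K w -> absC (u w) <= Mu.
  have cu : continuous (fun w => absC (u w)) by exact: continuous_absCf (exp_alg_continuous Eu).
  have [Mu _ HMu] := continuous_compact_bound cK (fun w _ => cu w).
  by exists Mu => w Kw; exact: le_trans (ler_norm _) (HMu w Kw).
have H0 : (fun n => L (fun w => u w * conjc (x_ n w))) @ \oo --> L (fun=> 0).
  (* The dominating constant uses |x| <= 1 + |x|^2, and |x|^2 <= M Mq holds on [K] by the local
     bound and the bounded norms. *)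
  apply: (cmeasure_integral_cvg (M := Mu * (1 + M * Mq))) => //.
  - move=> n; exact: (bmfC_mul (exp_alg_bmfC cK Eu) (bmfC_conj (bergman_bmfC (Hx n)))).
  - exact: bmfC_cst.
  - move=> n w Kw; rewrite absCM absCJ ler_pM ?absC_ge0 ?HMu//.
    have := HM _ _ (Hx n) Kw; have := ler_wpM2l M0 (qx n).
    have := absC_ge0 (x_ n w); have := sqr_ge0 (absC (x_ n w) - 1).
    nra.
  - move=> w Kw; apply/cvgC_absP => e e0.
    pose c := absC (u w) + 1; have c0 : 0 < c by rewrite ltr_wpDl ?absC_ge0.
    pose q := sqint O (B ^~ w) + 1; have q0 : 0 < q by rewrite ltr_wpDl ?sqint_ge0.
    have k0 : 0 < (e / c) ^+ 2 / q by rewrite divr_gt0// exprn_gt0// divr_gt0.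
    have /cvgrPdist_lt/(_ _ k0) := @cvg_harmonic R.
    apply: filterS => n; rewrite sub0r normrN ger0_norm ?harmonic_ge0// /harmonic /=.
    rewrite ltr_pdivlMr// mulrC => lt.
    rewrite sub0r absCN absCM absCJ.
    have := le_lt_trans (xle w n (KO Kw)) lt.
    rewrite ltr_sqr ?nnegrE ?absC_ge0 ?divr_ge0 ?ltW// ltr_pdivlMr// => {}lt.
    apply: le_lt_trans lt; rewrite mulrC ler_wpM2l ?absC_ge0//.
    by rewrite /c lerDl.
(* The integrals do not depend on [n], as the sequence stays in [D], yet they converge to 0. *)
have Lc : (fun n => L (fun w => u w * conjc (x_ n w))) = fun=> L (fun w => u w * conjc (v w)).
  by apply/funext => n; exact: Lx.
rewrite Lc cmeasure_integral0 in H0.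
exact: (cvg_unique _ (cvg_cst _) H0).
Qed.

Lemma bergman_rank_det0 : has_rank H Top N ->
  forall f g : 'I_N.+1 -> Cd -> C, (forall i, exp_alg (f i)) ->
    (forall i, exp_alg (g i)) ->
    \det (\matrix_(i, j) L (fun x => f i x * conjc (g j x))) = 0.
Proof.
have TE u z : exp_alg u -> Top u z = L (fun w => b z w * u w).
  by move=> Eu; exact: bergman_toeplitzE.
apply: (toeplitz_rank_det0 cK (res := zero_extend O) b_bmfC TE).
- move=> u h Eu Eh Tu0.
  rewrite -[RHS](toeplitz0_orthogonal Eu (bergman_zero_extend oO bO Eh) Tu0).
  by apply: cmeasure_integral_eq => w Kw; rewrite zero_extendE//; exact: KO.
- move=> u Eu; split; first exact: bergman_zero_extend.
  apply/funext => z; rewrite [RHS]TE//.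
  by apply: bergman_toeplitzE => // w Ow; rewrite zero_extendE.
Qed.

End bergman_case.

Theorem theorem1p1 (R : realType) (d N : nat) (hd : (1 <= d)%N) :
  (forall mu : {charge set 'rV[R[i]]_d -> \bar R[i]},
     regular_cmeasure mu -> compact (cmeasure_support mu) ->
     has_rank (@bargmann_space R d)
       (toeplitz (@bargmann_kernel R d) [set: 'rV[R[i]]_d] mu) N ->
     (exists (lam : 'I_N -> R[i]) (z : 'I_N -> 'rV[R[i]]_d),
        forall A, measurable A ->
          mu A = (\sum_(k < N) (lam k)%:E * point_mass R (z k) A)%E) /\
     (abs_continuous_lebesgue mu -> forall A, measurable A -> mu A = 0%E)) /\
  (forall (O : set 'rV[R[i]]_d) (B : 'rV[R[i]]_d -> 'rV[R[i]]_d -> R[i])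
          (mu : {charge set 'rV[R[i]]_d -> \bar R[i]}),
     open O -> connected O -> bounded_set O -> is_bergman_kernel O B ->
     regular_cmeasure mu -> carried_by mu O ->
     compact (cmeasure_support mu) -> cmeasure_support mu `<=` O ->
     has_rank (bergman_space O) (toeplitz B O mu) N ->
     (exists (lam : 'I_N -> R[i]) (z : 'I_N -> 'rV[R[i]]_d),
        (forall k, O (z k)) /\
        forall A, measurable A ->
          mu A = (\sum_(k < N) (lam k)%:E * point_mass R (z k) A)%E) /\
     (abs_continuous_lebesgue mu -> forall A, measurable A -> mu A = 0%E)).

Proof.
(* [P] is where the points have to lie, and [z0] fills the slots beyond the atoms; this is why [P]
   must contain some point. *)
have reps (mu : {charge set 'rV[R[i]]_d -> \bar R[i]}) (P : set 'rV[R[i]]_d) z0 : P z0 ->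
    cmeasure_support mu `<=` P ->
    (exists s : seq 'rV[R[i]]_d, [/\ uniq s, (size s <= N)%N,
       (forall p, p \in s -> cmeasure_support mu p) & charge_null mu (~` [set` s])]) ->
    (exists (lam : 'I_N -> R[i]) (z : 'I_N -> 'rV[R[i]]_d), (forall k, P (z k)) /\
        forall A, measurable A ->
          mu A = (\sum_(k < N) (lam k)%:E * point_mass R (z k) A)%E) /\
     (abs_continuous_lebesgue mu -> forall A, measurable A -> mu A = 0%E).
  move=> Pz0 KP [s [us sN sK ns]]; split; last exact: abs_continuous_points hd us ns.
  have [lam Hlam] := point_mass_representation z0 us sN ns.
  exists lam, (fun k => nth z0 s k); split => // k.
  have [ks|ks] := ltnP k (size s); last by rewrite nth_default.
  by apply: KP; apply: sK; exact: mem_nth.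
split=> [mu _ cK rk|O B mu oO _ bO kB _ _ cK KO rk].
  have nK := @null_outside_support _ _ mu.
  have [|[lam [z [_ Hz]]] ac] := reps mu setT 0 I (fun _ _ => I).
    exact: (det0_points cK nK (bargmann_rank_det0 cK nK rk)).
  by split => //; exists lam, z.
have nK := @null_outside_support _ _ mu.
have pts := det0_points cK nK (bergman_rank_det0 oO bO kB cK KO nK rk).
have [[z0 Oz0]|O0] := pselect (exists z0, O z0); first exact: (reps mu O z0 Oz0 KO pts).
(* An empty [O] offers no filler point. All integrals over it are 0, so the operator is 0 and its
   rank [N] must be 0. *)
have N0 : N = 0%N.
  move: rk; clear - O0; case: N => // n [e [free im]].
  have T0 u : toeplitz B O mu u = 0.
    apply/funext => z; rewrite -[RHS](cmeasure_integral0 mu O) /toeplitz.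
    by apply: cmeasure_integral_eq => w Ow; case: O0; exists w.
  have e0 : e ord0 = 0.
    have : (toeplitz B O mu @` bergman_space O) (e ord0).
      rewrite im; exists (fun k => (k == ord0)%:R) => //.
      rewrite (bigD1 ord0)//= scale1r big1 ?addr0// => k /negPf ->.
      by rewrite scale0r.
    by case=> u _ <-; exact: T0.
  have := free (fun k => (k == ord0)%:R); rewrite (bigD1 ord0)//= e0 scaler0 add0r.
  rewrite big1 => [/(_ erefl ord0)/eqP|k /negPf ->]; last by rewrite scale0r.
  by rewrite eqxx oner_eq0.
(* With N = 0 there are no points to place, so the condition of lying in [O] is vacuous. *)
have [[lam [z [_ Hz]]] ac] := reps mu setT 0 I (fun _ _ => I) pts.
by split => //; exists lam, z; split => // k; move: (ltn_ord k); rewrite {2}N0.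
Qed.
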